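(* Let $T\sim\{X_n\}_{n=1}^\infty$ be a random weighted shift on $\mathcal H$ with $r<R=1$, where $r=\min\operatorname{essran}X_1$ and $R=\max\operatorname{essran}X_1$. Then, almost surely, $T\in\mathbb A_{\aleph_0}$.
   Context: $\mathcal H$ is a complex separable infinite-dimensional Hilbert space with orthonormal basis $\{e_n\}_{n=1}^\infty$. $\{X_n\}_{n=1}^\infty$ are nonnegative, bounded, i.i.d. random variables on a probability space $(\Omega,\mathcal F,\mathbb P)$. Writing $T\sim\{X_n\}$ means that $T=T(\omega)$ is the random unilateral weighted shift $T(\omega)e_n=X_n(\omega)e_{n+1}$, $n\ge1$. $\operatorname{essran}X_1$ is the essential range of $X_1$ (closed support of its law). A dual algebra is a subalgebra $\mathcal A$ of $\mathcal B(\mathcal H)$ containing the identity and closed in the weak* topology ($\mathcal B(\mathcal H)$ being the dual of the trace class $\mathcal C_1$ via $(Z,L)\mapsto\operatorname{tr}(ZL)$). Its predual is $Q_{\mathcal A}=\mathcal C_1/{}^\perp\mathcal A$, where ${}^\perp\mathcal A=\{L\in\mathcal C_1:\operatorname{tr}(ZL)=0\ \forall Z\in\mathcal A\}$; $[L]$ denotes the class of $L\in\mathcal C_1$, and for $x,y\in\mathcal H$, $x\otimes y$ is the rank-one operator $u\mapsto\langle u,y\rangle x$. $\mathcal A$ has property $(\mathbb A_{\aleph_0})$ if for every doubly indexed family $\{[L_{ij}]\}_{i,j\ge0}$ in $Q_{\mathcal A}$ there exist sequences $\{x_i\}_{i\ge0}$, $\{y_j\}_{j\ge0}$ in $\mathcal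 H$ with $[L_{ij}]=[x_i\otimes y_j]$ for all $i,j\ge0$. $\mathbb A_{\aleph_0}$ is the set of operators $A\in\mathcal B(\mathcal H)$ such that the dual algebra generated by $A$ (the weak* closure of the polynomials in $A$) has property $(\mathbb A_{\aleph_0})$. *)

(* Defs.v *)
From HB Require Import structures.
From mathcomp Require Import all_boot all_order all_algebra sesquilinear.
From mathcomp Require Import all_classical all_reals all_analysis.
From mathcomp Require Import complex.

Set Implicit Arguments.
Unset Strict Implicit.
Unset Printing Implicit Defensive.

Import Order.TTheory GRing.Theory Num.Theory numFieldNormedType.Exports.

Local Open Scope classical_set_scope.
Local Open Scope ring_scope.
Local Open Scope complex_scope.

(* The library equips [R[i]^o], but not [R[i]], with its usual topology. *)
HB.instance Definition _ (R : realType) := NormedModule.copy R[i] R[i]^o.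

(* [{dot H for Num.conj}] is linear in its first argument and conjugate-linear
   in the second; completeness is part of [completeNormedModType]. *)
Record hilbertType (R : realType) := HilbertType {
  hilbert_sort :> completeNormedModType R[i];
  inner : {dot hilbert_sort for Num.conj};
  inner_norm : forall x : hilbert_sort, inner x x = `|x| ^+ 2 }.

Notation "''<' x , y >" := (inner _ x y)
  (at level 2, x at level 69, y at level 69, format "''<' x ,  y >")
  : ring_scope.

Section BoundedOperators.
Variables (R : realType) (H : hilbertType R).

(* A linear map between normed spaces is bounded iff it is continuous
   (linear_bounded_continuous). *)
Definition bounded_op : {pred H -> H} :=
  fun A => `[< linear A /\ continuous A >].

Lemma bounded_opP (A : H -> H) :
  reflect (linear A /\ continuous A) (A \in bounded_op).
Proof. exact: asboolP. Qed.

Lemma bounded_op_submod_closed : submod_closed bounded_op.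
Proof.
split=> [|a A B /bounded_opP[linA ctsA] /bounded_opP[linB ctsB]];
  apply/bounded_opP; split.
- by move=> k u v; rewrite -![GRing.zero _]/(0 : H) scaler0 addr0.
- exact: cst_continuous.
- move=> k u v; change (a *: A (k *: u + v) + B (k *: u + v)
    = k *: (a *: A u + B u) + (a *: A v + B v)).
  by rewrite linA linB !scalerDr !scalerA (mulrC a k) addrACA.
- move=> x; apply: cvgD; last exact: ctsB.
  by apply: cvgZr; exact: ctsA.
Qed.

HB.instance Definition _ :=
  GRing.isSubmodClosed.Build _ _ bounded_op bounded_op_submod_closed.

Record bop := Bop { bop_fun :> H -> H; bop_funP : bop_fun \in bounded_op }.

HB.instance Definition _ := [isSub for bop_fun].
HB.instance Definition _ := [Choice of bop by <:].
HB.instance Definition _ := [SubChoice_isSubLmodule of bop by <:].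

Lemma bop_linear (A : bop) : linear A.
Proof. by case/bounded_opP: (bop_funP A). Qed.

Lemma bop_continuous (A : bop) : continuous A.
Proof. by case/bounded_opP: (bop_funP A). Qed.

Lemma id_bounded_op : idfun \in bounded_op.
Proof. by apply/bounded_opP; split=> [k u v|x] //; exact: cvg_id. Qed.

Definition bop_id : bop := Bop id_bounded_op.

Lemma comp_bounded_op (A B : bop) : A \o B \in bounded_op.
Proof.
apply/bounded_opP; split=> [k u v|x]; first by rewrite /= !bop_linear.
by apply: continuous_comp; exact: bop_continuous.
Qed.

Definition bop_comp (A B : bop) : bop := Bop (comp_bounded_op A B).

Definition bop_horner (p : {poly R[i]}) (A : bop) : bop :=
  \sum_(k < size p) p`_k *: iter k (bop_comp A) bop_id.

Lemma inner_le (u y : H) : `|'<u, y>| <= `|u| * `|y|.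
Proof.
have [->|y0] := eqVneq y 0; first by rewrite linear0r normr0 mulr_ge0.
have y2 : '<y, y> != 0 by rewrite inner_norm expf_neq0// normr_eq0.
pose a := '<u, y> / '<y, y>; pose v := u - a *: y.
have ov : '<v, y> = 0 by rewrite linearBl/= linearZl_LR/= divfK ?subrr.
have ua : '<u, y> = a * '<y, y> by rewrite divfK.
have oav : '<v, a *: y> = 0 by rewrite linearZr_LR/= ov mulr0.
have uE : '<u, u> = '<v, v> + `|a| ^+ 2 * '<y, y>.
  rewrite -{1 2}(subrK (a *: y) u) (hnormDd oav).
  by congr (_ + _); exact: dnormZ.
suff : `|'<u, y>| ^+ 2 <= (`|u| * `|y|) ^+ 2.
  by rewrite ler_pXn2r// nnegrE mulr_ge0.
rewrite exprMn -!inner_norm ua normrM.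
rewrite (ger0_norm (dnorm_ge0 _ _)) exprMn expr2 mulrA ler_wpM2r ?dnorm_ge0//.
by rewrite uE lerDr dnorm_ge0.
Qed.

Lemma rank_one_bounded_op (x y : H) :
  (fun u : H => '<u, y> *: x) \in bounded_op.
Proof.
have lin : linear (fun u : H => '<u, y> *: x).
  by move=> k u v; rewrite linearDl linearZl_LR /= scalerDl scalerA.
apply/bounded_opP; split=> //.
pose f : {linear H -> H} := HB.pack (fun u : H => '<u, y> *: x)
  (GRing.isLinear.Build _ _ _ _ _ lin).
apply: (@bounded_linear_continuous _ _ _ f); apply/linear_boundedP.
exists (`|y| * `|x|); split; first by rewrite ger0_real ?mulr_ge0.
move=> M yxM u; rewrite /= normrZ (le_trans (ler_wpM2r _ (inner_le u y)))//.
by rewrite -mulrA mulrC ler_wpM2r// ltW.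
Qed.

(* The operator x (x) y : u |-> <u, y> x. *)
Definition rank_one (x y : H) : bop := Bop (rank_one_bounded_op x y).

End BoundedOperators.

Section TraceClass.
Variables (R : realType) (H : hilbertType R).

Definition orthonormal_basis (e : nat -> H) :=
  (forall i j, '<e i, e j> = (i == j)%:R) /\
  (forall x, series (fun n => '<x, e n> *: e n) @ \oo --> x).

Definition positive_bop (A : bop H) := forall x, 0 <= '<A x, x>.

(* A = |L|, i.e. A is positive and A^2 = L^* L. *)
Definition is_abs (L A : bop H) :=
  positive_bop A /\ forall x y, '<A (A x), y> = '<L x, L y>.

(* Trace and trace class are computed in a fixed orthonormal basis [e]; they do
   not depend on it. *)
Variable e : nat -> H.

Definition bop_trace (L : bop H) : R[i] :=
  limn (series (fun n => '<L (e n), e n>)).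

(* tr |L| < +oo; the terms of the series are nonnegative. *)
Definition trace_class : set (bop H) :=
  [set L | exists2 A, is_abs L A & cvgn (series (fun n => '<A (e n), e n>))].

Definition trace_pairing (Z : bop H) :
    {ptws {L : bop H | trace_class L} -> R[i]} :=
  fun L => bop_trace (bop_comp Z (sval L)).

(* B(H) with the coarsest topology making Z |-> tr (Z L) continuous for every
   trace class operator L. *)
Definition weakstar := initial_topology trace_pairing.

Definition generated_dual_algebra (A : bop H) : set (bop H) :=
  closure ([set bop_horner p A | p in [set: {poly R[i]}]] : set weakstar).

Definition preannihilator (D : set (bop H)) : set (bop H) :=
  [set L | trace_class L /\ forall Z, D Z -> bop_trace (bop_comp Z L) = 0].

(* The class [L] of L in the predual C_1 / preannihilator, as a coset. *)
Definition predual_class (D : set (bop H)) (L : bop H) : set (bop H) :=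
  [set L + N | N in preannihilator D].

Definition property_A_aleph0 (D : set (bop H)) :=
  forall L : nat -> nat -> bop H, (forall i j, trace_class (L i j)) ->
    exists x y : nat -> H, forall i j,
      predual_class D (L i j) = predual_class D (rank_one (x i) (y j)).

Definition A_aleph0 : set (bop H) :=
  [set A | property_A_aleph0 (generated_dual_algebra A)].

End TraceClass.

Section RandomVariables.
Context d (Omega : measurableType d) (R : realType) (P : probability Omega R).

Definition mutually_independent (X : nat -> {RV P >-> R}) :=
  forall (s : seq nat) (B : nat -> set R), uniq s ->
    (forall n, measurable (B n)) ->
    P (\bigcap_(n in [set` s]) (X n @^-1` B n))
    = (\prod_(n <- s) P (X n @^-1` B n))%E.

Definition identically_distributed (X : nat -> {RV P >-> R}) :=
  forall m n (B : set R), measurable B ->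
    distribution P (X m) B = distribution P (X n) B.

(* The closed support of the law of X. *)
Definition essran (X : {RV P >-> R}) : set R :=
  [set x | forall U : set R, open U -> U x -> (0 < distribution P X U)%E].

End RandomVariables.

Definition is_min (R : realType) (A : set R) (r : R) := A r /\ lbound A r.

Definition is_max (R : realType) (A : set R) (r : R) := A r /\ ubound A r.

(* Main.v *)
From HB Require Import structures.
Require Import Defs.
From mathcomp Require Import all_boot all_order all_algebra.
From mathcomp Require Import all_classical all_reals all_analysis.
From mathcomp Require Import measurable_realfun complex sesquilinear.
From mathcomp Require Import ring lra zify.
Import Order.TTheory GRing.Theory Num.Theory numFieldNormedType.Exports.
Local Open Scope classical_set_scope.
Local Open Scope ring_scope.
Local Open Scope complex_scope.
Set Implicit Arguments.
Unset Strict Implicit.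
Unset Printing Implicit Defensive.

(** Write [w n] for the weights [X n omega]. Almost surely all of them lie
    between 0 and 1. As 1 and some number below 1 belong to the essential range
    of the independent weights, runs of any given length of weights arbitrarily close
    to 1 recur arbitrarily far, and the product of the weights over an interval
    tends to 0 as the interval grows ([ae_recurrent_run]). What remains is a
    deterministic statement ([weighted_shift_A_aleph0]).

    A class in the predual of the dual algebra generated by [T] is determined by
    its moments, because polynomials are weak*-dense ([predual_class_eq]). So one
    has to find vectors with [<T ^ k x_i, y_j> = tr (T ^ k L_ij)] for all [i], [j]
    and [k] ([solve_moments]). Three facts carry the solution.

    First, each moment sequence is a sum of correlations, that is of sequences
    [k |-> sum_p u_p conj v_(p + k)] with [u] and [v] finitely supported and with
    summable squared norms ([trace_moments_represented]). Writing [L] as a product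
    of two Hilbert-Schmidt operators gives sums that still involve products of
    weights; these products are the entries of the Gram matrix of explicit unit
    vectors ([gram_wprod]), and expanding them in coordinates removes the weights.

    Secondly, a correlation is exactly of the form [<T ^ k a, b>] with [a] and [b]
    supported in a far away run of weights close to 1, at no essential cost in
    norm: on such a run [T] is similar to the unweighted shift by a diagonal
    operator that is bounded together with its inverse ([place]).

    Thirdly, when [a] and [b] live in different runs, [<T ^ k a, b>] vanishes if [b]
    comes first, and is otherwise the correlation of two vectors which are as
    small as desired if the gap between the runs has a small product of weights
    ([wcorr_gap]).

    The pieces of all the [L_ij] are therefore placed one by one in successive runs,
    and every unwanted cross term is cancelled by placing the opposite correlation
    later ([scheme]). Each [x_i] and [y_j] is an orthogonal sum of pieces. The
    freedom to replace [(u, v)] by [(s u, v / s)] makes all these sums converge at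
    the same time, although no bound is assumed on the family of the [L_ij]
    ([enumerate_pairs]).

    The reduction to moments needs trace class operators to be closed under
    addition, hence polar decompositions and square roots; they are obtained from
    strong limits of explicit iterations. *)


(** * Real-valued norms and scalar sequences *)
Lemma ltr0c (R : realType) (k : R) : (0 < k%:C :> R[i]) = (0 < k).
Proof. exact: ltcR. Qed.

(** The norm of a complex normed module takes its values in the partially
    ordered field [R[i]]; estimates are carried out on its real part, where the
    order is total. *)
Definition rnorm (R : realType) (V : normedModType R[i]) (x : V) : R :=
  complex.Re `|x|.

Section Rnorm.
Variables (R : realType) (V : normedModType R[i]).
Implicit Types x y : V.

Lemma rnormE x : `|x| = (rnorm x)%:C.
Proof. by rewrite /rnorm RRe_real // ger0_real. Qed.

Lemma rnorm_ge0 x : 0 <= rnorm x.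
Proof. by rewrite -ler0c -rnormE. Qed.

Lemma rnormD x y : rnorm (x + y) <= rnorm x + rnorm y.
Proof. by rewrite -lecR rmorphD /= -!rnormE ler_normD. Qed.

Lemma rnormN x : rnorm (- x) = rnorm x.
Proof. by rewrite /rnorm normrN. Qed.

Lemma rnorm_sub x y : rnorm (x - y) = rnorm (y - x).
Proof. by rewrite -rnormN opprB. Qed.

Lemma rnorm_dist x y z : rnorm (x - z) <= rnorm (x - y) + rnorm (y - z).
Proof. by apply: le_trans (rnormD _ _); rewrite addrA subrK. Qed.

Lemma rnorm0 : rnorm (0 : V) = 0.
Proof. by rewrite /rnorm normr0. Qed.

Lemma rnorm_eq0 x : (rnorm x == 0) = (x == 0).
Proof. by rewrite -(normr_eq0 x) rnormE -(inj_eq (@complexI R)). Qed.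

Lemma rnormZ (a : R[i]) x : rnorm (a *: x) = rnorm (a : R[i]) * rnorm x.
Proof. by apply: (@complexI R); rewrite rmorphM /= -!rnormE normrZ. Qed.

Lemma rnorm_sum I (r : seq I) (P : pred I) (F : I -> V) :
  rnorm (\sum_(i <- r | P i) F i) <= \sum_(i <- r | P i) rnorm (F i).
Proof.
elim/big_rec2: _ => [|i y z _ h]; first by rewrite rnorm0.
by apply: le_trans (rnormD _ _) _; rewrite lerD2l.
Qed.

Lemma cvg_rnormP (u : nat -> V) l :
  (u @ \oo --> l) <->
  forall eps : R, 0 < eps -> exists N, forall n, (N <= n)%N ->
    rnorm (u n - l) <= eps.
Proof.
split=> [/cvgrPdist_le h eps e0|h].
  have := h eps%:C; rewrite ltr0c => /(_ e0) [N _ hN].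
  by exists N => n /hN; rewrite /= rnormE lecR rnorm_sub.
apply/cvgrPdist_le => e e0.
have er : (complex.Re e)%:C = e by rewrite RRe_real // gtr0_real.
have e0' : 0 < complex.Re e by rewrite -ltr0c er.
have [N hN] := h _ e0'; exists N => // n /= /hN.
by rewrite rnormE rnorm_sub -{2}er lecR.
Qed.

Lemma cvg_finite_sum I (r : seq I) (f : I -> nat -> V) (l : I -> V) :
  (forall i, f i @ \oo --> l i) ->
  (fun n => \sum_(i <- r) f i n) @ \oo --> \sum_(i <- r) l i.
Proof.
move=> fl; elim: r => [|i r IH].
  by rewrite big_nil; under eq_fun do rewrite big_nil; exact: cvg_cst.
by rewrite big_cons; under eq_fun do rewrite big_cons; exact: cvgD.
Qed.

Lemma rnorm_lim_unique (u : nat -> V) l l' : u @ \oo --> l ->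
  (forall eps : R, 0 < eps -> exists N, forall n, (N <= n)%N ->
    rnorm (u n - l') <= eps) -> l = l'.
Proof. by move=> ul /cvg_rnormP ul'; exact: cvg_unique ul ul'. Qed.

End Rnorm.

Lemma cvgn_rnorm_cauchy (R : realType) (V : completeNormedModType R[i])
  (u : nat -> V) :
  (forall eps : R, 0 < eps -> exists N, forall m n, (N <= m)%N -> (N <= n)%N ->
    rnorm (u m - u n) <= eps) -> cvgn u.
Proof.
move=> h; apply/cauchy_cvgP/cauchy_ballP => e e0.
have er : (complex.Re e)%:C = e by rewrite RRe_real // gtr0_real.
have e0' : 0 < complex.Re e / 2 by rewrite divr_gt0 // -ltr0c er.
have [N hN] := h _ e0'.
exists (u @` [set n | (N <= n)%N], u @` [set n | (N <= n)%N]) => /=.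
  by split; exists N => // n /= Nn; exists n.
move=> [_ _] /= [[m Nm <-] [n Nn <-]]; rewrite -ball_normE /ball_ /= rnormE -er ltcR.
apply: le_lt_trans (hN _ _ Nm Nn) _.
by rewrite ltr_pdivrMr // ltr_pMr -?ltr0c ?er // ltr1n.
Qed.

Section Scalars.
Variable R : realType.
Local Notation C := R[i].
Implicit Types z : C.

Lemma rnormM (a b : C) : rnorm (a * b) = rnorm a * rnorm b.
Proof. exact: (rnormZ a (b : R[i])). Qed.

Lemma rnorm_sqr z : rnorm z ^+ 2 = complex.Re z ^+ 2 + complex.Im z ^+ 2.
Proof.
by apply: (@complexI R); rewrite rmorphXn /= -rnormE add_Re2_Im2.
Qed.

Lemma rnorm_real (a : R) : rnorm (a%:C : C) = `|a|.
Proof.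
apply/eqP; rewrite -(@eqrXn2 _ 2) ?rnorm_ge0 // rnorm_sqr /= expr0n addr0.
by rewrite real_normK // num_real.
Qed.

Lemma rnormJ z : rnorm (Num.conj z : C) = rnorm z.
Proof. by rewrite /rnorm norm_conjC. Qed.

Lemma conj_real (a : R) : Num.conj (a%:C : C) = a%:C.
Proof. exact: conjc_real. Qed.

Lemma conj_realM (a : R) z : Num.conj (a%:C * z) = a%:C * Num.conj z.
Proof. by rewrite rmorphM /= conj_real. Qed.

Lemma mul_conj_rnorm z : z * Num.conj z = ((rnorm z) ^+ 2)%:C.
Proof. by rewrite -normCK rnormE rmorphXn. Qed.

Lemma Re_le_rnorm z : `|complex.Re z| <= rnorm z.
Proof. by rewrite -lecR -rnormE; exact: normc_ge_Re. Qed.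

Lemma Im_le_rnorm z : `|complex.Im z| <= rnorm z.
Proof.
rewrite -(@ler_pXn2r _ 2) ?nnegrE ?rnorm_ge0 // rnorm_sqr real_normK ?num_real//.
by rewrite lerDr sqr_ge0.
Qed.

Lemma rnorm_le_ReIm z : rnorm z <= `|complex.Re z| + `|complex.Im z|.
Proof.
rewrite {1}[z]complexE; apply: le_trans (rnormD _ _) _.
by rewrite rnormM !rnorm_real -[X in X * _](_ : 1 = _) ?mul1r // /rnorm normCi.
Qed.

Lemma real_cauchy (u : nat -> R) :
  (forall eps : R, 0 < eps -> exists N, forall m n, (N <= m)%N -> (N <= n)%N ->
    `|u m - u n| <= eps) ->
  exists l, forall eps : R, 0 < eps -> exists N, forall n, (N <= n)%N ->
    `|u n - l| <= eps.
Proof.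
move=> h; have : cvgn u.
  apply/cauchy_cvgP/cauchy_ballP => e e0.
  have e0' : 0 < e / 2 by rewrite divr_gt0.
  have [N hN] := h _ e0'.
  exists (u @` [set n | (N <= n)%N], u @` [set n | (N <= n)%N]) => /=.
    by split; exists N => // n /= Nn; exists n.
  move=> [_ _] /= [[m Nm <-] [n Nn <-]]; rewrite -ball_normE /ball_ /=.
  by apply: le_lt_trans (hN _ _ Nm Nn) _; lra.
move=> /cvgrPdist_le hl; exists (limn u) => eps /hl[N _ hN].
by exists N => n /hN /=; rewrite distrC.
Qed.

Lemma bounded_monotone_cauchy (u : nat -> R) M :
  (forall n, u n <= u n.+1) -> (forall n, u n <= M) ->
  forall eps : R, 0 < eps -> exists N, forall m n, (N <= m)%N -> (N <= n)%N ->
    `|u m - u n| <= eps.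
Proof.
move=> u_nd uM eps e0.
have : cvgn u.
  apply: nondecreasing_is_cvgn; last by exists M => _ [n _ <-].
  by apply/nondecreasing_seqP.
move=> /cvgrPdist_le/(_ (eps / 2)) []; first by rewrite divr_gt0.
move=> N _ hN; exists N => m n /hN /= h1 /hN /= h2.
move: h1 h2; rewrite !ler_norml => /andP[? ?] /andP[? ?].
by apply/andP; split; lra.
Qed.

Lemma complex_cauchy_cvg (u : nat -> C) :
  (forall eps : R, 0 < eps -> exists N, forall m n, (N <= m)%N -> (N <= n)%N ->
    rnorm (u m - u n) <= eps) -> cvgn u.
Proof.
move=> h.
have hRe : exists l, forall eps : R, 0 < eps -> exists N, forall n, (N <= n)%N ->
    `|complex.Re (u n) - l| <= eps.
  apply: real_cauchy => eps /h [N hN]; exists N => m n Nm Nn.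
  apply: le_trans (hN m n Nm Nn).
  by rewrite -(raddfB (@complex.Re R : Rcomplex R -> R)); exact: Re_le_rnorm.
have hIm : exists l, forall eps : R, 0 < eps -> exists N, forall n, (N <= n)%N ->
    `|complex.Im (u n) - l| <= eps.
  apply: real_cauchy => eps /h [N hN]; exists N => m n Nm Nn.
  apply: le_trans (hN m n Nm Nn).
  by rewrite -(raddfB (@complex.Im R : Rcomplex R -> R)); exact: Im_le_rnorm.
case: hRe hIm => [a ha] [b hb].
apply/cvg_ex; exists (a +i* b); apply/cvg_rnormP => eps e0.
have e2 : 0 < eps / 2 by rewrite divr_gt0.
have [N hN] := ha _ e2; have [M hM] := hb _ e2.
exists (maxn N M) => n; rewrite geq_max => /andP[/hN h1 /hM h2].
apply: le_trans (rnorm_le_ReIm _) _.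
rewrite (raddfB (@complex.Re R : Rcomplex R -> R)).
rewrite (raddfB (@complex.Im R : Rcomplex R -> R)) /=.
by lra.
Qed.

End Scalars.

(** * Inner products and expansions in an orthonormal basis *)
Section Inner.
Variables (R : realType) (H : hilbertType R).
Local Notation C := R[i].
Implicit Types x y z : H.

Lemma innerC x y : '<x, y> = Num.conj '<y, x>.
Proof. by rewrite (hermC (@inner R H)) expr0 mul1r. Qed.

Lemma innerDl x y z : '<x + y, z> = '<x, z> + '<y, z>.
Proof. exact: linearDl. Qed.
Lemma innerDr x y z : '<z, x + y> = '<z, x> + '<z, y>.
Proof. exact: linearDr. Qed.
Lemma innerBl x y z : '<x - y, z> = '<x, z> - '<y, z>.
Proof. exact: linearBl. Qed.
Lemma innerBr x y z : '<z, x - y> = '<z, x> - '<z, y>.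
Proof. exact: linearBr. Qed.
Lemma innerZl (a : C) x z : '<a *: x, z> = a * '<x, z>.
Proof. exact: linearZl_LR. Qed.
Lemma innerZr (a : C) x z : '<z, a *: x> = Num.conj a * '<z, x>.
Proof. exact: linearZr_LR. Qed.
Lemma inner0l z : '<0, z> = 0.
Proof. exact: linear0l. Qed.
Lemma inner0r z : '<z, 0> = 0.
Proof. exact: linear0r. Qed.
Lemma inner_suml I (r : seq I) (P : pred I) (F : I -> H) z :
  '<\sum_(i <- r | P i) F i, z> = \sum_(i <- r | P i) '<F i, z>.
Proof. exact: linear_sumlz. Qed.
Lemma inner_sumr I (r : seq I) (P : pred I) (F : I -> H) z :
  '<z, \sum_(i <- r | P i) F i> = \sum_(i <- r | P i) '<z, F i>.
Proof. exact: linear_sumr. Qed.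

Lemma inner_rnorm x : '<x, x> = (rnorm x ^+ 2)%:C.
Proof. by rewrite inner_norm rnormE rmorphXn. Qed.

Lemma rnorm_sqr_inner x : rnorm x ^+ 2 = complex.Re '<x, x>.
Proof. by rewrite inner_rnorm. Qed.

Lemma rnorm_inner_le x y : rnorm ('<x, y> : C) <= rnorm x * rnorm y.
Proof. by rewrite -lecR rmorphM /= -!rnormE inner_le. Qed.

Lemma Re_innerC x y : complex.Re '<x, y> = complex.Re '<y, x>.
Proof. by rewrite innerC; case: '<y, x>. Qed.

Lemma rnorm_sqrD x y : rnorm (x + y) ^+ 2 =
  rnorm x ^+ 2 + rnorm y ^+ 2 + 2 * complex.Re '<x, y>.
Proof.
rewrite !rnorm_sqr_inner !(innerDl, innerDr).
rewrite !(raddfD (@complex.Re R : Rcomplex R -> R)) /= (Re_innerC y x); ring.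
Qed.

Lemma rnorm_sqrB x y : rnorm (x - y) ^+ 2 =
  rnorm x ^+ 2 + rnorm y ^+ 2 - 2 * complex.Re '<x, y>.
Proof.
rewrite !rnorm_sqr_inner !(innerBl, innerBr).
rewrite !(raddfB (@complex.Re R : Rcomplex R -> R)) /= (Re_innerC y x); ring.
Qed.

Lemma rnorm_sqr_ortho x y : '<x, y> = 0 ->
  rnorm (x + y) ^+ 2 = rnorm x ^+ 2 + rnorm y ^+ 2.
Proof. by move=> xy0; rewrite rnorm_sqrD xy0 /= mulr0 addr0. Qed.

Lemma cvg_inner (u v : nat -> H) x y : u @ \oo --> x -> v @ \oo --> y ->
  (fun n => '<u n, v n> : C) @ \oo --> ('<x, y> : C).
Proof.
move=> /cvg_rnormP hu /cvg_rnormP hv; apply/cvg_rnormP => eps e0.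
pose K := 1 + rnorm x + rnorm y.
have K1 : 1 <= K by rewrite /K; have := rnorm_ge0 x; have := rnorm_ge0 y; lra.
have d0 : 0 < Num.min 1 (eps / (2 * K)).
  by rewrite lt_min ltr01 divr_gt0 // mulr_gt0 //; lra.
have [N hN] := hu _ d0; have [M hM] := hv _ d0.
exists (maxn N M) => n; rewrite geq_max => /andP[/hN h1 /hM h2].
move: h1 h2; rewrite !le_min => /andP[a1 a2] /andP[b1 b2].
have -> : '<u n, v n> - '<x, y> = '<u n - x, v n> + '<x, v n - y>.
  by rewrite innerBl innerBr; ring.
have v1 : rnorm (v n) <= K.
  have := rnormD (v n - y) y; rewrite subrK /K; have := rnorm_ge0 x; lra.
have xK : rnorm x <= K by rewrite /K; have := rnorm_ge0 y; lra.
have eK : eps = eps / (2 * K) * K + K * (eps / (2 * K)) by field; lra.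
apply: le_trans (rnormD _ _) _; rewrite eK lerD //.
  by apply: le_trans (rnorm_inner_le _ _) _; rewrite ler_pM ?rnorm_ge0.
by apply: le_trans (rnorm_inner_le _ _) _; rewrite ler_pM ?rnorm_ge0.
Qed.

Lemma inner_cvg_l (u : nat -> H) x y : u @ \oo --> x ->
  (fun n => '<u n, y> : C) @ \oo --> ('<x, y> : C).
Proof. by move=> ux; apply: cvg_inner => //; exact: cvg_cst. Qed.

Lemma cvg_rnorm_sqr_le (u : nat -> H) x M : u @ \oo --> x ->
  (forall n, rnorm (u n) ^+ 2 <= M) -> rnorm x ^+ 2 <= M.
Proof.
move=> ux uM; apply/ler_addgt0Pr => eps e0.
have /cvg_rnormP/(_ _ e0)[N /(_ _ (leqnn N))] := cvg_inner ux ux.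
rewrite !inner_rnorm -rmorphB rnorm_real ler_norml => /andP[h _].
by have := uM N; lra.
Qed.

Section Orthogonal.
Variable z : nat -> H.
Hypothesis z_ortho : forall i j, i != j -> '<z i, z j> = 0.

Lemma rnorm_sqr_sum_ortho m n :
  rnorm (\sum_(m <= k < n) z k) ^+ 2 = \sum_(m <= k < n) rnorm (z k) ^+ 2.
Proof.
case: (leqP m n) => [|nm]; last by rewrite !big_geq ?rnorm0 ?expr0n // ltnW.
elim: n => [|n IH]; first by rewrite leqn0 => /eqP ->; rewrite !big_geq ?rnorm0 ?expr0n.
rewrite leq_eqVlt => /predU1P[->|]; first by rewrite !big_geq ?rnorm0 ?expr0n.
rewrite ltnS => mn; rewrite !big_nat_recr //= rnorm_sqr_ortho ?IH //.
rewrite inner_suml big_nat_cond big1 // => k /andP[/andP[_ kn] _].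
by rewrite z_ortho // neq_ltn kn.
Qed.

(** By Pythagoras the squared distance between two partial sums is a difference
    of partial sums of the squared norms, so the partial sums are Cauchy. *)
Lemma cvg_series_ortho M :
  (forall n, \sum_(0 <= k < n) rnorm (z k) ^+ 2 <= M) -> cvgn (series z).
Proof.
move=> zM; apply: cvgn_rnorm_cauchy => eps e0.
have [|N hN] := bounded_monotone_cauchy (u :=
  fun n => \sum_(0 <= k < n) rnorm (z k) ^+ 2) _ zM (exprn_gt0 2 e0).
  by move=> n; rewrite big_nat_recr //= lerDl sqr_ge0.
have {}hN m n : (N <= m)%N -> (m <= n)%N -> rnorm (series z n - series z m) <= eps.
  move=> Nm mn; rewrite -(@ler_pXn2r _ 2) ?nnegrE ?rnorm_ge0 ?(ltW e0) //.
  rewrite sub_series_geq // rnorm_sqr_sum_ortho.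
  have := hN _ _ (leq_trans Nm mn) Nm.
  rewrite [X in X - _](big_cat_nat (n := m)) //= addrAC subrr add0r.
  by rewrite ger0_norm // sumr_ge0 // => i _; rewrite sqr_ge0.
exists N => m n Nm Nn; case: (leqP m n) => mn; last exact: hN (ltnW mn).
by rewrite rnorm_sub hN.
Qed.

End Orthogonal.

End Inner.

Section Basis.
Variables (R : realType) (H : hilbertType R) (e : nat -> H).
Hypothesis e_basis : orthonormal_basis e.
Local Notation C := R[i].
Implicit Types x y z : H.

Lemma basis_inner i j : '<e i, e j> = (i == j)%:R :> C.
Proof. exact: e_basis.1. Qed.

Lemma rnorm_basis i : rnorm (e i) = 1.
Proof.
apply/eqP; rewrite -(@eqrXn2 _ 2) ?rnorm_ge0 // rnorm_sqr_inner basis_inner.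
by rewrite eqxx expr1n.
Qed.

Definition expansion (c : nat -> C) n := \sum_(0 <= k < n) c k *: e k.

Lemma inner_expansion c n j :
  '<expansion c n, e j> = if (j < n)%N then c j else 0.
Proof.
rewrite /expansion inner_suml; under eq_bigr do rewrite innerZl basis_inner.
rewrite big_mkord; case: ifP => jn.
  rewrite (bigD1 (Ordinal jn)) //= eqxx mulr1 big1 ?addr0 // => i.
  by rewrite -val_eqE /= => /negbTE ->; rewrite mulr0.
rewrite big1 // => i _; case: eqP => [ij|_]; last by rewrite mulr0.
by rewrite -ij ltn_ord in jn.
Qed.

Lemma rnorm_sqr_expansion c n :
  rnorm (expansion c n) ^+ 2 = \sum_(0 <= k < n) rnorm (c k : C) ^+ 2.
Proof.
rewrite rnorm_sqr_sum_ortho.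
  by apply: eq_bigr => k _; rewrite rnormZ rnorm_basis mulr1.
move=> i j ij; rewrite innerZl innerZr basis_inner (negbTE ij).
by rewrite !mulr0.
Qed.

Lemma expansion_cvg x : expansion (fun k => '<x, e k>) @ \oo --> x.
Proof. exact: e_basis.2. Qed.

Lemma inner_expansion_coef x n : '<x, expansion (fun k => '<x, e k>) n> =
  (\sum_(0 <= k < n) rnorm ('<x, e k> : C) ^+ 2)%:C.
Proof.
rewrite inner_sumr rmorph_sum /=; apply: eq_bigr => k _.
by rewrite innerZr mulrC mul_conj_rnorm.
Qed.

Lemma rnorm_sqr_sub_expansion x n :
  rnorm (x - expansion (fun k => '<x, e k>) n) ^+ 2 =
  rnorm x ^+ 2 - \sum_(0 <= k < n) rnorm ('<x, e k> : C) ^+ 2.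
Proof.
rewrite rnorm_sqrB rnorm_sqr_expansion inner_expansion_coef /=; ring.
Qed.

Lemma bessel x n : \sum_(0 <= k < n) rnorm ('<x, e k> : C) ^+ 2 <= rnorm x ^+ 2.
Proof. by rewrite -subr_ge0 -rnorm_sqr_sub_expansion sqr_ge0. Qed.

Lemma parseval x (eps : R) : 0 < eps -> exists N, forall n, (N <= n)%N ->
  rnorm x ^+ 2 - \sum_(0 <= k < n) rnorm ('<x, e k> : C) ^+ 2 <= eps.
Proof.
move=> e0; have /cvg_rnormP := @expansion_cvg x.
move=> /(_ (Num.min 1 eps)) []; first by rewrite lt_min ltr01.
move=> N hN; exists N => n /hN; rewrite rnorm_sub le_min => /andP[h1 h2].
rewrite -rnorm_sqr_sub_expansion expr2.
by apply: le_trans h2; rewrite ler_piMl ?rnorm_ge0.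
Qed.

Lemma basis_ext x y : (forall n, '<x, e n> = '<y, e n> :> C) -> x = y.
Proof.
move=> xy; have := @expansion_cvg y; rewrite -(funext xy) => ey.
exact: cvg_unique (@expansion_cvg x) ey.
Qed.

(** Source of all the existence statements below: vectors, adjoints and the
    solutions of the moment problem are produced from their coefficients. *)
Lemma riesz_fischer (c : nat -> C) M :
  (forall n, \sum_(0 <= k < n) rnorm (c k) ^+ 2 <= M) ->
  exists x, (forall n, '<x, e n> = c n) /\ rnorm x ^+ 2 <= M.
Proof.
move=> cM; have cv : cvgn (expansion c).
  apply: (@cvg_series_ortho _ _ _ _ M).
    by move=> i j ij; rewrite innerZl innerZr basis_inner (negbTE ij) !mulr0.
  move=> n; apply: le_trans (cM n).
  by rewrite ler_sum // => i _; rewrite rnormZ rnorm_basis mulr1.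
exists (limn (expansion c)); split=> [n|].
  have h := inner_cvg_l (y := e n) cv.
  have h2 : (fun m => '<expansion c m, e n> : C) @ \oo --> (c n : C).
    apply/cvg_rnormP => eps e0; exists n.+1 => m nm.
    by rewrite inner_expansion nm subrr rnorm0; exact: ltW.
  exact: cvg_unique h h2.
by apply: (cvg_rnorm_sqr_le cv) => n; rewrite rnorm_sqr_expansion.
Qed.

End Basis.

(** * Bounded operators and the square root of a contraction *)
Section Operators.
Variables (R : realType) (H : hilbertType R).
Local Notation C := R[i].
Implicit Types x y z : H.
Implicit Types A B : bop H.

Lemma bopE : (forall A B x, (A + B : bop H) x = A x + B x) *
  (forall (a : C) A x, (a *: A : bop H) x = a *: A x) *
  (forall A x, (- A : bop H) x = - A x) * (forall x, (0 : bop H) x = 0) *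
  (forall A B x, bop_comp A B x = A (B x)) * (forall x, bop_id H x = x).
Proof. by []. Qed.

Lemma bopD A x y : A (x + y) = A x + A y.
Proof. by have := bop_linear A 1 x y; rewrite !scale1r. Qed.

Lemma bop0 A : A 0 = 0.
Proof. by apply: (@addrI _ (A 0)); rewrite -bopD !addr0. Qed.

Lemma bopZ A (a : C) x : A (a *: x) = a *: A x.
Proof. by have := bop_linear A a x 0; rewrite bop0 !addr0. Qed.

Lemma bopN A x : A (- x) = - A x.
Proof. by rewrite -scaleN1r bopZ scaleN1r. Qed.

Lemma bopB A x y : A (x - y) = A x - A y.
Proof. by rewrite bopD bopN. Qed.

Lemma bop_sum A I (r : seq I) (P : pred I) (F : I -> H) :
  A (\sum_(i <- r | P i) F i) = \sum_(i <- r | P i) A (F i).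
Proof.
by elim/big_rec2: _ => [|i y z _ <-]; [exact: bop0 | rewrite bopD].
Qed.

Lemma sum_bopE I (r : seq I) (P : pred I) (F : I -> bop H) x :
  (\sum_(i <- r | P i) F i : bop H) x = \sum_(i <- r | P i) F i x.
Proof. by elim/big_rec2: _ => [|i y A _ <-]. Qed.

Lemma bop_cvg A (u : nat -> H) x : u @ \oo --> x ->
  (fun n => A (u n)) @ \oo --> A x.
Proof. by move=> ux; apply: continuous_cvg => //; exact: bop_continuous. Qed.

Lemma bop_bounded A : exists2 M : R, 0 < M & forall x, rnorm (A x) <= M * rnorm x.
Proof.
pose f : {linear H -> H} := HB.pack (bop_fun A)
  (GRing.isLinear.Build _ _ _ _ _ (bop_linear A)).
have /linear_bounded_continuous/linear_boundedP : continuous f.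
  exact: bop_continuous.
move=> /pinfty_ex_gt0 [M M0 hM].
have MR : (complex.Re M)%:C = M by rewrite RRe_real // gtr0_real.
exists (complex.Re M); first by rewrite -ltr0c MR.
by move=> x; have := hM x; rewrite /= !rnormE -{1}MR -rmorphM lecR.
Qed.

Lemma bop_of_linear (f : H -> H) M : linear f ->
  (forall x, rnorm (f x) <= M * rnorm x) -> exists A : bop H, A =1 f.
Proof.
move=> lf hM; have bf : f \in @bounded_op R H.
  apply/bounded_opP; split=> //.
  pose g : {linear H -> H} := HB.pack f (GRing.isLinear.Build _ _ _ _ _ lf).
  apply: (@bounded_linear_continuous _ _ _ g); apply/linear_boundedP.
  exists `|M|%:C; split=> [|N MN x]; first by rewrite ger0_real // ler0c.
  have NR : (complex.Re N)%:C = N.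
    by rewrite RRe_real // ger0_real // (le_trans _ (ltW MN)) // ler0c.
  rewrite /= !rnormE -NR -rmorphM lecR; apply: le_trans (hM x) _.
  rewrite ler_wpM2r ?rnorm_ge0 // (le_trans (ler_norm _)) //.
  by rewrite -lecR NR ltW.
by exists (Bop bf).
Qed.

Lemma bop_strong_limit (A : nat -> bop H) M :
  (forall n x, rnorm (A n x) <= M * rnorm x) ->
  (forall x, cvgn (fun n => A n x)) ->
  exists2 B : bop H, (forall x, (fun n => A n x) @ \oo --> B x) &
    forall x, rnorm (B x) <= M * rnorm x.
Proof.
move=> AM Ac; pose f x := limn (fun n => A n x).
have fM x : rnorm (f x) <= M * rnorm x.
  rewrite -(@ler_pXn2r _ 2) ?nnegrE ?rnorm_ge0 //; last first.
    exact: le_trans (rnorm_ge0 _) (AM 0%N x).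
  apply: (cvg_rnorm_sqr_le (Ac x)) => n.
  by rewrite ler_pXn2r ?nnegrE ?rnorm_ge0 // (le_trans (rnorm_ge0 _) (AM 0%N x)).
have lf : linear f.
  move=> a x y; have h1 : (fun n => A n (a *: x + y)) @ \oo --> f (a *: x + y) by exact: Ac.
  have h2 : (fun n => A n (a *: x + y)) @ \oo --> a *: f x + f y.
    under eq_fun do rewrite bop_linear.
    by apply: cvgD; [apply: cvgZr; exact: Ac | exact: Ac].
  exact: cvg_unique h1 h2.
have [B Bf] := bop_of_linear lf fM.
by exists B => x; rewrite Bf //; exact: Ac.
Qed.

Lemma iter_bop_compE A n x : iter n (bop_comp A) (bop_id H) x = iter n A x.
Proof. by elim: n => //= n <-. Qed.

Definition is_adjoint A B := forall x y, '<A x, y> = '<x, B y> :> C.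

Lemma is_adjoint_sym A B : is_adjoint A B -> is_adjoint B A.
Proof. by move=> AB x y; rewrite innerC -AB -innerC. Qed.

Definition contractive A := forall x, rnorm (A x) <= rnorm x.

(** The square root of [1 - A], for a self-adjoint contraction [A], is [1 - Y]
    where [Y] solves [Y = (A + Y ^ 2) / 2]. The solution is the strong limit of
    the iterates started at 0, which converge because the same iteration on the
    scalar 1 dominates the operator iteration. *)
Section SquareRoot.
Variable A : bop H.
Hypotheses (A_sa : is_adjoint A A) (A_contr : contractive A).

Fixpoint sqrt_scalar n : R :=
  if n is m.+1 then (1 + sqrt_scalar m ^+ 2) / 2 else 0.

Fixpoint sqrt_iter n : bop H :=
  if n is m.+1 then (2^-1 : C) *: (A + bop_comp (sqrt_iter m) (sqrt_iter m))
  else 0.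

Lemma sqrt_iterS n x : sqrt_iter n.+1 x =
  (2^-1 : C) *: (A x + sqrt_iter n (sqrt_iter n x)).
Proof. by []. Qed.

Lemma sqrt_iter0 x : sqrt_iter 0 x = 0.
Proof. by []. Qed.

Lemma sqrt_scalar_bound n : 0 <= sqrt_scalar n <= 1.
Proof. by elim: n => [|n /= /andP[h0 h1]]; [rewrite lexx ler01 | apply/andP; split; nra]. Qed.

Lemma sqrt_scalar_mono n : sqrt_scalar n <= sqrt_scalar n.+1.
Proof.
elim: n => [|n IH] /=; first by lra.
have /andP[a0 a1] := sqrt_scalar_bound n; move: IH => /=; nra.
Qed.

Lemma rnorm_half x : rnorm ((2^-1 : C) *: x) = rnorm x / 2.
Proof.
rewrite rnormZ (_ : 2^-1 = (2^-1)%:C) ?rnorm_real; last first.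
  by rewrite rmorphV ?unitfE //= rmorph_nat.
by rewrite ger0_norm ?invr_ge0 // mulrC.
Qed.

Lemma sqrt_iter_le n x : rnorm (sqrt_iter n x) <= sqrt_scalar n * rnorm x.
Proof.
elim: n x => [|n IH] x; first by rewrite sqrt_iter0 mul0r rnorm0.
rewrite sqrt_iterS rnorm_half /=.
have h1 := rnormD (A x) (sqrt_iter n (sqrt_iter n x)).
have h2 := A_contr x; have h3 := IH (sqrt_iter n x); have h4 := IH x.
have /andP[a0 _] := sqrt_scalar_bound n.
have := rnorm_ge0 (sqrt_iter n x); nra.
Qed.

(** The scalar increments dominate the operator increments, since
    [Y' ^ 2 - Y ^ 2 = Y' (Y' - Y) + (Y' - Y) Y] and its scalar counterpart is
    [s' ^ 2 - s ^ 2 = s' (s' - s) + (s' - s) s]. The scalar sequence increases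
    and is bounded by 1, so the operator iterates are pointwise Cauchy. *)
Lemma sqrt_iter_step n x : rnorm (sqrt_iter n.+1 x - sqrt_iter n x) <=
  (sqrt_scalar n.+1 - sqrt_scalar n) * rnorm x.
Proof.
elim: n x => [|n IH] x.
  have := sqrt_iter_le 1 x; rewrite sqrt_iter0 /= !subr0; lra.
set Y' := sqrt_iter n.+1; set Y := sqrt_iter n.
have -> : sqrt_iter n.+2 x - Y' x =
   (2^-1 : C) *: (Y' (Y' x - Y x) + (Y' (Y x) - Y (Y x))).
  rewrite sqrt_iterS /Y' [in X in _ - X]sqrt_iterS -/Y -scalerBr; congr (_ *: _).
  rewrite -[sqrt_iter n.+1]/Y' bopB addrA subrK opprD addrACA subrr add0r //.
rewrite rnorm_half.
have h1 := rnormD (Y' (Y' x - Y x)) (Y' (Y x) - Y (Y x)).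
have h2 := sqrt_iter_le n.+1 (Y' x - Y x).
have h3 := IH x; have h4 := IH (Y x); have h5 := sqrt_iter_le n x.
have /andP[a0 _] := sqrt_scalar_bound n.
have /andP[b0 _] := sqrt_scalar_bound n.+1.
have ab := sqrt_scalar_mono n.
have d := rnorm_ge0 (Y' x - Y x).
rewrite -/Y -/Y' in h2 h3 h4 h5 *.
have -> : sqrt_scalar n.+2 - sqrt_scalar n.+1 =
  (sqrt_scalar n.+1 * (sqrt_scalar n.+1 - sqrt_scalar n) +
   (sqrt_scalar n.+1 - sqrt_scalar n) * sqrt_scalar n) / 2.
  by rewrite /=; field.
move: (sqrt_scalar n) (sqrt_scalar n.+1) a0 b0 ab h2 h3 h4 h5 => s s' a0 b0 ab h2 h3 h4 h5.
have k1 : s' * rnorm (Y' x - Y x) <= s' * ((s' - s) * rnorm x) by rewrite ler_wpM2l.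
have k2 : (s' - s) * rnorm (Y x) <= (s' - s) * (s * rnorm x) by rewrite ler_wpM2l ?subr_ge0.
nra.
Qed.

Lemma sqrt_iter_dist m n x : (m <= n)%N ->
  rnorm (sqrt_iter n x - sqrt_iter m x) <=
  (sqrt_scalar n - sqrt_scalar m) * rnorm x.
Proof.
elim: n => [|n IH]; first by rewrite leqn0 => /eqP ->; rewrite !subrr mul0r rnorm0.
rewrite leq_eqVlt => /predU1P[->|]; first by rewrite !subrr mul0r rnorm0.
rewrite ltnS => /IH mn; have := sqrt_iter_step n x.
have := rnorm_dist (sqrt_iter n.+1 x) (sqrt_iter n x) (sqrt_iter m x); lra.
Qed.

Lemma sqrt_iter_adjoint n : is_adjoint (sqrt_iter n) (sqrt_iter n).
Proof.
elim: n => [|n IH] x y; first by rewrite !sqrt_iter0 inner0l inner0r.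
rewrite !sqrt_iterS innerZl innerZr innerDl innerDr A_sa !IH; congr (_ * _).
by rewrite rmorphV ?unitfE ?pnatr_eq0 //= rmorph_nat.
Qed.

Lemma square_root_id_minus : exists Y : bop H,
  [/\ is_adjoint Y Y, contractive Y & forall x, Y x + Y x = A x + Y (Y x)].
Proof.
have scal_cauchy := bounded_monotone_cauchy sqrt_scalar_mono
  (fun n => proj2 (andP (sqrt_scalar_bound n))).
have Yc x : cvgn (fun n => sqrt_iter n x).
  apply: cvgn_rnorm_cauchy => eps e0.
  have K0 : 0 < 1 + rnorm x by have := rnorm_ge0 x; lra.
  have [N hN] := scal_cauchy _ (divr_gt0 e0 K0).
  have {}hN m n : (N <= m)%N -> (m <= n)%N ->
      rnorm (sqrt_iter n x - sqrt_iter m x) <= eps.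
    move=> Nm mn; apply: le_trans (sqrt_iter_dist x mn) _.
    apply: (@le_trans _ _ (eps / (1 + rnorm x) * (1 + rnorm x))); last by rewrite divfK ?gt_eqF.
    have := hN _ _ (leq_trans Nm mn) Nm => /(le_trans (ler_norm _)) h.
    have := rnorm_ge0 x => hx.
    apply: le_trans (ler_wpM2r hx h) _.
    by rewrite ler_wpM2l ?lerDr // ltW // divr_gt0.
  exists N => m n Nm Nn; case: (leqP n m) => mn; first exact: hN.
  by rewrite rnorm_sub hN // ltnW.
have Y1 n x : rnorm (sqrt_iter n x) <= 1 * rnorm x.
  apply: le_trans (sqrt_iter_le n x) _; rewrite ler_wpM2r ?rnorm_ge0 //.
  by have /andP[] := sqrt_scalar_bound n.
have [Y YY Yle] := bop_strong_limit Y1 Yc.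
exists Y; split=> [x y|x|x]; last 1 first.
- have YYY : (fun n => sqrt_iter n (sqrt_iter n x)) @ \oo --> Y (Y x).
    apply/cvg_rnormP => eps e0.
    have e2 : 0 < eps / 2 by rewrite divr_gt0.
    have /cvg_rnormP/(_ _ e2)[N hN] := YY x.
    have /cvg_rnormP/(_ _ e2)[M hM] := YY (Y x).
    exists (maxn N M) => n; rewrite geq_max => /andP[/hN h1 /hM h2].
    have h3 := Y1 n (sqrt_iter n x - Y x); rewrite bopB in h3.
    have := rnorm_dist (sqrt_iter n (sqrt_iter n x)) (sqrt_iter n (Y x)) (Y (Y x)).
    lra.
  have h1 : (fun n => sqrt_iter n.+1 x + sqrt_iter n.+1 x) @ \oo --> Y x + Y x.
    by apply: cvgD; rewrite (cvg_shiftS (fun n => sqrt_iter n x)); exact: YY.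
  have h2 : (fun n => sqrt_iter n.+1 x + sqrt_iter n.+1 x) @ \oo --> A x + Y (Y x).
    have half : 2^-1 + 2^-1 = 1 :> C.
      by rewrite -mulr2n -(mulr_natr (2^-1 : C)) mulVf ?pnatr_eq0.
    under eq_fun do rewrite sqrt_iterS -scalerDl half scale1r.
    by apply: cvgD => //; exact: cvg_cst.
  exact: cvg_unique h1 h2.
- have h1 := inner_cvg_l (y := y) (YY x).
  have h2 : (fun n => '<sqrt_iter n x, y> : C) @ \oo --> ('<x, Y y> : C).
    under eq_fun do rewrite sqrt_iter_adjoint.
    by apply: cvg_inner; [exact: cvg_cst | exact: YY].
  exact: cvg_unique h1 h2.
- by have := Yle x; rewrite mul1r.
Qed.

End SquareRoot.

End Operators.

(** * Adjoints, positive square roots and polar decomposition *)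
Section Positive.
Variables (R : realType) (H : hilbertType R) (e : nat -> H).
Hypothesis e_basis : orthonormal_basis e.
Local Notation C := R[i].
Implicit Types x y z : H.
Implicit Types A B L S : bop H.

Lemma adjoint_exists A : exists B, is_adjoint A B.
Proof.
have [M M0 hM] := bop_bounded A.
pose c y n : C := '<y, A (e n)>.
have c_bound y n : \sum_(0 <= k < n) rnorm (c y k : C) ^+ 2 <= (M * rnorm y) ^+ 2.
  rewrite -(rnorm_sqr_expansion e_basis); set z := expansion e (c y) n.
  have zE : '<y, A z> = (rnorm z ^+ 2)%:C.
    rewrite /z rnorm_sqr_expansion // bop_sum inner_sumr rmorph_sum /=.
    by apply: eq_bigr => k _; rewrite bopZ innerZr mulrC mul_conj_rnorm.
  rewrite ler_pXn2r ?nnegrE ?rnorm_ge0 ?mulr_ge0 ?rnorm_ge0 ?(ltW M0) //.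
  have [->|] := eqVneq z 0; first by rewrite rnorm0 mulr_ge0 ?rnorm_ge0 ?(ltW M0).
  rewrite -rnorm_eq0 => z0; have {}z0 : 0 < rnorm z by rewrite lt_def z0 rnorm_ge0.
  rewrite -(ler_pM2r z0) -expr2.
  have := rnorm_inner_le y (A z); rewrite zE rnorm_real ger0_norm ?sqr_ge0 //.
  move=> /le_trans; apply; rewrite -mulrA mulrCA ler_wpM2l ?rnorm_ge0 //.
have /choice[f hf] : forall y, exists z,
    (forall n, '<z, e n> = c y n) /\ rnorm z ^+ 2 <= (M * rnorm y) ^+ 2.
  by move=> y; exact: riesz_fischer (c_bound y).
have lf : linear f.
  move=> a x y; apply: (basis_ext e_basis) => n.
  by rewrite (hf _).1 innerDl innerZl !(hf _).1 /c innerDl innerZl.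
have fM y : rnorm (f y) <= M * rnorm y.
  rewrite -(@ler_pXn2r _ 2) ?nnegrE ?rnorm_ge0 ?mulr_ge0 ?rnorm_ge0 ?(ltW M0) //.
  exact: (hf y).2.
have [B Bf] := bop_of_linear lf fM; exists B => x y.
have h1 : (fun n => '<A (expansion e (fun k => '<x, e k>) n), y> : C) @ \oo --> ('<A x, y> : C).
  by apply: inner_cvg_l; apply: bop_cvg; exact: expansion_cvg.
have h2 : (fun n => '<A (expansion e (fun k => '<x, e k>) n), y> : C) @ \oo --> ('<x, B y> : C).
  rewrite (_ : (fun n => _) = (fun n => '<expansion e (fun k => '<x, e k>) n, B y>)).
    by apply: inner_cvg_l; exact: expansion_cvg.
  apply/funext => n; rewrite bop_sum !inner_suml; apply: eq_bigr => k _.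
  by rewrite bopZ !innerZl Bf (innerC (e k) (f y)) (hf _).1 -innerC.
exact: cvg_unique h1 h2.
Qed.

Lemma is_adjoint_real A x : is_adjoint A A -> '<A x, x> = (complex.Re '<A x, x>)%:C.
Proof.
move=> /(_ x x); rewrite [X in _ = X]innerC; case: '<A x, x> => a b /= [] /eqP.
by rewrite -addr_eq0 -mulr2n mulrn_eq0 /= => /eqP ->.
Qed.

(** Over the complex numbers a positive form is automatically hermitian, by
    polarization with [x + y] and [x + i y]. *)
Lemma positive_bopP A : positive_bop A <->
  is_adjoint A A /\ forall x, 0 <= complex.Re '<A x, x>.
Proof.
split=> [Apos|[Asa Apos] x]; last by rewrite is_adjoint_real // ler0c.
have Im0 x : complex.Im '<A x, x> = 0 by apply: ger0_Im; exact: Apos.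
split=> [x y|x]; last first.
  by have := Apos x; rewrite lecE => /andP[].
have h1 := Im0 (x + y); have h2 := Im0 (x + 'i *: y).
move: h1 h2; rewrite !bopD !bopZ !(innerDl, innerDr, innerZl, innerZr).
rewrite [X in _ -> _ -> _ = X]innerC.
have := Im0 x; have := Im0 y.
case: '<A x, x> => a1 b1; case: '<A y, y> => a2 b2.
case: '<A x, y> => a3 b3; case: '<A y, x> => a4 b4 /= -> ->; simpc => h1 h2.
by congr (_ +i* _); lra.
Qed.

(** This is [A ^ 2 <= A] for a positive contraction, obtained by evaluating the
    positive form at [x - A x]. *)
Lemma positive_contractive_le A x : is_adjoint A A ->
  (forall x, 0 <= complex.Re '<A x, x>) -> contractive A ->
  rnorm (A x) ^+ 2 <= complex.Re '<A x, x>.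
Proof.
move=> Asa Apos Ac; have := Apos (x - A x).
rewrite bopB !(innerBl, innerBr) !(raddfB (@complex.Re R : Rcomplex R -> R)) /=.
rewrite (Asa (A x) x) -rnorm_sqr_inner.
have := le_trans (ler_norm _) (Re_le_rnorm '<A (A x), A x>).
have := rnorm_inner_le (A (A x)) (A x); have := Ac (A x); have := rnorm_ge0 (A x).
by nra.
Qed.

Lemma id_minus_contractive S : is_adjoint S S ->
  (forall x, 0 <= complex.Re '<S x, x>) -> contractive S ->
  [/\ is_adjoint (bop_id H - S) (bop_id H - S),
      forall x, 0 <= complex.Re '<(bop_id H - S) x, x> &
      contractive (bop_id H - S)].
Proof.
move=> Ssa Spos Sc; split=> [x y|x|x]; rewrite !bopE.
- by rewrite innerBl innerBr Ssa.
- rewrite innerBl (raddfB (@complex.Re R : Rcomplex R -> R)) /= -rnorm_sqr_inner.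
  have := le_trans (ler_norm _) (Re_le_rnorm '<S x, x>).
  have := rnorm_inner_le (S x) x; have := Sc x; have := rnorm_ge0 x; nra.
- rewrite -(@ler_pXn2r _ 2) ?nnegrE ?rnorm_ge0 // rnorm_sqrB Re_innerC.
  have := positive_contractive_le x Ssa Spos Sc; have := Spos x; nra.
Qed.

Lemma bop_normalize A : exists2 M : R, 0 < M & contractive ((M^-1)%:C *: A).
Proof.
have [M M0 hM] := bop_bounded A; exists M => // x.
by rewrite bopE rnormZ rnorm_real gtr0_norm ?invr_gt0 // ler_pdivrMl.
Qed.

Lemma scale_adjoint (a : R) A : is_adjoint A A -> is_adjoint (a%:C *: A) (a%:C *: A).
Proof.
by move=> Asa x y; rewrite !bopE innerZl innerZr Asa conj_real.
Qed.

Lemma Re_realM (a : R) (z : C) : complex.Re (a%:C * z) = a * complex.Re z.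
Proof. by case: z => u v /=; rewrite mul0r subr0. Qed.

(** After normalization [1 - S] is a contraction, so that the iteration above
    applies to it. *)
Lemma positive_square_root S : positive_bop S ->
  exists2 B, positive_bop B & forall x, B (B x) = S x.
Proof.
move=> /positive_bopP[Ssa Spos]; have [M M0 Sc] := bop_normalize S.
have M0' : 0 <= M^-1 by rewrite invr_ge0 ltW.
set S' := _ *: S in Sc.
have S'sa : is_adjoint S' S' by exact: scale_adjoint.
have S'pos x : 0 <= complex.Re '<S' x, x>.
  by rewrite bopE innerZl Re_realM mulr_ge0.
have [Asa Apos Ac] := id_minus_contractive S'sa S'pos Sc.
have [Y [Ysa Yc YE]] := square_root_id_minus Asa Ac.
exists ((Num.sqrt M)%:C *: (bop_id H - Y)).
  apply/positive_bopP; split.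
    apply: scale_adjoint => x y; rewrite !bopE innerBl innerBr Ysa //.
  move=> x; rewrite bopE innerZl Re_realM mulr_ge0 ?sqrtr_ge0 //.
  rewrite !bopE innerBl (raddfB (@complex.Re R : Rcomplex R -> R)) /= -rnorm_sqr_inner.
  have := le_trans (ler_norm _) (Re_le_rnorm '<Y x, x>).
  have := rnorm_inner_le (Y x) x; have := Yc x; have := rnorm_ge0 x; nra.
move=> x; rewrite !bopE bopZ -scalerBr scalerA -rmorphM /=.
rewrite -expr2 sqr_sqrtr ?(ltW M0) // bopB.
have -> : x - Y x - (Y x - Y (Y x)) = S' x.
  have := YE x; rewrite !bopE => h.
  by rewrite opprB addrACA -opprD h opprD addrACA subrr addr0 opprB addrC subrK.
by rewrite bopE scalerA -rmorphM /= divff ?gt_eqF // scale1r.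
Qed.

Lemma abs_exists L : exists A, is_abs L A.
Proof.
have [L' LL'] := adjoint_exists L.
have LLE x y : '<L' (L x), y> = '<L x, L y> by rewrite (is_adjoint_sym LL').
have [|B Bpos BB] := positive_square_root (S := bop_comp L' L).
  apply/positive_bopP; split=> [x y|x]; rewrite !bopE LLE; first by rewrite LL'.
  by rewrite -rnorm_sqr_inner sqr_ge0.
by exists B; split=> // x y; rewrite BB bopE LLE.
Qed.

Lemma is_abs_rnorm L S x : is_abs L S -> rnorm (S x) = rnorm (L x).
Proof.
move=> [/positive_bopP[Ssa _] SL]; apply/eqP.
rewrite -(@eqrXn2 _ 2) ?rnorm_ge0 // !rnorm_sqr_inner -SL.
by rewrite (Ssa (S x)).
Qed.

(** The partial isometry [U] with [U |L| = L] is built as a strong limit. Put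
    [A = 1 - S] with [S = |L|], scaled to be a contraction, and let
    [q n = 1 + A + ... + A ^ (n - 1)], so that [S (q n) = 1 - A ^ n]. As [L] and
    [S] have the same norms on vectors, [L (q n)] is a contraction, and it
    converges strongly because [A ^ n] does. *)
Section PolarContractive.
Variables L S : bop H.
Hypotheses (LS : is_abs L S) (Sc : contractive S).
Let Ssa : is_adjoint S S := proj1 (proj1 (positive_bopP S) (proj1 LS)).
Let Spos : forall x, 0 <= complex.Re '<S x, x> :=
  proj2 (proj1 (positive_bopP S) (proj1 LS)).
Let A := bop_id H - S.
Let a n x := complex.Re '<iter n A x, x>.

Let powA n : bop H := iter n (bop_comp A) (bop_id H).

Lemma polar_powE n x : powA n x = iter n A x.
Proof. exact: iter_bop_compE. Qed.

Lemma polar_inner m n x : complex.Re '<iter m A x, iter n A x> = a (m + n) x.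
Proof.
have [Asa _ _] := id_minus_contractive Ssa Spos Sc.
elim: n m => [|n IH] m; first by rewrite addn0.
by rewrite iterS -Asa -iterS IH addSnnS.
Qed.

Lemma polar_half n x : exists z, [/\ a n.*2 x = rnorm z ^+ 2,
  a n.*2.+1 x = complex.Re '<A z, z> & a n.+1.*2 x = rnorm (A z) ^+ 2].
Proof.
exists (iter n A x); rewrite !rnorm_sqr_inner -[A (iter n A x)]/(iter n.+1 A x).
by rewrite !polar_inner -!addnn addSn.
Qed.

(** Both [1 - A] and [A - A ^ 2] are positive, so the numbers
    [<A ^ n x, x>] decrease. *)
Lemma polar_noninc m n x : (m <= n)%N -> 0 <= a n x <= a m x.
Proof.
have [Asa Apos Ac] := id_minus_contractive Ssa Spos Sc.
have step k : 0 <= a k.+1 x <= a k x.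
  have [z [h1 h2 h3]] := polar_half k./2 x.
  have := odd_double_half k; case: (odd k); rewrite ?add0n ?add1n => <-.
    rewrite h2 -[_.+2]/(_.+1.*2) h3 sqr_ge0; exact: positive_contractive_le.
  rewrite h2 h1 Apos andTb /A !bopE innerBl.
  rewrite (raddfB (@complex.Re R : Rcomplex R -> R)) /= -rnorm_sqr_inner.
  by have := Spos z; lra.
move=> mn; have a0 : 0 <= a n x.
  case: n mn => [|n _]; last by have /andP[] := step n.
  by rewrite /a /= -rnorm_sqr_inner sqr_ge0.
rewrite a0 /=; elim: n mn {a0} => [|n IH]; first by rewrite leqn0 => /eqP ->.
rewrite leq_eqVlt => /predU1P[-> //|]; rewrite ltnS => /IH.
by have /andP[_] := step n; apply: le_trans.
Qed.

Lemma polar_dist m n x : rnorm (iter m A x - iter n A x) ^+ 2 =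
  a m.*2 x + a n.*2 x - 2 * a (m + n) x.
Proof. by rewrite rnorm_sqrB !rnorm_sqr_inner !polar_inner !addnn. Qed.

Lemma polar_cauchy x (eps : R) : 0 < eps -> exists N, forall m n,
  (N <= m)%N -> (N <= n)%N -> rnorm (iter m A x - iter n A x) <= eps.
Proof.
move=> e0; have e2 : 0 < eps ^+ 2 / 2 by rewrite divr_gt0 // exprn_gt0.
have [|n|N hN] := bounded_monotone_cauchy (u := fun n => - a n x) (M := 0) _ _ e2.
- by move=> n; rewrite lerN2; have /andP[] := polar_noninc x (leqnSn n).
- by rewrite oppr_le0; have /andP[] := polar_noninc x (leqnn n).
exists N => m n Nm Nn; rewrite -(@ler_pXn2r _ 2) ?nnegrE ?rnorm_ge0 ?(ltW e0) //.
rewrite polar_dist -!addnn.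
have Nmn : (N <= m + n)%N by lia.
have := hN (m + m)%N (m + n)%N; have := hN (n + n)%N (m + n)%N.
have Nmm : (N <= m + m)%N by lia.
have Nnn : (N <= n + n)%N by lia.
move=> /(_ Nnn Nmn) /ler_normlP [_ h1] /(_ Nmm Nmn) /ler_normlP [_ h2].
have := hN (m + m)%N (m + n)%N Nmm Nmn => /ler_normlP[h3 _].
have := hN (n + n)%N (m + n)%N Nnn Nmn => /ler_normlP[h4 _].
lra.
Qed.

Let q n : bop H := \sum_(0 <= k < n) powA k.

Lemma polar_qS n x : q n (S x) = x - iter n A x.
Proof.
rewrite /q sum_bopE; elim: n => [|n IH]; first by rewrite big_geq // subrr.
rewrite big_nat_recr //= IH polar_powE.
have -> : S x = x - A x by rewrite /A !bopE opprB addrC subrK.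
by rewrite -!polar_powE bopB !polar_powE -iterSr addrA subrK.
Qed.

Lemma polar_Sq n x : S (q n x) = x - iter n A x.
Proof.
rewrite -polar_qS /q !sum_bopE bop_sum; apply: eq_bigr => k _.
rewrite !polar_powE; elim: k => // k IH.
by rewrite !iterS -IH /A !bopE bopB.
Qed.

Lemma polar_Lq m n x : rnorm (L (q m x) - L (q n x)) = rnorm (iter n A x - iter m A x).
Proof.
by rewrite -bopB -(is_abs_rnorm _ LS) bopB !polar_Sq opprB addrC addrA subrK.
Qed.

(** The identity [W L = S] for the adjoint [W] of [U] rests on the fact that [U]
    vanishes on the kernel of [S]: [y = W L x - S x] is in that kernel, whence
    [<y, y> = <L x, U y> - <x, S y> = 0]. *)
Lemma polar_contractive : exists U W, [/\ contractive U, is_adjoint U W,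
  forall x, U (S x) = L x & forall x, W (L x) = S x].
Proof.
have U1 n x : rnorm (bop_comp L (q n) x) <= 1 * rnorm x.
  rewrite mul1r bopE -(is_abs_rnorm _ LS) polar_Sq.
  rewrite -(@ler_pXn2r _ 2) ?nnegrE ?rnorm_ge0 //.
  have -> : x - iter n A x = iter 0 A x - iter n A x by [].
  rewrite polar_dist /= add0n rnorm_sqr_inner -[X in _ <= X]/(a 0 x).
  have /andP[_] := @polar_noninc n n.*2 x (ltac:(lia)).
  have /andP[h _] := polar_noninc x (leqnn n); lra.
have Uc x : cvgn (fun n => bop_comp L (q n) x).
  apply: cvgn_rnorm_cauchy => eps /(polar_cauchy x)[N hN].
  by exists N => m n Nm Nn; rewrite !bopE polar_Lq hN.
have [U UE Ule] := bop_strong_limit U1 Uc.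
have [W UW] := adjoint_exists U.
have US x : U (S x) = L x.
  apply: (rnorm_lim_unique (UE (S x))) => eps /(polar_cauchy x)[N hN].
  exists N => n Nn; rewrite bopE polar_qS bopB addrAC subrr add0r rnormN.
  rewrite -(is_abs_rnorm _ LS).
  have -> : S (iter n A x) = iter n A x - iter n.+1 A x.
    have AE z : S z = z - A z by rewrite /A !bopE opprB addrC subrK.
    exact: AE.
  by apply: hN => //; apply: leq_trans Nn _.
exists U, W; split=> // x; first by have := Ule x; rewrite mul1r.
set y := W (L x) - S x.
have Sy : S y = 0.
  apply: (basis_ext e_basis) => n; rewrite inner0l Ssa innerBl.
  rewrite (is_adjoint_sym UW) US -(proj2 LS) -Ssa.
  by rewrite (Ssa (S x)) subrr.
have iterAy n : iter n A y = y.
  by elim: n => // n IH; rewrite iterS IH /A !bopE Sy subr0.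
have Uy : U y = 0.
  apply: (rnorm_lim_unique (UE y)) => eps e0.
  exists 0%N => n _; rewrite subr0 bopE -(is_abs_rnorm _ LS) polar_Sq iterAy.
  by rewrite subrr rnorm0 ltW.
apply/subr0_eq/eqP; rewrite -/y -rnorm_eq0 -sqrf_eq0 rnorm_sqr_inner {1}/y innerBl.
by rewrite (is_adjoint_sym UW) Uy Ssa Sy !inner0r subrr.
Qed.

End PolarContractive.

Lemma polar_decomposition L S : is_abs L S ->
  exists U W, [/\ contractive U, is_adjoint U W,
    forall x, U (S x) = L x & forall x, W (L x) = S x].
Proof.
move=> LS; have [M M0 Sc] := bop_normalize S.
have M0' : 0 <= M^-1 by rewrite invr_ge0 ltW.
have cM : (M^-1)%:C != 0 :> C.
  by rewrite -(rmorph0 (real_complex R)) (inj_eq (@complexI R)) gt_eqF // invr_gt0.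
have [|U [W [Uc UW US WL]]] := polar_contractive (L := (M^-1)%:C *: L) _ Sc.
  case: LS => /positive_bopP[Ssa Spos] SL; split.
    apply/positive_bopP; split; first exact: scale_adjoint.
    by move=> x; rewrite bopE innerZl Re_realM mulr_ge0.
  by move=> x y; rewrite !bopE bopZ !innerZl !innerZr SL !mulrA conj_real.
exists U, W; split=> // x; first by have := US x; rewrite !bopE bopZ => /(scalerI cM).
by have := WL x; rewrite !bopE bopZ => /(scalerI cM).
Qed.

End Positive.

(** * Trace class operators and classes in the predual *)
Lemma ptws_eval_continuous (U : Type) (V : topologicalType) (i : U) :
  continuous (fun g : {ptws U -> V} => g i).
Proof.
move=> f; have /cvg_sup/(_ i)/cvg_image : f --> f by apply: cvg_id.
move=> h; apply: cvg_trans (h _) => {h}.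
  by move=> Q /= [W nbdW <-]; apply: filterS nbdW; exact: preimage_image.
by rewrite eqEsubset; split=> // y _; exists (fun=> y).
Qed.

Section TraceClass.
Variables (R : realType) (H : hilbertType R) (e : nat -> H).
Hypothesis e_basis : orthonormal_basis e.
Local Notation C := R[i].
Implicit Types x y z : H.
Implicit Types A B L S Z : bop H.

Lemma cvg_series_dominated (u : nat -> C) (a : nat -> R) M :
  (forall n, rnorm (u n) <= a n) ->
  (forall n, \sum_(0 <= k < n) a k <= M) -> cvgn (series u).
Proof.
move=> ua aM; apply: complex_cauchy_cvg => eps e0.
have a_ge0 n : 0 <= a n by apply: le_trans (ua n); exact: rnorm_ge0.
have [|N hN] := bounded_monotone_cauchy (u := fun n => \sum_(0 <= k < n) a k) _ aM e0.
  by move=> n; rewrite big_nat_recr //= lerDl.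
have {}hN m n : (N <= m)%N -> (m <= n)%N -> rnorm (series u n - series u m) <= eps.
  move=> Nm mn; rewrite sub_series_geq //; apply: le_trans (rnorm_sum _ _ _) _.
  have := hN _ _ (leq_trans Nm mn) Nm; apply: le_trans.
  rewrite [X in X - _](big_cat_nat (n := m)) //= addrAC subrr add0r.
  by apply: le_trans (ler_norm _); rewrite ler_sum.
exists N => m n Nm Nn; case: (leqP m n) => mn; last exact: hN (ltnW mn).
by rewrite rnorm_sub hN.
Qed.

(** The bound [M] on the squared Hilbert-Schmidt norm is a parameter, which
    spares the definition of that norm as a limit. *)
Definition hilbert_schmidt A M :=
  forall N, \sum_(0 <= n < N) rnorm (A (e n)) ^+ 2 <= M.

Lemma parseval_sum (f : nat -> H) N (eps : R) : 0 < eps -> exists K,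
  \sum_(0 <= n < N) rnorm (f n) ^+ 2 <=
  \sum_(0 <= n < N) \sum_(0 <= m < K) rnorm ('<f n, e m> : C) ^+ 2 + eps.
Proof.
elim: N eps => [|N IH] eps e0; first by exists 0%N; rewrite !big_geq // add0r ltW.
have e2 : 0 < eps / 2 by rewrite divr_gt0.
have [K1 h1] := IH _ e2; have [K2 h2] := parseval e_basis (f N) e2.
exists (maxn K1 K2); rewrite !big_nat_recr //=.
have := h2 _ (leq_maxr K1 K2).
suff : \sum_(0 <= n < N) \sum_(0 <= m < K1) rnorm ('<f n, e m> : C) ^+ 2 <=
  \sum_(0 <= n < N) \sum_(0 <= m < maxn K1 K2) rnorm ('<f n, e m> : C) ^+ 2 by lra.
apply: ler_sum => n _; rewrite [X in _ <= X](big_cat_nat (n := K1)) ?leq_maxl //=.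
by rewrite lerDl sumr_ge0 // => i _; rewrite sqr_ge0.
Qed.

(** Both sums equal the sum of the squared moduli of all the matrix entries. *)
Lemma hilbert_schmidt_adjoint A B M :
  is_adjoint A B -> hilbert_schmidt A M -> hilbert_schmidt B M.
Proof.
move=> AB AM N; apply/ler_addgt0Pr => eps e0.
have [K hK] := parseval_sum (fun n => B (e n)) N e0.
apply: le_trans hK _; rewrite lerD2r exchange_big_nat /=.
apply: le_trans (AM K); apply: ler_sum => m _.
apply: le_trans (bessel e_basis _ N).
apply: ler_sum => n _; rewrite (is_adjoint_sym AB) innerC rnormJ //.
Qed.

Lemma hilbert_schmidt_compl Z A M : hilbert_schmidt A M ->
  exists M', hilbert_schmidt (bop_comp Z A) M'.
Proof.
move=> AM; have [K K0 hK] := bop_bounded Z; exists (K ^+ 2 * M) => N.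
apply: (@le_trans _ _ (\sum_(0 <= n < N) K ^+ 2 * rnorm (A (e n)) ^+ 2)).
  apply: ler_sum => n _; rewrite -exprMn ler_pXn2r ?nnegrE ?rnorm_ge0 ?hK //.
  by rewrite mulr_ge0 ?rnorm_ge0 ?ltW.
by rewrite -mulr_sumr ler_wpM2l ?sqr_ge0.
Qed.

Lemma cvg_trace_hilbert_schmidt A B M M' :
  hilbert_schmidt A M -> hilbert_schmidt B M' ->
  cvgn (series (fun n => '<A (B (e n)), e n> : C)).
Proof.
move=> AM BM; have [A' AA'] := adjoint_exists e_basis A.
have A'M := hilbert_schmidt_adjoint AA' AM.
apply: (@cvg_series_dominated _
  (fun n => rnorm (A' (e n)) ^+ 2 + rnorm (B (e n)) ^+ 2) (M + M')).
  move=> n; rewrite AA'; apply: le_trans (rnorm_inner_le _ _) _.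
  have := rnorm_ge0 (A' (e n)); have := rnorm_ge0 (B (e n)).
  move: (rnorm _) (rnorm _) => a b; have := sqr_ge0 (a - b); nra.
by move=> n; rewrite big_split /= lerD.
Qed.

Lemma cvg_series_bounded (a : nat -> R) : (forall n, 0 <= a n) ->
  cvgn (series (fun n => (a n)%:C : C)) ->
  exists M, forall n, \sum_(0 <= k < n) a k <= M.
Proof.
move=> a0 /cvg_rnormP/(_ 1 ltr01)[N hN]; set l := limn _ in hN.
exists (rnorm l + 1) => n.
have sE k : series (fun n => (a n)%:C : C) k = (\sum_(0 <= i < k) a i)%:C.
  by rewrite rmorph_sum.
have s0 k : 0 <= \sum_(0 <= i < k) a i by rewrite sumr_ge0.
apply: (@le_trans _ _ (\sum_(0 <= k < maxn N n) a k)).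
  by rewrite [X in _ <= X](big_cat_nat (n := n)) ?leq_maxr //= lerDl sumr_ge0.
have := hN _ (leq_maxl N n); have := rnormD (series (fun n => (a n)%:C : C) (maxn N n) - l) l.
rewrite subrK sE rnorm_real ger0_norm //; lra.
Qed.

(** With [Q] the square root of [|L|] and [L = U |L|], the factors are [U Q] and
    [Q]: the trace of [|L|] is the squared Hilbert-Schmidt norm of [Q]. *)
Lemma trace_class_factor L : trace_class e L -> exists A B M,
  [/\ hilbert_schmidt A M, hilbert_schmidt B M & forall x, L x = A (B x)].
Proof.
move=> [S LS Scv]; have [U [W [Uc _ US _]]] := polar_decomposition e_basis LS.
have [Q Qpos QQ] := positive_square_root (proj1 LS).
have /positive_bopP[Qsa _] := Qpos.
have QE n : '<S (e n), e n> = (rnorm (Q (e n)) ^+ 2)%:C.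
  by rewrite -QQ Qsa inner_rnorm.
have [M QM] : exists M, forall N, \sum_(0 <= n < N) rnorm (Q (e n)) ^+ 2 <= M.
  apply: cvg_series_bounded => [n|]; first exact: sqr_ge0.
  by under eq_fun do rewrite -QE.
exists (bop_comp U Q), Q, M; split=> // [N|x]; last by rewrite bopE QQ US.
apply: le_trans (QM N); apply: ler_sum => n _.
by rewrite ler_pXn2r ?nnegrE ?rnorm_ge0 // Uc.
Qed.

Lemma cvg_trace Z L : trace_class e L ->
  cvgn (series (fun n => '<Z (L (e n)), e n> : C)).
Proof.
move=> /trace_class_factor[A [B [M [AM BM LE]]]].
have [M' ZAM] := hilbert_schmidt_compl Z AM.
rewrite (_ : (fun n => _) = (fun n => '<bop_comp Z A (B (e n)), e n> : C)).
  exact: cvg_trace_hilbert_schmidt ZAM BM.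
by apply/funext => n; rewrite LE.
Qed.

(** Equality of cosets requires trace class operators to form a group under
    addition. Writing [|L + L'| = W L + W L'] by polar decomposition reduces the
    trace of [|L + L'|] to two convergent traces. *)
Lemma trace_classD L L' : trace_class e L -> trace_class e L' ->
  trace_class e (L + L').
Proof.
move=> tL tL'; have [S LS] := abs_exists e_basis (L + L').
have [U [W [_ _ _ WL]]] := polar_decomposition e_basis LS.
exists S => //; rewrite (_ : (fun n => _) =
    (fun n => '<W (L (e n)), e n> : C) + (fun n => '<W (L' (e n)), e n> : C)).
  rewrite seriesD; apply: is_cvgD; exact: cvg_trace.
by apply/funext => n; rewrite -WL bopE bopD innerDl.
Qed.

Lemma trace_classN L : trace_class e L -> trace_class e (- L).
Proof.
move=> [S [Spos SL] Scv]; exists S => //; split=> // x y.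
rewrite !bopE SL -(scaleN1r (L x)) -(scaleN1r (L y)) innerZl innerZr.
by rewrite rmorphN rmorph1 !mulN1r opprK.
Qed.

Lemma trace_classB L L' : trace_class e L -> trace_class e L' ->
  trace_class e (L - L').
Proof. by move=> tL tL'; apply: trace_classD => //; exact: trace_classN. Qed.

Lemma trace_class_rank_one x y : trace_class e (rank_one x y).
Proof.
pose c : R := rnorm x / rnorm y.
have SE z : (c%:C *: rank_one y y) z = (c%:C * '<z, y>) *: y.
  by rewrite bopE scalerA.
have c0 : 0 <= c by rewrite divr_ge0 ?rnorm_ge0.
exists (c%:C *: rank_one y y); first split.
- move=> z; rewrite SE innerZl -mulrA [X in _ * (_ * X)]innerC mul_conj_rnorm.
  by rewrite -rmorphM ler0c mulr_ge0 ?sqr_ge0.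
- move=> u v; rewrite !SE /= !innerZl !innerZr !inner_rnorm.
  have [->|y0] := eqVneq y 0; first by rewrite !inner0r !(mulr0, mul0r).
  have ny : rnorm y != 0 by rewrite rnorm_eq0.
  rewrite [X in _ * X = _]innerC.
  have -> : c%:C * (c%:C * '<u, y> * (rnorm y ^+ 2)%:C) * Num.conj '<v, y> =
     (c ^+ 2 * rnorm y ^+ 2)%:C * ('<u, y> * Num.conj '<v, y>).
    by rewrite !rmorphM; ring.
  rewrite -exprMn /c divfK //. by ring.
- apply: (@cvg_series_dominated _ (fun n => c * rnorm ('<y, e n> : C) ^+ 2) (c * rnorm y ^+ 2)).
    move=> n; rewrite SE innerZl -mulrA [X in _ * (X * _)]innerC.
    rewrite [X in _ * X]mulrC mul_conj_rnorm -rmorphM rnorm_real.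
    by rewrite ger0_norm // mulr_ge0 ?sqr_ge0.
  by move=> n; rewrite -mulr_sumr ler_wpM2l // bessel.
Qed.

Lemma bop_trace_rank_one Z x y :
  bop_trace e (bop_comp Z (rank_one x y)) = '<Z x, y>.
Proof.
apply: cvg_lim => //.
rewrite (_ : series _ = (fun n => '<expansion e (fun k => '<Z x, e k>) n, y>)).
  by apply: inner_cvg_l; exact: expansion_cvg.
apply/funext => n; rewrite inner_suml; apply: eq_bigr => k _.
by rewrite bopE /= bopZ !innerZl mulrC.
Qed.

Lemma cvg_bop_trace Z L : trace_class e L ->
  series (fun n => '<Z (L (e n)), e n> : C) @ \oo --> bop_trace e (bop_comp Z L).
Proof. by move=> tL; exact: (cvg_trace (Z := Z) tL). Qed.

Lemma bop_traceB Z L L' : trace_class e L -> trace_class e L' ->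
  bop_trace e (bop_comp Z (L - L')) =
  bop_trace e (bop_comp Z L) - bop_trace e (bop_comp Z L').
Proof.
move=> tL tL'; apply: cvg_lim => //.
rewrite (_ : series _ = series (fun n => '<Z (L (e n)), e n> : C)
  - series (fun n => '<Z (L' (e n)), e n> : C)).
  by apply: cvgB; exact: cvg_bop_trace.
rewrite -seriesN -seriesD; congr series; apply/funext => n.
by rewrite bopE bopE bopB innerBl.
Qed.

Lemma bop_traceD Z L L' : trace_class e L -> trace_class e L' ->
  bop_trace e (bop_comp Z (L + L')) =
  bop_trace e (bop_comp Z L) + bop_trace e (bop_comp Z L').
Proof.
move=> tL tL'; apply: cvg_lim => //.
rewrite (_ : series _ = series (fun n => '<Z (L (e n)), e n> : C)
  + series (fun n => '<Z (L' (e n)), e n> : C)).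
  by apply: cvgD; exact: cvg_bop_trace.
rewrite -seriesD; congr series; apply/funext => n.
by rewrite bopE bopE bopD innerDl.
Qed.

Lemma bop_trace_horner p A L : trace_class e L ->
  (forall k, bop_trace e (bop_comp (iter k (bop_comp A) (bop_id H)) L) = 0) ->
  bop_trace e (bop_comp (bop_horner p A) L) = 0.
Proof.
move=> tL h0; apply: cvg_lim => //.
pose u k := series (fun n => '<iter k (bop_comp A) (bop_id H) (L (e n)), e n> : C).
have u0 k : u k @ \oo --> (0 : C) by rewrite -(h0 k); exact: cvg_bop_trace.
rewrite (_ : series _ = fun N => \sum_(k < size p) p`_k * u k N).
  rewrite -[X in _ --> X](_ : \sum_(k < size p) p`_k * 0 = 0); last first.
    by rewrite big1 // => k _; rewrite mulr0.
  apply: (@cvg_finite_sum R C) => k; apply: cvgMr; exact: u0.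
apply/funext => N; rewrite /series /u /=.
under [in RHS]eq_bigr do rewrite mulr_sumr.
rewrite exchange_big /=; apply: eq_bigr => n _.
rewrite /bop_horner sum_bopE inner_suml; apply: eq_bigr => k _.
by rewrite bopE innerZl.
Qed.

(** The functional [tr (Z L)] is weak*-continuous in [Z] and vanishes on the
    polynomials in [A], hence on their closure. *)
Lemma preannihilator_generated A L : trace_class e L ->
  (forall k, bop_trace e (bop_comp (iter k (bop_comp A) (bop_id H)) L) = 0) ->
  preannihilator e (generated_dual_algebra e A) L.
Proof.
move=> tL h0; split=> // Z.
pose F : weakstar e -> C := fun Z => trace_pairing Z (exist _ L tL).
have Fcont : continuous F.
  move=> Y; apply: (@continuous_comp (weakstar e) _ _ (@trace_pairing R H e)
     (fun g => g (exist _ L tL))).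
    exact: initial_continuous.
  exact: ptws_eval_continuous.
have cl : closed (F @^-1` [set 0]).
  apply: preimage_closed => [Y _|]; first exact: Fcont.
  exact/accessible_closed_set1/hausdorff_accessible/norm_hausdorff.
have sub : [set bop_horner p A | p in [set: {poly C}]] `<=` F @^-1` [set 0].
  by move=> _ [p _ <-]; exact: bop_trace_horner.
by move=> /(@closureS (weakstar e) _ _ sub); rewrite -((closure_id _).1 cl).
Qed.

(** A class in the predual of the algebra generated by [A] is determined by the
    moments [tr (A ^ k L)]. This turns the theorem into a moment problem. *)
Lemma predual_class_eq A L L' : trace_class e L -> trace_class e L' ->
  (forall k, bop_trace e (bop_comp (iter k (bop_comp A) (bop_id H)) L) =
             bop_trace e (bop_comp (iter k (bop_comp A) (bop_id H)) L')) ->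
  predual_class e (generated_dual_algebra e A) L =
  predual_class e (generated_dual_algebra e A) L'.
Proof.
wlog suff : L L' / trace_class e L -> trace_class e L' ->
  (forall k, bop_trace e (bop_comp (iter k (bop_comp A) (bop_id H)) L) =
             bop_trace e (bop_comp (iter k (bop_comp A) (bop_id H)) L')) ->
  predual_class e (generated_dual_algebra e A) L `<=`
  predual_class e (generated_dual_algebra e A) L'.
  by move=> h tL tL' LL'; apply/seteqP; split; apply: h => // k; rewrite LL'.
move=> tL tL' LL' _ [N [tN hN] <-].
exists (L - L' + N); last by rewrite addrA (addrC L') subrK.
have tLL' := trace_classB tL tL'.
have [_ hLL'] : preannihilator e (generated_dual_algebra e A) (L - L').
  by apply: preannihilator_generated => // k; rewrite bop_traceB // LL' subrr.
split=> [|Z DZ]; first exact: trace_classD.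
by rewrite bop_traceD // hLL' // hN // addr0.
Qed.

End TraceClass.

(** * Correlations of finitely supported sequences *)
Section FinitePairs.
Variable R : realType.
Local Notation C := R[i].
Implicit Types u v : {poly C}.

(** Finitely supported sequences are encoded as polynomials, whose coefficients
    vanish beyond the size. *)
Definition pnorm2 u : R := \sum_(0 <= p < size u) rnorm (u`_p : C) ^+ 2.

(** The moments [<S ^ k u, v>] of the unweighted unilateral shift [S]. *)
Definition corr u v k : C := \sum_(0 <= p < size u) u`_p * Num.conj v`_(p + k).

Lemma big_nat_widen_poly (V : nmodType) N u (F : nat -> V) : (size u <= N)%N ->
  (forall p, u`_p = 0 -> F p = 0) ->
  \sum_(0 <= p < size u) F p = \sum_(0 <= p < N) F p.
Proof.
move=> uN F0; rewrite [RHS](big_cat_nat (n := size u)) //= [X in _ + X]big_nat.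
by rewrite [X in _ + X]big1 ?addr0 // => p /andP[up _]; rewrite F0 // nth_default.
Qed.

Lemma pnorm2E N u : (size u <= N)%N ->
  pnorm2 u = \sum_(0 <= p < N) rnorm (u`_p : C) ^+ 2.
Proof.
by move=> uN; apply: big_nat_widen_poly => // p ->; rewrite rnorm0 expr0n.
Qed.

Lemma corrE N u v k : (size u <= N)%N ->
  corr u v k = \sum_(0 <= p < N) u`_p * Num.conj v`_(p + k).
Proof. by move=> uN; apply: big_nat_widen_poly => // p ->; rewrite mul0r. Qed.

Lemma pnorm2_ge0 u : 0 <= pnorm2 u.
Proof. by apply: sumr_ge0 => p _; rewrite sqr_ge0. Qed.

Lemma pnorm2_0 : pnorm2 0 = 0.
Proof. by rewrite /pnorm2 size_poly0 big_geq. Qed.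

Lemma corr0 v k : corr 0 v k = 0.
Proof. by rewrite /corr size_poly0 big_geq. Qed.

(** A square-summable family of pairs whose correlations add up to [phi]. A
    cluster point of the partial sums is enough for the use made of this notion
    and, unlike a limit, ignores what happens inside a finite group of terms. *)
Definition represented (phi : nat -> C) M := exists l : nat -> {poly C} * {poly C},
  [/\ forall n, \sum_(0 <= c < n) pnorm2 (l c).1 <= M,
      forall n, \sum_(0 <= c < n) pnorm2 (l c).2 <= M &
      forall k (eps : R) n0, 0 < eps -> exists2 n, (n0 <= n)%N &
        rnorm (\sum_(0 <= c < n) corr (l c).1 (l c).2 k - phi k) <= eps].

(** A sequence of finite lists is read as a single sequence. The dummy pair
    [(0, 0)] put in front of every list makes the concatenation infinite. *)
Section Flatten.
Variable D : nat -> seq ({poly C} * {poly C}).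

Let D' q := (0, 0) :: D q.
Let P Q := flatten (mkseq D' Q).
Let l c := nth (0, 0) (P c.+1) c.

Lemma flatten_prefixS Q : P Q.+1 = P Q ++ D' Q.
Proof. by rewrite /P /mkseq -addn1 iotaD map_cat flatten_cat /= cats0. Qed.

Lemma flatten_size Q : (Q <= size (P Q))%N.
Proof. by elim: Q => // Q IH; rewrite flatten_prefixS size_cat -addn1 leq_add. Qed.

Lemma flatten_nth Q c : (c < size (P Q))%N -> nth (0, 0) (P Q) c = l c.
Proof.
have widen A B : (A <= B)%N -> (c < size (P A))%N ->
    nth (0, 0) (P B) c = nth (0, 0) (P A) c.
  elim: B => [|B IH]; first by rewrite leqn0 => /eqP ->.
  rewrite leq_eqVlt => /predU1P[-> //|]; rewrite ltnS => AB cA.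
  rewrite flatten_prefixS nth_cat -IH //; case: ifP => // /negP []; apply: leq_trans cA _.
  elim: B AB {IH} => [|B IH]; first by rewrite leqn0 => /eqP ->.
  rewrite leq_eqVlt => /predU1P[-> //|]; rewrite ltnS => /IH h.
  by rewrite flatten_prefixS size_cat (leq_trans h) // leq_addr.
move=> cQ; rewrite /l; case: (leqP Q c.+1) => h; first by rewrite (widen Q c.+1).
by rewrite (widen c.+1 Q) ?(ltnW h) // flatten_size.
Qed.

Lemma flatten_sum (V : nmodType) (F : {poly C} * {poly C} -> V) Q : F (0, 0) = 0 ->
  \sum_(0 <= c < size (P Q)) F (l c) =
  \sum_(0 <= q < Q) \sum_(x <- D q) F x.
Proof.
move=> F0; transitivity (\sum_(x <- P Q) F x).
  rewrite (big_nth (0, 0)); apply: eq_big_nat => c /andP[_ cQ].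
  by rewrite flatten_nth.
elim: Q => [|Q IH]; first by rewrite big_nil big_geq.
by rewrite flatten_prefixS big_cat /= IH big_nat_recr //= big_cons F0 add0r.
Qed.

Lemma represented_of_lists phi M :
  (forall Q, \sum_(0 <= q < Q) \sum_(x <- D q) pnorm2 x.1 <= M) ->
  (forall Q, \sum_(0 <= q < Q) \sum_(x <- D q) pnorm2 x.2 <= M) ->
  (forall k (eps : R), 0 < eps -> exists Q0, forall Q, (Q0 <= Q)%N ->
     rnorm (\sum_(0 <= q < Q) \sum_(x <- D q) corr x.1 x.2 k - phi k) <= eps) ->
  represented phi M.
Proof.
move=> M1 M2 lim; exists l.
have bound (F : {poly C} * {poly C} -> R) : F (0, 0) = 0 -> (forall x, 0 <= F x) ->
    (forall Q, \sum_(0 <= q < Q) \sum_(x <- D q) F x <= M) ->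
    forall n, \sum_(0 <= c < n) F (l c) <= M.
  move=> F0 Fge FM n; apply: le_trans (FM n); rewrite -flatten_sum //.
  rewrite [X in _ <= X](big_cat_nat (n := n)) ?flatten_size //=.
  by rewrite lerDl sumr_ge0.
split=> [||k eps n0 e0].
- by apply: (bound (fun x => pnorm2 x.1)) => //= [|x]; [exact: pnorm2_0 | exact: pnorm2_ge0].
- by apply: (bound (fun x => pnorm2 x.2)) => //= [|x]; [exact: pnorm2_0 | exact: pnorm2_ge0].
have [Q0 hQ] := lim k eps e0; exists (size (P (maxn n0 Q0))).
  by apply: leq_trans (flatten_size _); exact: leq_maxl.
by rewrite (flatten_sum (F := fun x => corr x.1 x.2 k)) ?corr0 // hQ // leq_maxr.
Qed.

End Flatten.

(** Weights between 0 and 1 are traded for a finite family of unweighted pairs. *)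
Section Weights.
Variable w : nat -> R.
Hypothesis w01 : forall n, 0 <= w n <= 1.

Definition wprod p k : R := \prod_(p <= s < p + k) w s.

(** Coordinate [l] of a unit vector [g_p], where [g_0 = d_0] and
    [g_(p + 1) = w_p g_p + sqrt (1 - w_p ^ 2) d_(p + 1)]. *)
Fixpoint gram p l : R :=
  if p is p'.+1 then w p' * gram p' l + Num.sqrt (1 - w p' ^+ 2) * (l == p)%:R
  else (l == 0%N)%:R.

Lemma gram_gt p l : (p < l)%N -> gram p l = 0.
Proof.
elim: p => [|p IH] pl /=; first by case: l pl.
by rewrite IH ?(ltnW pl) // mulr0 add0r gtn_eqF // mulr0.
Qed.

(** The products [w_p ... w_(q - 1)] form the Gram matrix of the vectors [g_p]:
    passing from [g_q] to [g_(q + 1)] multiplies the inner product with an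
    earlier [g_p] by [w_q], the new coordinate being orthogonal to [g_p]. *)
Lemma gram_wprod N p k : (p + k < N)%N ->
  \sum_(0 <= l < N) gram p l * gram (p + k) l = wprod p k.
Proof.
have delta (F : nat -> R) m : (m < N)%N ->
    \sum_(0 <= l < N) F l * (l == m)%:R = F m.
  move=> mN; rewrite big_mkord (bigD1 (Ordinal mN)) //= eqxx mulr1 big1 ?addr0 //.
  by move=> i; rewrite -val_eqE /= => /negbTE ->; rewrite mulr0.
elim: k p => [|k IH] p.
  rewrite addn0 /wprod addn0 big_geq //; elim: p => [|p IHp] pN /=.
    by rewrite delta.
  have /andP[w0 w1] := w01 p.
  have s0 : 0 <= 1 - w p ^+ 2 by nra.
  set s := Num.sqrt _; have sE : s ^+ 2 = 1 - w p ^+ 2 by rewrite sqr_sqrtr.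
  rewrite (eq_bigr (fun l => w p ^+ 2 * (gram p l * gram p l) +
      (2 * w p * gram p l * s + s ^+ 2 * (l == p.+1)%:R) * (l == p.+1)%:R)).
    2: by move=> l _; move: (gram p l) ((l == p.+1)%:R : R) => G b; ring.
  rewrite big_split /= -mulr_sumr IHp ?(ltnW pN) // delta //.
  by rewrite gram_gt // eqxx sE /=; ring.
rewrite addnS => pkN /=; have := IH p (ltnW pkN) => {}IH.
under eq_bigr do rewrite mulrDr mulrCA mulrA.
rewrite big_split /=.
have -> : \sum_(0 <= l < N) w (p + k)%N * gram p l * gram (p + k) l = w (p + k)%N * wprod p k.
  by rewrite -IH mulr_sumr; apply: eq_bigr => l _; rewrite mulrA.
under [X in _ + X]eq_bigr do rewrite mulrA.
rewrite delta // gram_gt; last by lia.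
by rewrite mul0r addr0 /wprod addnS big_nat_recr ?leq_addr //= mulrC.
Qed.

(** The moments [<T ^ k u, v>] of the shift [T] with weights [w]. *)
Definition wcorr u v k : C :=
  \sum_(0 <= p < size u) (wprod p k)%:C * (u`_p * Num.conj v`_(p + k)).

Lemma wcorrE N u v k : (size u <= N)%N ->
  wcorr u v k = \sum_(0 <= p < N) (wprod p k)%:C * (u`_p * Num.conj v`_(p + k)).
Proof.
by move=> uN; apply: big_nat_widen_poly => // p ->; rewrite mul0r mulr0.
Qed.

Definition twist N u l : {poly C} := \poly_(p < N) (u`_p * (gram p l)%:C).

Definition untwist N u v : seq ({poly C} * {poly C}) :=
  [seq (twist N u l, twist N v l) | l <- index_iota 0 N].

Lemma pnorm2_twist N u : (size u <= N)%N ->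
  \sum_(0 <= l < N) pnorm2 (twist N u l) = pnorm2 u.
Proof.
move=> uN; rewrite (pnorm2E uN).
under eq_bigr do rewrite (pnorm2E (size_poly _ _)).
rewrite exchange_big_nat /=; apply: eq_big_nat => p /andP[_ pN].
under eq_bigr do rewrite coef_poly pN rnormM rnorm_real exprMn real_normK ?num_real // expr2.
rewrite -mulr_sumr.
have := @gram_wprod N p 0; rewrite !addn0 => ->//.
by rewrite /wprod addn0 big_geq // mulr1.
Qed.

(** Expanding the inner product [<g_p, g_q>] over its coordinates [l] splits the
    weighted correlation into unweighted ones, and the total energy is unchanged
    because the [g_p] are unit vectors. *)
Lemma corr_untwist N u v k : (size u <= N)%N -> (size v <= N)%N ->
  \sum_(x <- untwist N u v) corr x.1 x.2 k = wcorr u v k.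
Proof.
move=> uN vN; rewrite big_map /= (wcorrE _ _ uN).
under eq_bigr do rewrite (corrE _ _ (size_poly _ _)).
rewrite exchange_big_nat /=; apply: eq_big_nat => p /andP[_ pN].
under eq_bigr do rewrite !coef_poly pN.
case: (ltnP (p + k) N) => pk; last first.
  rewrite big1 => [|i _]; last by rewrite rmorph0 mulr0.
  by rewrite (nth_default _ (leq_trans vN pk)) rmorph0 !mulr0.
under eq_bigr do rewrite rmorphM /= conj_real mulrACA -rmorphM mulrC.
by rewrite -mulr_suml -rmorph_sum /= gram_wprod.
Qed.

End Weights.

End FinitePairs.

(** * From Hilbert-Schmidt matrices to correlations *)
Section MatrixPairs.
Variable R : realType.
Local Notation C := R[i].
Implicit Types u v : {poly C}.
Variable w : nat -> R.
Hypothesis w01 : forall n, 0 <= w n <= 1.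

Lemma size_sub_leq N u v : (size u <= N)%N -> (size v <= N)%N ->
  (size (u - v : {poly C})%R <= N)%N.
Proof.
move=> uN vN; apply: leq_trans (size_polyD _ _) _.
by rewrite size_polyN geq_max uN.
Qed.

Lemma wcorr_sub u u' v v' k :
  wcorr w u' v' k - wcorr w u v k = wcorr w (u' - u) v' k + wcorr w u (v' - v) k.
Proof.
have uM := leq_maxl (size u) (size u'); have u'M := leq_maxr (size u) (size u').
rewrite !(@wcorrE _ w (maxn (size u) (size u'))) ?size_sub_leq //.
rewrite -sumrB -big_split; apply: eq_bigr => p _ /=.
by rewrite !coefB rmorphB; ring.
Qed.

Lemma wcorr_scale (s : R) u v k : s != 0 ->
  wcorr w (s%:C *: u) (s^-1%:C *: v) k = wcorr w u v k.
Proof.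
move=> s0; rewrite (@wcorrE _ w (size u) (_ *: _)) ?size_scale_leq //.
apply: eq_bigr => p _; rewrite !coefZ rmorphM /=.
rewrite conj_real [X in _ * X]mulrACA.
by rewrite -rmorphM mulfV // mul1r.
Qed.

Lemma pnorm2_scale (s : R) u : pnorm2 (s%:C *: u) = s ^+ 2 * pnorm2 u.
Proof.
rewrite (@pnorm2E _ (size u)) ?size_scale_leq // mulr_sumr.
apply: eq_bigr => p _.
by rewrite coefZ rnormM rnorm_real exprMn real_normK ?num_real.
Qed.

Definition trunc (F : nat -> nat -> C) N n : {poly C} :=
  if (n < N)%N then \poly_(p < N) F n p else 0.

Definition energy (F : nat -> nat -> C) N : R :=
  \sum_(0 <= n < N) \sum_(0 <= p < N) rnorm (F n p) ^+ 2.

Lemma size_trunc F N n : (size (trunc F N n) <= N)%N.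
Proof. by rewrite /trunc; case: ifP; rewrite ?size_poly ?size_poly0. Qed.

Lemma coef_trunc F N n p :
  (trunc F N n)`_p = if (n < N)%N && (p < N)%N then F n p else 0.
Proof. by rewrite /trunc; case: ifP => //= _; rewrite ?coef_poly ?coef0. Qed.

Lemma big_nat_widen_if (V : nmodType) N N' (F : nat -> V) : (N <= N')%N ->
  \sum_(0 <= n < N) F n = \sum_(0 <= n < N') if (n < N)%N then F n else 0.
Proof.
move=> NN'; rewrite [RHS](big_cat_nat (n := N)) //= [X in _ = _ + X]big_nat.
rewrite [X in _ = _ + X]big1 ?addr0 => [|n /andP[Nn _]]; last by rewrite ltnNge Nn.
by apply: eq_big_nat => n /andP[_ ->].
Qed.

Lemma energy_widen F N N' : (N <= N')%N -> energy F N =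
  \sum_(0 <= n < N') \sum_(0 <= p < N')
     if (n < N)%N && (p < N)%N then rnorm (F n p) ^+ 2 else 0.
Proof.
move=> NN'; rewrite /energy (big_nat_widen_if _ NN'); apply: eq_bigr => n _.
rewrite (big_nat_widen_if _ NN'); case: ifP => // _.
by rewrite big1.
Qed.

Lemma energy_trunc_sub F N N' : (N <= N')%N ->
  \sum_(0 <= n < N') pnorm2 (trunc F N' n - trunc F N n) = energy F N' - energy F N.
Proof.
move=> NN'; rewrite (energy_widen _ NN') /energy -sumrB.
apply: eq_big_nat => n /andP[_ nN'].
rewrite (@pnorm2E _ N') ?size_sub_leq ?(leq_trans (size_trunc _ _ _)) //.
rewrite -sumrB; apply: eq_big_nat => p /andP[_ pN'].
rewrite coefB !coef_trunc nN' pN' /=; case: ifP => _; last by rewrite !subr0.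
by rewrite !subrr rnorm0 expr0n.
Qed.

Lemma energy0 F : energy F 0 = 0.
Proof. by rewrite /energy big_geq. Qed.

Lemma energy_trunc F N N' : (N <= N')%N ->
  \sum_(0 <= n < N') pnorm2 (trunc F N n) = energy F N.
Proof.
move=> NN'; rewrite (energy_widen _ NN').
apply: eq_big_nat => n /andP[_ nN'].
rewrite (@pnorm2E _ N') ?(leq_trans (size_trunc _ _ _)) //.
apply: eq_big_nat => p _; rewrite coef_trunc.
by case: ifP => _ //; rewrite rnorm0 expr0n.
Qed.

Lemma energy_mono F N : energy F N <= energy F N.+1.
Proof.
rewrite -subr_ge0 -energy_trunc_sub // sumr_ge0 // => n _; exact: pnorm2_ge0.
Qed.

Variables U V : nat -> nat -> C.
Variable M : R.
Hypotheses (UM : forall N, energy U N <= M) (VM : forall N, energy V N <= M).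

Definition truncated_moment N k :=
  \sum_(0 <= n < N) wcorr w (trunc U N n) (trunc V N n) k.

Lemma truncated_moment_widen N N' k : (N <= N')%N ->
  truncated_moment N k = \sum_(0 <= n < N') wcorr w (trunc U N n) (trunc V N n) k.
Proof.
move=> NN'; rewrite /truncated_moment (big_nat_widen_if _ NN').
apply: eq_bigr => n _; case: ifP => // nN.
by rewrite /trunc nN /wcorr size_poly0 big_geq.
Qed.

Lemma geometric_sum (a : R) Q : \sum_(0 <= q < Q) a * 4^-1 ^+ q = a * (4 / 3) * (1 - 4^-1 ^+ Q).
Proof.
elim: Q => [|Q IH]; first by rewrite big_geq // expr0 subrr mulr0.
by rewrite big_nat_recr //= IH exprS; field.
Qed.

(** Cutoffs along which the energy tails decay like [16 ^ - q]. They start at 0,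
    where the tail is only bounded by [M], hence the constant [M + 1]; the 1
    makes it positive. *)
Lemma fast_cutoffs : exists Nq : nat -> nat,
  [/\ Nq 0%N = 0%N, forall q, (Nq q <= Nq q.+1)%N, forall q, (q <= Nq q)%N &
   forall q, energy U (Nq q.+1) - energy U (Nq q) <= (M + 1) * 16^-1 ^+ q /\
             energy V (Nq q.+1) - energy V (Nq q) <= (M + 1) * 16^-1 ^+ q].
Proof.
have M0 : 0 <= M by rewrite -(energy0 U).
have e0 q : 0 < (M + 1) * 16^-1 ^+ q :> R.
  by rewrite mulr_gt0 // ?exprn_gt0 ?invr_gt0 //; lra.
have /choice[m hm] : forall q, exists m, forall N N', (m <= N)%N -> (m <= N')%N ->
    energy U N' - energy U N <= (M + 1) * 16^-1 ^+ q /\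
    energy V N' - energy V N <= (M + 1) * 16^-1 ^+ q.
  move=> q.
  have [m1 h1] := bounded_monotone_cauchy (@energy_mono U) UM (e0 q).
  have [m2 h2] := bounded_monotone_cauchy (@energy_mono V) VM (e0 q).
  exists (maxn m1 m2) => N N'; rewrite !geq_max => /andP[a1 a2] /andP[b1 b2].
  split; apply: le_trans (ler_norm _) _; [exact: h1 | exact: h2].
pose Nq := fix F q := if q is q'.+1 then maxn (F q') (maxn (m q) q) else 0%N.
have NqS q : Nq q.+1 = maxn (Nq q) (maxn (m q.+1) q.+1) by [].
have mono q : (Nq q <= Nq q.+1)%N by rewrite NqS leq_maxl.
have Nm q : (m q.+1 <= Nq q.+1)%N by rewrite NqS; lia.
exists Nq; split=> // [[|q] //|[|q]]; first by rewrite NqS; lia.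
  rewrite expr0 mulr1 !energy0 !subr0; split; [have := UM (Nq 1%N) | have := VM (Nq 1%N)]; lra.
by apply: hm => //; apply: leq_trans (Nm q) (mono _).
Qed.

(** The increment of the truncated moment between two consecutive cutoffs is
    [corr (u' - u) v' + corr u (v' - v)]. In each product one factor is of order
    [4 ^ - q] and the other is bounded; rescaling by [s q = 2 ^ q] balances the
    two norms, and makes both series of squared norms geometric. *)
Lemma represented_of_matrices (phi : nat -> C) :
  (forall k (eps : R), 0 < eps -> exists N0, forall N, (N0 <= N)%N ->
     rnorm (truncated_moment N k - phi k) <= eps) ->
  exists M', represented phi M'.
Proof.
move=> lim; have [Nq [Nq0 Nmono Nge Ntail]] := fast_cutoffs.
have M0 : 0 <= M by rewrite -(energy0 U).
pose s q : R := 2 ^+ q.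
have s_neq0 q : s q != 0 by rewrite expf_neq0 ?pnatr_eq0.
pose piece q n : seq ({poly C} * {poly C}) :=
  let N := Nq q in let N' := Nq q.+1 in
  untwist w N' ((s q)%:C *: (trunc U N' n - trunc U N n)) ((s q)^-1%:C *: trunc V N' n) ++
  untwist w N' ((s q)^-1%:C *: trunc U N n) ((s q)^-1^-1%:C *: (trunc V N' n - trunc V N n)).
pose D q := flatten [seq piece q n | n <- index_iota 0 (Nq q.+1)].
have szZ a q n F : (size (a *: trunc F (Nq q) n : {poly C}) <= Nq q.+1)%N.
  by apply: leq_trans (size_scale_leq _ _) (leq_trans (size_trunc _ _ _) _).
have szZ' a q n F : (size (a *: trunc F (Nq q.+1) n : {poly C}) <= Nq q.+1)%N.
  by apply: leq_trans (size_scale_leq _ _) (size_trunc _ _ _).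
have szB a q n F : (size (a *: (trunc F (Nq q.+1) n - trunc F (Nq q) n))%R <= Nq q.+1)%N.
  apply: leq_trans (size_scale_leq _ _) (size_sub_leq _ _); first exact: size_trunc.
  exact: leq_trans (size_trunc _ _ _) _.
have sumD (W : nmodType) (F : {poly C} * {poly C} -> W) q :
    \sum_(x <- D q) F x = \sum_(0 <= n < Nq q.+1) \sum_(x <- piece q n) F x.
  by rewrite big_flatten big_map.
have s2 q : s q ^+ 2 = 4 ^+ q by rewrite /s -exprM mulnC exprM -natrX.
have s2V q : (s q)^-1 ^+ 2 = 4^-1 ^+ q by rewrite exprVn s2 -exprVn.
have cancel16 q : 4 ^+ q * ((M + 1) * 16^-1 ^+ q) = (M + 1) * 4^-1 ^+ q :> R.
  rewrite mulrCA -exprMn; congr (_ * _ ^+ _); lra.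
have tail q x y : x <= (M + 1) * 16^-1 ^+ q -> y <= M ->
    s q ^+ 2 * x + (s q)^-1 ^+ 2 * y <= (2 * M + 1) * 4^-1 ^+ q :> R.
  move=> xq yM; rewrite s2 s2V.
  have p1 : 0 <= 4 ^+ q :> R by rewrite exprn_ge0.
  have p2 : 0 <= 4^-1 ^+ q :> R by rewrite exprn_ge0 // invr_ge0.
  have := ler_wpM2l p1 xq; rewrite cancel16; have := ler_wpM2l p2 yM; lra.
have D1 q : \sum_(x <- D q) pnorm2 x.1 <= (2 * M + 1) * 4^-1 ^+ q.
  rewrite sumD; under eq_bigr do rewrite big_cat !big_map /= !pnorm2_twist // !pnorm2_scale.
  rewrite big_split /= -!mulr_sumr energy_trunc_sub // energy_trunc //.
  by apply: tail => //; have [] := Ntail q.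
have D2 q : \sum_(x <- D q) pnorm2 x.2 <= (2 * M + 1) * 4^-1 ^+ q.
  rewrite sumD; under eq_bigr do rewrite big_cat !big_map /= !pnorm2_twist // !pnorm2_scale.
  rewrite big_split /= -!mulr_sumr energy_trunc_sub // energy_trunc // addrC invrK.
  by apply: tail => //; have [] := Ntail q.
have Dc q k : \sum_(x <- D q) corr x.1 x.2 k =
    truncated_moment (Nq q.+1) k - truncated_moment (Nq q) k.
  rewrite sumD (truncated_moment_widen _ (Nmono q)) -sumrB; apply: eq_bigr => n _.
  rewrite big_cat /= !corr_untwist // wcorr_sub !wcorr_scale //.
  by rewrite invr_eq0.
have Dtel Q k : \sum_(0 <= q < Q) \sum_(x <- D q) corr x.1 x.2 k = truncated_moment (Nq Q) k.
  elim: Q => [|Q IH]; first by rewrite big_geq // Nq0 /truncated_moment big_geq.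
  by rewrite big_nat_recr //= IH Dc addrC subrK.
have bound (f : nat -> R) : (forall q, f q <= (2 * M + 1) * 4^-1 ^+ q) ->
    forall Q, \sum_(0 <= q < Q) f q <= (2 * M + 1) * (4 / 3).
  move=> fq Q; apply: le_trans (ler_sum _ (fun q _ => fq q)) _.
  rewrite geometric_sum.
  have p : 0 <= 4^-1 ^+ Q :> R by rewrite exprn_ge0 // invr_ge0.
  nra.
exists ((2 * M + 1) * (4 / 3)).
apply: (@represented_of_lists _ D) => [||k eps /(lim k)[N0 hN]].
- exact: bound D1.
- exact: bound D2.
by exists N0 => Q NQ; rewrite Dtel hN // (leq_trans NQ).
Qed.

End MatrixPairs.

(** * Moments of a weighted shift against a trace class operator *)
Section ShiftMoments.
Variables (R : realType) (H : hilbertType R) (e : nat -> H).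
Hypothesis e_basis : orthonormal_basis e.
Local Notation C := R[i].
Variable w : nat -> R.
Hypothesis w01 : forall n, 0 <= w n <= 1.
Variable T : bop H.
Hypothesis Te : forall n, T (e n) = (w n)%:C *: e n.+1.
Implicit Types x y : H.

Lemma wprodS p k : wprod w p k.+1 = wprod w p k * w (p + k)%N.
Proof. by rewrite /wprod addnS big_nat_recr ?leq_addr. Qed.

Lemma wprod_bound p k : 0 <= wprod w p k <= 1.
Proof.
elim: k => [|k IH]; first by rewrite /wprod addn0 big_geq // ler01 lexx.
rewrite wprodS; have /andP[a b] := IH; have /andP[c d] := w01 (p + k).
by apply/andP; split; nra.
Qed.

Lemma shift_iter_basis k n : iter k T (e n) = (wprod w n k)%:C *: e (n + k)%N.
Proof.
elim: k => [|k IH]; first by rewrite /wprod !addn0 big_geq // scale1r.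
by rewrite iterS IH bopZ Te scalerA -rmorphM wprodS addnS.
Qed.

Lemma shift_coef k r x : '<iter k T x, e r> =
  (if (r < k)%N then 0 else wprod w (r - k) k)%:C * '<x, e (r - k)%N> :> C.
Proof.
have [T' TT'] := adjoint_exists e_basis (iter k (bop_comp T) (bop_id H)).
suff T'e : T' (e r) = (if (r < k)%N then 0 else wprod w (r - k) k)%:C *: e (r - k)%N.
  by rewrite -iter_bop_compE TT' T'e innerZr conj_real.
apply: (basis_ext e_basis) => n; rewrite (is_adjoint_sym TT') iter_bop_compE.
rewrite shift_iter_basis innerZr innerZl !(basis_inner e_basis).
rewrite conj_real; case: ltnP => rk.
  by rewrite mul0r (_ : (r == (n + k)%N) = false) ?mulr0 //; apply/eqP; lia.
rewrite -[X in X == (n + k)%N](subnK rk) eqn_add2r.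
by case: eqP => [->//|_]; rewrite !mulr0.
Qed.

Lemma big_nat_shift (V : nmodType) (f : nat -> V) k N :
  \sum_(0 <= p < N) (if (p + k < N)%N then f p else 0) =
  \sum_(0 <= r < N) (if (r < k)%N then 0 else f (r - k)%N).
Proof.
case: (leqP N k) => Nk.
  rewrite big_nat big1 => [|p /andP[_ pN]]; last by rewrite ifF //; lia.
  by rewrite big_nat big1 // => r /andP[_ rN]; rewrite (leq_trans rN Nk).
rewrite [RHS](big_cat_nat (n := k)) ?(ltnW Nk) //= [X in _ = X + _]big_nat.
rewrite [X in _ = X + _]big1 ?add0r => [|r /andP[_ ->] //].
rewrite -{2}[k]add0n big_addn.
rewrite (big_nat_widen_if (N := (N - k)%N) (N' := N)) ?leq_subr //.
apply: eq_bigr => p _; have -> : (p < N - k)%N = (p + k < N)%N by lia.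
by case: ifP => // _; rewrite addnK ltnNge leq_addl.
Qed.

Lemma energy_tail (F : nat -> nat -> C) N N' : (N <= N')%N ->
  \sum_(N <= n < N') \sum_(0 <= p < N) rnorm (F n p) ^+ 2 <=
  energy F N' - energy F N.
Proof.
move=> NN'; rewrite {1}/energy [X in _ <= X - _](big_cat_nat (n := N)) //= lerBrDl lerD //.
  apply: ler_sum => n _; rewrite [X in _ <= X](big_cat_nat (n := N)) //=.
  by rewrite lerDl sumr_ge0 // => *; rewrite sqr_ge0.
apply: ler_sum => n _; rewrite [X in _ <= X](big_cat_nat (n := N)) //=.
by rewrite lerDl sumr_ge0 // => *; rewrite sqr_ge0.
Qed.

(** If [L = A B] with [A] and [B] Hilbert-Schmidt, then [tr (T ^ k L)] is the sum
    over [n] and [r] of [w_(r - k) ... w_(r - 1)] times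
    [<B e_r, e_n> <A e_n, e_(r - k)>]. This double series converges absolutely,
    so it is the limit of its square truncations. *)
Lemma trace_moments_represented L : trace_class e L -> exists M,
  represented
    (fun k => bop_trace e (bop_comp (iter k (bop_comp T) (bop_id H)) L)) M.
Proof.
move=> tL; have [A [B [M [AM BM LE]]]] := trace_class_factor e_basis tL.
pose U n p : C := '<A (e n), e p>.
pose V n r : C := Num.conj '<B (e r), e n>.
have UM N : energy U N <= M.
  apply: le_trans (AM N); apply: ler_sum => n _; exact: bessel.
have VM N : energy V N <= M.
  rewrite /energy exchange_big_nat /=; apply: le_trans (BM N); apply: ler_sum => r _.
  apply: le_trans (bessel e_basis _ N); apply: ler_sum => n _.
  by rewrite /V rnormJ.
apply: (represented_of_matrices w01 UM VM) => k eps e0.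
pose c r : R := if (r < k)%N then 0 else wprod w (r - k) k.
have c01 r : 0 <= c r <= 1.
  by rewrite /c; case: ifP => _; [rewrite lexx ler01 | exact: wprod_bound].
pose G N N' : C := \sum_(0 <= r < N) (c r)%:C *
  \sum_(0 <= n < N') U n (r - k)%N * Num.conj (V n r).
(* The sum over square blocks is organized by the column index [r = p + k]. *)
have momentG N : truncated_moment w U V N k = G N N.
  rewrite /G; under [RHS]eq_bigr do rewrite mulr_sumr.
  rewrite exchange_big_nat /=; apply: eq_big_nat => n /andP[_ nN].
  rewrite (wcorrE _ _ _ (size_trunc U N n)).
  pose f p := (wprod w p k)%:C * (U n p * Num.conj (V n (p + k)%N)).
  transitivity (\sum_(0 <= p < N) if (p + k < N)%N then f p else 0).
    apply: eq_big_nat => p /andP[_ pN]; rewrite !coef_trunc nN pN /=.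
    by case: ifP => _ //; rewrite rmorph0 !mulr0.
  rewrite big_nat_shift; apply: eq_bigr => r _; rewrite /c /f.
  by case: ltnP => rk; [rewrite mul0r | rewrite subnK].
have limG N : (fun N' => G N N') @ \oo -->
    series (fun n => '<iter k (bop_comp T) (bop_id H) (L (e n)), e n> : C) N.
  apply: cvg_finite_sum => r; rewrite iter_bop_compE shift_coef -/(c r).
  apply: cvgMr; rewrite LE.
  rewrite (_ : (fun N' => _) = (fun N' =>
      '<A (expansion e (fun m => '<B (e r), e m>) N'), e (r - k)%N> : C)).
    by apply: inner_cvg_l; apply: bop_cvg; exact: expansion_cvg.
  apply/funext => N'; rewrite bop_sum inner_suml; apply: eq_bigr => n _.
  by rewrite bopZ innerZl /U /V conjCK mulrC.
have tailG N N' : (N <= N')%N -> rnorm (G N N' - G N N) <=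
    (energy V N' - energy V N) + (energy U N' - energy U N).
  move=> NN'; apply: le_trans (lerD (energy_tail V NN') (energy_tail U NN')).
  rewrite /G -sumrB exchange_big_nat /=.
  rewrite [X in _ + X](_ : _ = \sum_(N <= n < N') \sum_(0 <= r < N) rnorm (U n r) ^+ 2) //.
  apply: le_trans (rnorm_sum _ _ _) _.
  apply: (@le_trans _ _ (\sum_(0 <= r < N) ((\sum_(N <= n < N') rnorm (V n r) ^+ 2)
    + if (r < k)%N then 0 else \sum_(N <= n < N') rnorm (U n (r - k)%N) ^+ 2))).
    apply: ler_sum => r _; rewrite -mulrBr [X in X - _](big_cat_nat (n := N)) //=.
    rewrite addrAC subrr add0r rnormM rnorm_real ger0_norm; last by have /andP[] := c01 r.
    rewrite /c; case: ifP => rk.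
      by rewrite mul0r addr0 sumr_ge0 // => *; rewrite sqr_ge0.
    rewrite -big_split /=.
    apply: (@le_trans _ _ (rnorm (\sum_(N <= i < N') U i (r - k)%N * Num.conj (V i r)))).
      by have /andP[a b] := wprod_bound (r - k) k; rewrite ler_piMl ?rnorm_ge0.
    apply: le_trans (rnorm_sum _ _ _) _; apply: ler_sum => n _.
    rewrite rnormM rnormJ; have := rnorm_ge0 (U n (r - k)%N); have := rnorm_ge0 (V n r).
    move: (rnorm _) (rnorm _) => a b a0 b0; have := sqr_ge0 (a - b); nra.
  rewrite big_split /= lerD //.
  rewrite -(big_nat_shift (fun p => \sum_(N <= n < N') rnorm (U n p) ^+ 2)).
  rewrite [X in _ <= X]exchange_big_nat /=.
  apply: ler_sum => p _; case: ifP => // _.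
  by rewrite sumr_ge0 // => *; rewrite sqr_ge0.
have e4 : 0 < eps / 4 by rewrite divr_gt0.
have [NV hV] := bounded_monotone_cauchy (@energy_mono _ V) VM e4.
have [NU hU] := bounded_monotone_cauchy (@energy_mono _ U) UM e4.
have /cvg_rnormP/(_ _ e4)[NL hL] := 
  cvg_bop_trace e_basis (Z := iter k (bop_comp T) (bop_id H)) tL.
exists (maxn NV (maxn NU NL)) => N; rewrite !geq_max => /and3P[N1 N2 N3].
have /cvg_rnormP/(_ _ e4)[N4 hG] := limG N.
set N' := maxn N N4.
have NN' : (N <= N')%N by exact: leq_maxl.
have h1 := hG _ (leq_maxr N N4).
have h2 := tailG _ _ NN'.
have := le_trans (ler_norm _) (hV _ _ (leq_trans N1 NN') N1).
have := le_trans (ler_norm _) (hU _ _ (leq_trans N2 NN') N2).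
have := hL _ N3; rewrite momentG.
set s := series _ _ in h1 *; set t := bop_trace _ _.
have := rnorm_dist (G N N) (G N N') t; have := rnorm_dist (G N N') s t.
rewrite (rnorm_sub (G N N') (G N N)) in h2; rewrite -/N' in h1; lra.
Qed.

End ShiftMoments.

(** * Placing a correlation, and crossing a gap *)
Lemma big_nat_addr (V : nmodType) (F : nat -> V) k N :
  \sum_(k <= i < N + k) F i = \sum_(0 <= p < N) F (p + k)%N.
Proof. by rewrite -{1}[k]add0n big_addn addnK. Qed.

Section Placing.
Variable R : realType.
Local Notation C := R[i].
Variable w : nat -> R.
Hypothesis w01 : forall n, 0 <= w n <= 1.
Implicit Types u v a b : {poly C}.

Lemma wprodD p k l : wprod w p (k + l) = wprod w p k * wprod w (p + k) l.
Proof.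
by rewrite /wprod (big_cat_nat (n := (p + k)%N)) ?leq_addr ?addnA ?leq_addr.
Qed.

Lemma wprod_le p k l : (k <= l)%N -> wprod w p l <= wprod w p k.
Proof.
move=> /subnKC <-; rewrite wprodD.
have /andP[a0 _] := wprod_bound w01 p k.
by have /andP[b0 b1] := wprod_bound w01 (p + k) (l - k); rewrite ler_piMr.
Qed.

Lemma wprod_shift_le p q k : wprod w p (q + k) <= wprod w (p + q) k.
Proof.
rewrite wprodD; have /andP[a0 _] := wprod_bound w01 (p + q) k.
by have /andP[b0 b1] := wprod_bound w01 p q; rewrite ler_piMl.
Qed.

Lemma rnorm_corr_le u v k : rnorm (corr u v k) <= (pnorm2 u + pnorm2 v) / 2.
Proof.
pose N := maxn (size u) (size v).
have uN : (size u <= N)%N by exact: leq_maxl.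
have vN : (size v <= N + k)%N by rewrite (leq_trans (leq_maxr (size u) _)) ?leq_addr.
rewrite (corrE _ _ uN) (pnorm2E uN) (pnorm2E vN); apply: le_trans (rnorm_sum _ _ _) _.
apply: (@le_trans _ _ (\sum_(0 <= p < N)
  (rnorm (u`_p : C) ^+ 2 + rnorm (v`_(p + k) : C) ^+ 2) / 2)).
  apply: ler_sum => p _; rewrite rnormM rnormJ.
  move: (rnorm _) (rnorm _) => x y; have := sqr_ge0 (x - y); nra.
rewrite -mulr_suml ler_wpM2r ?invr_ge0 // big_split /= lerD //.
rewrite [X in _ <= X](big_cat_nat (n := k)) ?leq_addl //= big_nat_addr.
by rewrite lerDr sumr_ge0 // => *; rewrite sqr_ge0.
Qed.

Lemma corrN u v k : corr (- u) v k = - corr u v k.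
Proof.
rewrite (@corrE _ (size u) (- u)) ?size_polyN // /corr -sumrN.
by apply: eq_bigr => p _; rewrite coefN mulNr.
Qed.

Lemma pnorm2N u : pnorm2 (- u) = pnorm2 u.
Proof.
rewrite (@pnorm2E _ (size u) (- u)) ?size_polyN // /pnorm2.
by apply: eq_bigr => p _; rewrite coefN rnormN.
Qed.

Lemma wcorr_before a b n k : (size b <= n)%N -> (forall p, (p < n)%N -> a`_p = 0) ->
  wcorr w a b k = 0.
Proof.
move=> bn an; rewrite /wcorr big1 // => p _; case: (ltnP p n) => pn.
  by rewrite an // mul0r mulr0.
by rewrite [b`__]nth_default ?rmorph0 ?mulr0 // (leq_trans bn) // (leq_trans pn) ?leq_addr.
Qed.

(** If [a] lives before position [f] and [b] after position [n], every product of
    weights occurring in [<T ^ k a, b>] factors through the weights between [f]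
    and [n]. Half of this small factor is given to each side as a square root,
    and the remaining weights are absorbed in the coefficients. *)
Lemma wcorr_gap a b n : (size a <= n)%N -> (forall p, (p < n)%N -> b`_p = 0) ->
  exists u v, [/\ pnorm2 u <= wprod w (size a) (n - size a) * pnorm2 a,
    pnorm2 v <= wprod w (size a) (n - size a) * pnorm2 b &
    forall k, wcorr w a b k = corr u v k].
Proof.
move=> an bn; set f := size a; set g := wprod w f (n - f).
have /andP[g0 g1] : 0 <= g <= 1 by exact: wprod_bound.
pose u : {poly C} := \poly_(p < f) ((Num.sqrt g * wprod w p (f - p))%:C * a`_p).
pose v : {poly C} := \poly_(q < size b) ((Num.sqrt g * wprod w n (q - n))%:C * b`_q).
have norm_le p k (z : C) : rnorm ((Num.sqrt g * wprod w p k)%:C * z) ^+ 2 <= g * rnorm z ^+ 2.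
  rewrite rnormM rnorm_real exprMn real_normK ?num_real // exprMn sqr_sqrtr //.
  have /andP[a0 a1] := wprod_bound w01 p k.
  rewrite -mulrA ler_wpM2l // ler_piMl ?sqr_ge0 // expr2; nra.
exists u, v; split=> [||k].
- rewrite (pnorm2E (size_poly _ _)) /pnorm2 mulr_sumr; apply: ler_sum_nat => p /andP[_ pf].
  by rewrite coef_poly pf.
- rewrite (pnorm2E (size_poly _ _)) /pnorm2 mulr_sumr; apply: ler_sum_nat => p /andP[_ pf].
  by rewrite coef_poly pf.
rewrite (corrE _ _ (size_poly _ _)) /wcorr -/f; apply: eq_big_nat => p /andP[_ pf].
rewrite !coef_poly pf; case: ltnP => [pkb|bpk]; last first.
  by rewrite [b`__]nth_default // rmorph0 !mulr0.
case: (ltnP (p + k) n) => pkn; first by rewrite bn // !(mulr0, rmorph0).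
rewrite conj_realM mulrACA -rmorphM /=.
congr (_%:C * _); rewrite mulrACA -expr2 sqr_sqrtr // mulrA mulrAC.
have -> : k = ((f - p) + ((n - f) + (p + k - n)))%N.
  have fn : (f <= n)%N by []. have pf' : (p < f)%N by []. lia.
rewrite !wprodD mulrA; have -> : (p + (f - p) = f)%N by have pf' : (p < f)%N by []; lia.
have -> : (f + (n - f) = n)%N by have fn : (f <= n)%N by []; lia.
have -> : (p + (f - p + (n - f + (p + k - n))) - n = p + k - n)%N.
  have fn : (f <= n)%N by []. have pf' : (p < f)%N by []. lia.
by rewrite -/g; ring.
Qed.

Hypothesis runs : forall N M, exists2 n, (M <= n)%N & 2^-1 <= wprod w n N.
Hypothesis decay : forall M (eps : R), 0 < eps -> exists k, wprod w M k <= eps.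

(** On a run of nonzero weights [T] is diagonally similar to the unweighted shift:
    with [d_p] the product of the first [p] weights of the run, [a_p = d_p u_p]
    and [b_p = v_p / d_p] have exactly the correlations of [u] and [v]. A run of
    total product at least 1/2 costs only a factor 4 in the squared norms. *)
Lemma place u v M (eps : R) : 0 < eps -> exists n a b,
  [/\ (M <= n)%N, wprod w M (n - M) <= eps,
    (forall p, (p < n)%N -> a`_p = 0) /\ (forall p, (p < n)%N -> b`_p = 0),
    pnorm2 a <= pnorm2 u /\ pnorm2 b <= 4 * pnorm2 v &
    forall k, wcorr w a b k = corr u v k].
Proof.
move=> e0; have [m hm] := decay M e0; pose N := maxn (size u) (size v).
(* [M + m] lies beyond a gap whose product is small, and products only decrease. *)
have [n Mn hn] := runs N (M + m).
have uN : (size u <= N)%N by exact: leq_maxl.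
have vN : (size v <= N)%N by exact: leq_maxr.
have d_half p : (p <= N)%N -> 2^-1 <= wprod w n p.
  by move=> pN; apply: le_trans hn _; exact: wprod_le.
have d_neq0 p : (p <= N)%N -> wprod w n p != 0.
  by move=> /d_half h; rewrite gt_eqF // (lt_le_trans _ h) // invr_gt0.
pose a : {poly C} := \poly_(p < n + N)
  (if (p < n)%N then 0 else (wprod w n (p - n))%:C * u`_(p - n)).
pose b : {poly C} := \poly_(p < n + N)
  (if (p < n)%N then 0 else ((wprod w n (p - n))^-1)%:C * v`_(p - n)).
have sum_shift (W : nmodType) (F : nat -> W) : (forall p, (p < n)%N -> F p = 0) ->
    \sum_(0 <= p < n + N) F p = \sum_(0 <= p < N) F (p + n)%N.
  move=> F0; rewrite (big_cat_nat (n := n)) ?leq_addr //= big_nat big1.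
    by rewrite add0r addnC big_nat_addr.
  by move=> p /andP[_ /F0].
have aE p : (p < N)%N -> a`_(p + n) = (wprod w n p)%:C * u`_p.
  by move=> pN; rewrite coef_poly addnC ltn_add2l pN ltnNge leq_addr addKn.
have bE p : (p < N)%N -> b`_(p + n) = ((wprod w n p)^-1)%:C * v`_p.
  by move=> pN; rewrite coef_poly addnC ltn_add2l pN ltnNge leq_addr addKn.
have a0 p : (p < n)%N -> a`_p = 0 by rewrite coef_poly => ->; case: ifP.
have b0 p : (p < n)%N -> b`_p = 0 by rewrite coef_poly => ->; case: ifP.
exists n, a, b; split=> //.
- by apply: leq_trans (leq_addr _ _) Mn.
- by apply: le_trans hm; apply: wprod_le; lia.
- rewrite !(pnorm2E (size_poly _ _)) (pnorm2E uN) (pnorm2E vN) !sum_shift;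
    [|by move=> p /b0 ->; rewrite rnorm0 expr0n|by move=> p /a0 ->; rewrite rnorm0 expr0n].
  split; last rewrite mulr_sumr; apply: ler_sum_nat => p /andP[_ pN].
    rewrite aE // rnormM rnorm_real exprMn real_normK ?num_real //.
    rewrite ler_piMl ?sqr_ge0 //; have /andP[] := wprod_bound w01 n p; nra.
  rewrite bE // rnormM rnorm_real exprMn real_normK ?num_real //.
  rewrite ler_wpM2r ?sqr_ge0 // exprVn invf_ple ?posrE //; last first.
    by rewrite exprn_gt0 // (lt_le_trans _ (d_half _ (ltnW pN))) // invr_gt0.
  have := d_half _ (ltnW pN); nra.
move=> k; rewrite (wcorrE _ _ _ (size_poly _ _)) (corrE _ _ uN) sum_shift; last first.
  by move=> p /a0 ->; rewrite mul0r mulr0.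
apply: eq_big_nat => p /andP[_ pN]; rewrite aE // addnAC.
case: (ltnP (p + k) N) => pkN; last first.
  rewrite [v`__]nth_default ?(leq_trans vN) // [b`__]nth_default ?rmorph0 ?mulr0 //.
  by apply: leq_trans (size_poly _ _) _; lia.
rewrite bE // conj_realM.
transitivity ((wprod w (p + n) k * (wprod w n p * (wprod w n (p + k))^-1))%:C *
    (u`_p * Num.conj v`_(p + k))); first by rewrite !rmorphM; ring.
rewrite [X in X%:C](_ : _ = 1) ?mul1r // wprodD (addnC p n).
have h1 := d_neq0 _ (ltnW pN).
have h2 : wprod w (n + p) k != 0.
  by have := d_neq0 _ (ltnW pkN); rewrite wprodD mulf_eq0 negb_or => /andP[].
by rewrite mulrA (mulrC (wprod w (n + p) k)) divff ?mulf_neq0.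
Qed.

End Placing.

(** * Enumerating a doubly indexed family of representations *)
Section Enumeration.
Variable R : realType.
Local Notation C := R[i].

(** Summation along the set of indices where [b] holds. If this set is infinite
    then the sums over its initial segments run through all the partial sums. *)
Section Fibre.
Variable b : nat -> bool.
Hypothesis b_inf : forall n, exists2 c, (n <= c)%N & b c.

Definition rank n := (\sum_(0 <= c < n) b c)%N.

Lemma rankS n : rank n.+1 = (rank n + b n)%N.
Proof. by rewrite /rank big_nat_recr. Qed.

Lemma rank_le n : (rank n <= n)%N.
Proof. by elim: n => [|n IH]; [rewrite /rank big_geq | rewrite rankS; case: (b n); lia]. Qed.

Lemma rank_mono m n : (m <= n)%N -> (rank m <= rank n)%N.
Proof.
by move=> mn; rewrite /rank (big_cat_nat (n := m) (p := n)) //= leq_addr.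
Qed.

Lemma rank_onto m : exists n, rank n = m.
Proof.
have : exists n, (m <= rank n)%N.
  elim: m => [|m [n mn]]; first by exists 0%N.
  have [c nc bc] := b_inf n; exists c.+1; rewrite rankS bc.
  by have := rank_mono nc; lia.
move=> ex; case: (ex_minnP ex) => n mn nmin; exists n.
case: n mn nmin => [|n] mn nmin; first by move: mn; rewrite /rank big_geq //; lia.
have := nmin n; rewrite rankS in mn *; case: (b n) mn => /=; lia.
Qed.

Lemma sum_rank (W : nmodType) (F : nat -> W) n :
  \sum_(0 <= c < n) (if b c then F (rank c) else 0) = \sum_(0 <= m < rank n) F m.
Proof.
elim: n => [|n IH]; first by rewrite /rank !big_geq.
rewrite big_nat_recr //= IH rankS; case: (b n); last by rewrite addn0 addr0.
by rewrite addn1 big_nat_recr.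
Qed.

End Fibre.

Lemma sum_if_eq (W : nmodType) (F : nat -> W) N t0 : (t0 < N)%N ->
  \sum_(0 <= t < N) (if t == t0 then F t else 0) = F t0.
Proof.
move=> tN; rewrite big_mkord (bigD1 (Ordinal tN)) //= eqxx big1 ?addr0 //.
by move=> i; rewrite -val_eqE /= => /negbTE ->.
Qed.

(** The pair is recovered by [logn 2] and [logn 3], also after multiplication by a
    power of 5, so every pair has infinitely many representatives. *)
Definition code i j := (2 ^ i * 3 ^ j)%N.

Lemma logn_code2 i j q : logn 2 (code i j * 5 ^ q) = i.
Proof.
rewrite /code !lognM ?muln_gt0 ?expn_gt0 // pfactorK //.
by rewrite !(logn_coprime (coprimeXr _ _)) // !addn0.
Qed.

Lemma logn_code3 i j q : logn 3 (code i j * 5 ^ q) = j.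
Proof.
rewrite /code !lognM ?muln_gt0 ?expn_gt0 // pfactorK //.
by rewrite !(logn_coprime (coprimeXr _ _)) // addn0.
Qed.

Lemma logn_leq p n : (logn p n <= n)%N.
Proof.
case: n => [|n]; first by rewrite logn0.
case: (boolP (prime p)) => pp; last by rewrite lognE (negbTE pp).
apply: leq_trans (ltnW (ltn_expl _ (prime_gt1 pp))) _.
by apply: dvdn_leq => //; exact: pfactor_dvdnn.
Qed.

Lemma half_geometric_le N : \sum_(0 <= j < N) (2^-1 : R) ^+ j <= 2.
Proof.
suff -> : \sum_(0 <= j < N) (2^-1 : R) ^+ j = 2 - 2 * 2^-1 ^+ N.
  have : 0 <= (2^-1 : R) ^+ N by rewrite exprn_ge0 // invr_ge0.
  lra.
elim: N => [|N IH]; first by rewrite big_geq // expr0 mulr1 subrr.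
by rewrite big_nat_recr //= IH exprS; field.
Qed.

Lemma represented_scaled phi M (s : R) : 0 < s -> represented phi M ->
  exists l : nat -> {poly C} * {poly C},
  [/\ forall n, \sum_(0 <= c < n) pnorm2 (l c).1 <= s * M,
      forall n, \sum_(0 <= c < n) pnorm2 (l c).2 <= s^-1 * M &
      forall k (eps : R) n0, 0 < eps -> exists2 n, (n0 <= n)%N &
        rnorm (\sum_(0 <= c < n) corr (l c).1 (l c).2 k - phi k) <= eps].
Proof.
move=> s0 [l [l1 l2 lc]]; set r := Num.sqrt s.
have r0 : r != 0 by rewrite sqrtr_eq0 -ltNge.
have r2 : r ^+ 2 = s by rewrite sqr_sqrtr // ltW.
exists (fun c => (r%:C *: (l c).1, (r^-1)%:C *: (l c).2)); split=> [n|n|k eps n0 e0] /=.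
- under eq_bigr do rewrite pnorm2_scale r2.
  by rewrite -mulr_sumr ler_wpM2l // ltW.
- under eq_bigr do rewrite pnorm2_scale exprVn r2.
  by rewrite -mulr_sumr ler_wpM2l // invr_ge0 ltW.
have [n nn hn] := lc k eps n0 e0; exists n => //; apply: le_trans hn.
rewrite (eq_bigr (fun c => corr (l c).1 (l c).2 k)) // => c _.
rewrite (@corrE _ (size (l c).1)) ?size_scale_leq //; apply: eq_bigr => p _.
by rewrite !coefZ conj_realM mulrACA -rmorphM mulfV // mul1r.
Qed.

(** The pairs representing [phi i j] are interleaved into one sequence. Squared
    norms must be summable along each row for the first components and along
    each column for the second ones. Scaling [(u, v)] into [(s u, v / s)] allows
    it: the energy of [u] is made at most [2 ^ - j] if [i <= j], and that of [v]
    at most [2 ^ - i] if [j < i], which leaves in every row and in every column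
    only finitely many uncontrolled entries. *)
Lemma enumerate_pairs (phi : nat -> nat -> nat -> C) :
  (forall i j, exists M, represented (phi i j) M) ->
  exists (I J : nat -> nat) (u v : nat -> {poly C}),
  [/\ forall i, exists M, forall n,
        \sum_(0 <= c < n) (if I c == i then pnorm2 (u c) else 0) <= M,
      forall j, exists M, forall n,
        \sum_(0 <= c < n) (if J c == j then pnorm2 (v c) else 0) <= M &
      forall i j k (eps : R) n0, 0 < eps -> exists2 n, (n0 <= n)%N &
        rnorm (\sum_(0 <= c < n)
          (if (I c == i) && (J c == j) then corr (u c) (v c) k else 0)
          - phi i j k) <= eps].
Proof.
move=> hphi.
pose p c i j := (logn 2 c == i) && (logn 3 c == j).
have p_inf i j n : exists2 c, (n <= c)%N & p c i j.
  exists (code i j * 5 ^ n)%N; last by rewrite /p logn_code2 logn_code3 !eqxx.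
  apply: leq_trans (ltnW (ltn_expl n (isT : 1 < 5)%N)) _.
  by rewrite leq_pmull // /code muln_gt0 !expn_gt0.
have p_self c : p c (logn 2 c) (logn 3 c) by rewrite /p !eqxx.
have /choice[l hl] : forall ij : nat * nat, exists l : nat -> {poly C} * {poly C},
    exists Cu Cv : R,
    [/\ (ij.1 <= ij.2)%N -> Cu <= 2^-1 ^+ ij.2, (ij.2 < ij.1)%N -> Cv <= 2^-1 ^+ ij.1,
      forall n, \sum_(0 <= c < n) pnorm2 (l c).1 <= Cu,
      forall n, \sum_(0 <= c < n) pnorm2 (l c).2 <= Cv &
      forall k (eps : R) n0, 0 < eps -> exists2 n, (n0 <= n)%N &
        rnorm (\sum_(0 <= c < n) corr (l c).1 (l c).2 k - phi ij.1 ij.2 k) <= eps].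
  move=> [i j] /=; have [M repM] := hphi i j.
  have M0 : 0 <= M by case: repM => l [h _ _]; have := h 0%N; rewrite big_geq.
  have g0 k : 0 < (2^-1 : R) ^+ k by rewrite exprn_gt0 // invr_gt0.
  have M1 : 0 < M + 1 by lra.
  pose s : R := if (i <= j)%N then 2^-1 ^+ j / (M + 1) else (2^-1 ^+ i / (M + 1))^-1.
  have s0 : 0 < s by rewrite /s; case: ifP => _; rewrite ?invr_gt0 divr_gt0.
  have le_pow k : 2^-1 ^+ k / (M + 1) * M <= (2^-1 : R) ^+ k.
    by rewrite -mulrA ler_piMr ?(ltW (g0 k)) // mulrC ler_pdivrMr // mul1r; lra.
  have [l [l1 l2 lc]] := represented_scaled s0 repM.
  exists l, (s * M), (s^-1 * M); split=> // ij; rewrite /s; first by rewrite ij.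
  by rewrite leqNgt ij /= invrK.
pose rk c := rank (fun c' => p c' (logn 2 c) (logn 3 c)) c.
pose L c := l (logn 2 c, logn 3 c) (rk c).
have sumL (W : nmodType) (F : {poly C} * {poly C} -> W) i j n :
    \sum_(0 <= c < n) (if p c i j then F (L c) else 0) =
    \sum_(0 <= m < rank (fun c => p c i j) n) F (l (i, j) m).
  rewrite -(sum_rank (fun c => p c i j) (fun m => F (l (i, j) m))).
  by apply: eq_bigr => c _; rewrite /L /rk; case: ifP => // /andP[/eqP -> /eqP ->].
exists (logn 2), (logn 3), (fun c => (L c).1), (fun c => (L c).2).
split=> [i|j|i j k eps n0 e0].
- have /choice[Cu hCu] : forall j, exists Cu : R, ((i <= j)%N -> Cu <= 2^-1 ^+ j) /\
      forall n, \sum_(0 <= c < n) pnorm2 (l (i, j) c).1 <= Cu.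
    by move=> j; have [Cu [Cv [h _ h' _ _]]] := hl (i, j); exists Cu.
  exists (\sum_(0 <= j < i) Cu j + 2) => n.
  apply: (@le_trans _ _ (\sum_(0 <= j < n) Cu j)).
    apply: (@le_trans _ _ (\sum_(0 <= j < n) \sum_(0 <= c < n)
        if p c i j then pnorm2 (L c).1 else 0)).
      rewrite exchange_big_nat /=; apply: ler_sum_nat => c /andP[_ cn].
      case: ifP => ci; last by apply: sumr_ge0 => j _; case: ifP => // _; exact: pnorm2_ge0.
      rewrite (eq_bigr (fun j => if j == logn 3 c then pnorm2 (L c).1 else 0)).
        by rewrite sum_if_eq // (leq_ltn_trans (logn_leq _ _)).
      by move=> j _; rewrite /p ci eq_sym.
    apply: ler_sum => j _; rewrite (sumL _ (fun x => pnorm2 x.1)).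
    exact: (hCu j).2.
  have Cu0 j : 0 <= Cu j by have := (hCu j).2 0%N; rewrite big_geq.
  apply: (@le_trans _ _ (\sum_(0 <= j < i + n) Cu j)).
    by rewrite [X in _ <= X](big_cat_nat (n := n)) ?leq_addl //= lerDl sumr_ge0.
  rewrite (big_cat_nat (n := i)) ?leq_addr //= lerD2l.
  apply: le_trans (half_geometric_le (i + n)).
  rewrite [X in _ <= X](big_cat_nat (n := i)) ?leq_addr //= -[X in X <= _]add0r lerD //.
    by apply: sumr_ge0 => q _; rewrite exprn_ge0 // invr_ge0.
  by apply: ler_sum_nat => j /andP[ij _]; exact: (hCu j).1.
- have /choice[Cv hCv] : forall i, exists Cv : R, ((j < i)%N -> Cv <= 2^-1 ^+ i) /\
      forall n, \sum_(0 <= c < n) pnorm2 (l (i, j) c).2 <= Cv.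
    by move=> i; have [Cu [Cv [_ h _ h' _]]] := hl (i, j); exists Cv.
  exists (\sum_(0 <= i < j.+1) Cv i + 2) => n.
  apply: (@le_trans _ _ (\sum_(0 <= i < n) Cv i)).
    apply: (@le_trans _ _ (\sum_(0 <= i < n) \sum_(0 <= c < n)
        if p c i j then pnorm2 (L c).2 else 0)).
      rewrite exchange_big_nat /=; apply: ler_sum_nat => c /andP[_ cn].
      case: ifP => cj; last by apply: sumr_ge0 => i _; case: ifP => // _; exact: pnorm2_ge0.
      rewrite (eq_bigr (fun i => if i == logn 2 c then pnorm2 (L c).2 else 0)).
        by rewrite sum_if_eq // (leq_ltn_trans (logn_leq _ _)).
      by move=> i _; rewrite /p cj andbT eq_sym.
    apply: ler_sum => i _; rewrite (sumL _ (fun x => pnorm2 x.2)).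
    exact: (hCv i).2.
  have Cv0 i : 0 <= Cv i by have := (hCv i).2 0%N; rewrite big_geq.
  apply: (@le_trans _ _ (\sum_(0 <= i < j.+1 + n) Cv i)).
    by rewrite [X in _ <= X](big_cat_nat (n := n)) ?leq_addl //= lerDl sumr_ge0.
  rewrite (big_cat_nat (n := j.+1)) ?leq_addr //= lerD2l.
  apply: le_trans (half_geometric_le (j.+1 + n)).
  rewrite [X in _ <= X](big_cat_nat (n := j.+1)) ?leq_addr //= -[X in X <= _]add0r lerD //.
    by apply: sumr_ge0 => q _; rewrite exprn_ge0 // invr_ge0.
  by apply: ler_sum_nat => i /andP[ij _]; exact: (hCv i).1.
have [_ [_ [_ _ _ _ lc]]] := hl (i, j).
have [m mn hm] := lc k eps n0 e0.
have [n nm] := rank_onto (p_inf i j) m.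
exists n; first by rewrite (leq_trans mn) // -nm rank_le.
by rewrite (sumL _ (fun x => corr x.1 x.2 k)) nm.
Qed.

End Enumeration.

(** * The placing scheme *)
Lemma strong_choice (X : Type) (x0 : X) (P : nat -> (nat -> X) -> X -> Prop) :
  (forall t x x' y, (forall s, (s < t)%N -> x s = x' s) -> P t x y -> P t x' y) ->
  (forall t x, exists y, P t x y) -> exists x, forall t, P t x (x t).
Proof.
move=> Pext Pex.
have /choice[f fP] : forall tx : nat * (nat -> X), exists y, P tx.1 tx.2 y.
  by move=> [t x]; exact: Pex.
pose st := fix F t := if t is t'.+1
  then fun s => if s == t' then f (t', F t') else F t' s else fun=> x0.
have stS t s : st t.+1 s = if s == t then f (t, st t) else st t s by [].
pose x t := st t.+1 t.
have st_lt t s : (s < t)%N -> st t s = x s.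
  elim: t => // t IH; rewrite ltnS leq_eqVlt => /predU1P[-> //|st'].
  by rewrite stS ltn_eqF // IH.
exists x => t; apply: (Pext t (st t)) => [s /st_lt //|].
by rewrite /x stS eqxx; exact: (fP (t, st t)).
Qed.

Lemma big_nat_double (V : nmodType) (f : nat -> V) m :
  \sum_(0 <= t < m.*2) f t = \sum_(0 <= c < m) (f c.*2 + f c.*2.+1).
Proof.
elim: m => [|m IH]; first by rewrite !big_geq.
by rewrite doubleS !big_nat_recr //= IH addrA.
Qed.

Lemma code_logn2 i j : logn 2 (code i j) = i.
Proof. by have := logn_code2 i j 0; rewrite expn0 muln1. Qed.

Lemma code_logn3 i j : logn 3 (code i j) = j.
Proof. by have := logn_code3 i j 0; rewrite expn0 muln1. Qed.

Lemma code_gt i j : (i < code i j)%N.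
Proof.
by apply: leq_trans (ltn_expl i (isT : 1 < 2)%N) _; rewrite /code leq_pmulr ?expn_gt0.
Qed.

Lemma code_le t s : (s < t)%N -> (code t s <= 6 ^ t)%N.
Proof.
by move=> st; rewrite /code (expnMn 2 3 t) leq_mul2l leq_exp2l // (ltnW st) orbT.
Qed.

(** Step [2 c + 1] of the scheme treats the cross term of the pieces [s < t] when
    [c = code t s], which happens after both pieces have been placed. *)
Definition is_code c := (logn 3 c < logn 2 c)%N && (c == code (logn 2 c) (logn 3 c)).

Lemma is_code_code t s : (s < t)%N -> is_code (code t s).
Proof. by move=> st; rewrite /is_code code_logn2 code_logn3 st eqxx. Qed.

Lemma sum_is_code (V : nmodType) (g : nat -> nat -> V) m N : (m <= N)%N ->
  \sum_(0 <= c < m) (if is_code c then g (logn 3 c) (logn 2 c) else 0) =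
  \sum_(0 <= t < N) \sum_(0 <= s < t) (if (code t s < m)%N then g s t else 0).
Proof.
elim: m => [|m IH] mN.
  rewrite big_geq //; apply/esym; apply: big1 => t _; exact: big1.
rewrite big_nat_recr //= IH ?(ltnW mN) //.
transitivity (\sum_(0 <= t < N) \sum_(0 <= s < t) (if (code t s < m)%N then g s t else 0) +
  \sum_(0 <= t < N) \sum_(0 <= s < t) (if (code t s == m)%N then g s t else 0)); last first.
  rewrite -big_split; apply: eq_bigr => t _ /=; rewrite -big_split; apply: eq_bigr => s _ /=.
  by rewrite ltnS; case: (ltngtP (code t s) m) => /=; rewrite ?addr0 ?add0r.
congr (_ + _); case: ifP => [/andP[st /eqP mE]|nm]; last first.
  symmetry; rewrite big1 // => t _; rewrite big_nat big1 // => s /andP[_ st].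
  by case: eqP => // ms; rewrite -ms is_code_code in nm.
set t0 := logn 2 m in st mE *; set s0 := logn 3 m in st mE *.
have t0N : (t0 < N)%N by apply: leq_trans mN; rewrite ltnS mE ltnW // code_gt.
rewrite -[LHS](sum_if_eq (fun t => g s0 t) t0N); apply: eq_bigr => t _.
case: eqP => [->|tt0].
  rewrite -[LHS](sum_if_eq (fun s => g s t0) st); apply: eq_bigr => s _.
  case: eqP => [->|ss0]; first by rewrite -mE eqxx.
  by case: eqP => // ms; case: ss0; rewrite /s0 -ms code_logn3.
rewrite big1 // => s _; case: eqP => // ms; case: tt0.
by rewrite /t0 -ms code_logn2.
Qed.

(** Pieces are placed one after the other, each far to the right of the previous
    ones. Step [2 c] realizes the [c]-th given correlation. A piece interacts with
    the earlier ones through cross terms, which are correlations of tiny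
    vectors; each odd step realizes the opposite of one of them. The corrections
    create cross terms of their own, which are corrected in turn. *)
Section Scheme.
Variable R : realType.
Local Notation C := R[i].
Variable w : nat -> R.
Hypothesis w01 : forall n, 0 <= w n <= 1.
Hypothesis runs : forall N M, exists2 n, (M <= n)%N & 2^-1 <= wprod w n N.
Hypothesis decay : forall M (eps : R), 0 < eps -> exists k, wprod w M k <= eps.

(** [left_part] contributes to the vector [x_row] and [right_part] to [y_col]. *)
Record piece := Piece {row : nat; col : nat; left_part : {poly C}; right_part : {poly C}}.

Variables (I J : nat -> nat) (u v : nat -> {poly C}).

(** Bound for the energy of the cross terms ending at piece [t]. Since
    [code t s <= 6 ^ t], it also bounds the energy of the correction at step
    [2 (code t s) + 1] by [2 ^ - (code t s)], which is summable. *)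
Definition delta t : R := 2^-1 ^+ (6 ^ t).

Lemma delta_gt0 t : 0 < delta t.
Proof. by rewrite exprn_gt0 // invr_gt0. Qed.

Definition cross (x : nat -> piece) s y := wcorr w (left_part (x s)) (right_part y).

Definition small t (phi : nat -> C) := exists a b : {poly C},
  [/\ pnorm2 a <= delta t, pnorm2 b <= delta t & forall k, phi k = corr a b k].

Definition target_row x t := if odd t then
  if is_code t./2 then row (x (logn 3 t./2)) else 0%N else I t./2.
Definition target_col x t := if odd t then
  if is_code t./2 then col (x (logn 2 t./2)) else 0%N else J t./2.
Definition target x t k : C := if odd t then
  if is_code t./2 then - cross x (logn 3 t./2) (x (logn 2 t./2)) k else 0
  else corr (u t./2) (v t./2) k.
Definition left_bound t := if odd t then 2^-1 ^+ t./2 else pnorm2 (u t./2).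
Definition right_bound t :=
  4 * if odd t then 2^-1 ^+ t./2 else pnorm2 (v t./2).

Definition good_piece t x y :=
  [/\ row y = target_row x t /\ col y = target_col x t,
      forall k, wcorr w (left_part y) (right_part y) k = target x t k,
      pnorm2 (left_part y) <= left_bound t /\ pnorm2 (right_part y) <= right_bound t,
      exists n, [/\ forall p, (p < n)%N -> (left_part y)`_p = 0,
        forall p, (p < n)%N -> (right_part y)`_p = 0 &
        forall s, (s < t)%N -> (size (left_part (x s)) <= n)%N /\
          (size (right_part (x s)) <= n)%N] &
      forall s, (s < t)%N -> small t (cross x s y)].

Lemma is_code_lt t : odd t -> is_code t./2 ->
  (logn 3 t./2 < logn 2 t./2)%N /\ (logn 2 t./2 < t)%N.
Proof.
move=> ot /andP[h1 /eqP h2]; split=> //.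
have : (logn 2 t./2 < t./2)%N by rewrite [X in (_ < X)%N]h2 code_gt.
by move=> h; apply: leq_trans h _; lia.
Qed.

(** Whatever step [t] has to realize is a correlation: for a cross term this is
    the smallness of the previous cross terms. *)
Lemma target_pair t x :
  (forall s t', (s < t')%N -> (t' < t)%N -> small t' (cross x s (x t'))) ->
  exists a b : {poly C}, [/\ pnorm2 a <= left_bound t, 4 * pnorm2 b <= right_bound t &
    forall k, target x t k = corr a b k].
Proof.
move=> hx; rewrite /target /left_bound /right_bound.
case: ifP => ot; last by exists (u t./2), (v t./2).
case: (boolP (is_code t./2)) => vt; last first.
  exists 0, 0; rewrite pnorm2_0 mulr0; split=> [||k]; last by rewrite corr0.
    by rewrite exprn_ge0 // invr_ge0.
  by rewrite mulr_ge0 // exprn_ge0 // invr_ge0.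
have [st tt] := is_code_lt ot vt.
have [a [b [ha hb hab]]] := hx _ _ st tt.
have dle : delta (logn 2 t./2) <= 2^-1 ^+ t./2.
  rewrite ler_wiXn2l ?invr_ge0 ?invf_le1 ?ler1n //.
  by have /andP[_ /eqP {1}->] := vt; exact: code_le.
exists (- a), b; rewrite pnorm2N; split=> [||k]; last by rewrite corrN hab.
  exact: le_trans ha dle.
by rewrite ler_wpM2l // (le_trans hb).
Qed.

Lemma good_piece_exists t x :
  (forall s t', (s < t')%N -> (t' < t)%N -> small t' (cross x s (x t'))) ->
  exists y, good_piece t x y.
Proof.
move=> hx; have [a [b [ha hb hab]]] := target_pair hx.
pose F := (\sum_(0 <= s < t) (size (left_part (x s)) + size (right_part (x s))))%N.
have Fle s : (s < t)%N -> (size (left_part (x s)) <= F)%N /\ (size (right_part (x s)) <= F)%N.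
  move=> st; rewrite /F big_mkord (bigD1 (Ordinal st)) //=; split; lia.
pose K := \sum_(0 <= s < t) pnorm2 (left_part (x s)) + 4 * pnorm2 b + 1.
have S0 : 0 <= \sum_(0 <= s < t) pnorm2 (left_part (x s)).
  by apply: sumr_ge0 => s _; exact: pnorm2_ge0.
have K0 : 0 < K by rewrite /K; have := pnorm2_ge0 b; lra.
have [n [a' [b' [Fn gap [a0 b0] [na nb] ab]]]] :=
  place w01 runs decay a b F (divr_gt0 (delta_gt0 t) K0).
exists (Piece (target_row x t) (target_col x t) a' b').
split=> //= [k|||s st].
- by rewrite ab hab.
- by split; [exact: le_trans na ha | exact: le_trans nb hb].
- exists n; split=> // s /Fle[h1 h2].
  by split; [exact: leq_trans h1 Fn | exact: leq_trans h2 Fn].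
have [sF _] := Fle _ st.
have [c [d [hc hd cd]]] := wcorr_gap w01 (leq_trans sF Fn) b0.
have gap' : wprod w (size (left_part (x s))) (n - size (left_part (x s))) <= delta t / K.
  apply: le_trans gap; set f := size _ in sF *.
  have -> : (n - f = (F - f) + (n - F))%N by lia.
  by apply: le_trans (wprod_shift_le w01 _ _ _) _; rewrite subnKC.
have le_delta z : 0 <= z -> z <= K -> delta t / K * z <= delta t.
  by move=> z0 zK; rewrite -mulrA ler_piMr ?(ltW (delta_gt0 t)) // mulrC ler_pdivrMr // mul1r.
exists c, d; split=> //.
  apply: le_trans hc _; apply: le_trans (ler_wpM2r (pnorm2_ge0 _) gap') _.
  apply: le_delta (pnorm2_ge0 _) _; rewrite /K.
  apply: (@le_trans _ _ (\sum_(0 <= s < t) pnorm2 (left_part (x s)))).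
    rewrite big_mkord (bigD1 (Ordinal st)) //= lerDl.
    by apply: sumr_ge0 => *; exact: pnorm2_ge0.
  by have := pnorm2_ge0 b; lra.
apply: le_trans hd _; apply: le_trans (ler_wpM2r (pnorm2_ge0 _) gap') _.
by apply: le_delta (pnorm2_ge0 _) _; rewrite /K; lra.
Qed.

Lemma scheme : exists x, forall t, good_piece t x (x t).
Proof.
pose P t x y := (forall s t', (s < t')%N -> (t' < t)%N -> small t' (cross x s (x t'))) ->
  good_piece t x y.
have [t x x' y xx'|t x|x xP] := @strong_choice piece (Piece 0 0 0 0) P.
- move=> Pxy hx'; have hx s t' : (s < t')%N -> (t' < t)%N -> small t' (cross x s (x t')).
    by move=> st tt; rewrite /cross !xx' ?(ltn_trans st tt) //; exact: hx'.
  have [h1 h2 h3 [n [h4 h5 h6]] h7] := Pxy hx.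
  have eqs : odd t -> is_code t./2 ->
      x (logn 3 t./2) = x' (logn 3 t./2) /\ x (logn 2 t./2) = x' (logn 2 t./2).
    by move=> ot vt; have [a b] := is_code_lt ot vt; rewrite !xx' // (ltn_trans a b).
  have rowE : target_row x' t = target_row x t.
    rewrite /target_row; case: ifP => // ot; case: ifP => // vt.
    by have [-> _] := eqs ot vt.
  have colE : target_col x' t = target_col x t.
    rewrite /target_col; case: ifP => // ot; case: ifP => // vt.
    by have [_ ->] := eqs ot vt.
  split=> //; first by rewrite rowE colE.
  - move=> k; rewrite h2 /target; case: ifP => // ot; case: ifP => // vt.
    by have [e1 e2] := eqs ot vt; rewrite /cross e1 e2.
  - by exists n; split=> // s st; rewrite -xx' //; exact: h6.
  - by move=> s st; have := h7 s st; rewrite /cross xx'.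
- have [hx|nhx] := pselect
      (forall s t', (s < t')%N -> (t' < t)%N -> small t' (cross x s (x t'))).
    by have [y hy] := good_piece_exists hx; exists y => _.
  by exists (Piece 0 0 0 0).
have hx t : forall s t', (s < t')%N -> (t' < t)%N -> small t' (cross x s (x t')).
  elim: t => // t IH s t' st; rewrite ltnS leq_eqVlt => /predU1P[tt|]; last exact: IH.
  by have [_ _ _ _ h] := xP t IH; rewrite tt in st *; exact: h.
by exists x => t; apply: xP; exact: hx.
Qed.

End Scheme.

(** * Solution of the moment problem *)
Lemma half_pow_small (R : realType) (eps : R) : 0 < eps -> exists K, 2^-1 ^+ K <= eps.
Proof.
move=> e0; have [K hK] : exists K : nat, eps^-1 <= K%:R.
  exists (Num.bound eps^-1); apply/ltW; apply: le_lt_trans (archi_boundP _) => //.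
  by rewrite invr_ge0 ltW.
exists K; rewrite exprVn invf_ple ?posrE ?exprn_gt0 //.
by apply: le_trans hK _; rewrite -natrX ler_nat ltnW // ltn_expl.
Qed.

Lemma delta_summable (R : realType) t : t%:R * delta R t <= 2^-1 ^+ t.
Proof.
have h : (t + t <= 6 ^ t)%N.
  elim: t => // t IH; rewrite expnS; have : (0 < 6 ^ t)%N by rewrite expn_gt0.
  by move: IH; move: (6 ^ t)%N => n; lia.
have q0 : 0 <= 2^-1 :> R by rewrite invr_ge0.
have q1 : 2^-1 <= 1 :> R by rewrite invf_le1 ?ler1n.
apply: (@le_trans _ _ (2 ^+ t * 2^-1 ^+ (t + t))).
  rewrite ler_pM ?ler0n ?exprn_ge0 //; first by rewrite -natrX ler_nat ltnW // ltn_expl.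
  exact: ler_wiXn2l.
by rewrite exprD mulrA -exprMn mulfV ?pnatr_eq0 // expr1n mul1r.
Qed.

Section Solve.
Variables (R : realType) (H : hilbertType R) (e : nat -> H).
Hypothesis e_basis : orthonormal_basis e.
Local Notation C := R[i].
Variable w : nat -> R.
Hypothesis w01 : forall n, 0 <= w n <= 1.
Variable T : bop H.
Hypothesis Te : forall n, T (e n) = (w n)%:C *: e n.+1.

Definition vec (a : {poly C}) : H := expansion e (fun p => a`_p) (size a).

Lemma inner_vec r (a : {poly C}) : '<e r, vec a> = Num.conj a`_r.
Proof.
rewrite innerC inner_expansion //; case: ltnP => // ar.
by rewrite nth_default.
Qed.

Lemma rnorm_sqr_vec a : rnorm (vec a) ^+ 2 = pnorm2 a.
Proof. exact: rnorm_sqr_expansion. Qed.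

Lemma inner_shift_vec k a b : '<iter k T (vec a), vec b> = wcorr w a b k.
Proof.
rewrite -iter_bop_compE /vec bop_sum inner_suml; apply: eq_bigr => p _.
rewrite bopZ iter_bop_compE (shift_iter_basis Te) !innerZl inner_vec; ring.
Qed.

Hypothesis runs : forall N M, exists2 n, (M <= n)%N & 2^-1 <= wprod w n N.
Hypothesis decay : forall M (eps : R), 0 < eps -> exists k, wprod w M k <= eps.

Section Sums.
Variables (I J : nat -> nat) (u v : nat -> {poly C}) (x : nat -> piece R).
Hypothesis xP : forall t, good_piece w I J u v t x (x t).

Lemma cross_after s t k : (t < s)%N -> cross w x s (x t) k = 0.
Proof.
move=> ts; have [_ _ _ [n [n1 _ n3]] _] := xP s.
by have [_ h] := n3 _ ts; exact: wcorr_before h n1.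
Qed.

Lemma left_ortho s t : s != t -> '<vec (left_part (x s)), vec (left_part (x t))> = 0 :> C.
Proof.
wlog st : s t / (t < s)%N.
  move=> h; rewrite neq_ltn => /orP[st|ts]; last by apply: h => //; rewrite gtn_eqF.
  by rewrite innerC h ?conjC0 // gtn_eqF.
move=> _; have [_ _ _ [n [n1 _ n3]] _] := xP s.
have [h _] := n3 _ st.
by rewrite -[vec (left_part (x s))]/(iter 0 T _) inner_shift_vec (wcorr_before w 0 h n1).
Qed.

Lemma right_ortho s t : s != t -> '<vec (right_part (x s)), vec (right_part (x t))> = 0 :> C.
Proof.
wlog st : s t / (t < s)%N.
  move=> h; rewrite neq_ltn => /orP[st|ts]; last by apply: h => //; rewrite gtn_eqF.
  by rewrite innerC h ?conjC0 // gtn_eqF.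
move=> _; have [_ _ _ [n [_ n1 n3]] _] := xP s.
have [_ h] := n3 _ st.
by rewrite -[vec (right_part (x s))]/(iter 0 T _) inner_shift_vec (wcorr_before w 0 h n1).
Qed.

Definition row_term i t : H := if row (x t) == i then vec (left_part (x t)) else 0.
Definition col_term j t : H := if col (x t) == j then vec (right_part (x t)) else 0.

Lemma sum_double_le (f g : nat -> R) (M K : R) :
  (forall t, 0 <= f t) -> (forall c, f c.*2 <= g c) ->
  (forall c, f c.*2.+1 <= K * 2^-1 ^+ c) -> 0 <= K ->
  (forall n, \sum_(0 <= c < n) g c <= M) ->
  forall n, \sum_(0 <= t < n) f t <= M + K * 2.
Proof.
move=> f0 fg fK K0 gM n.
apply: (@le_trans _ _ (\sum_(0 <= t < n.*2) f t)).
  rewrite [X in _ <= X](big_cat_nat (n := n)) //=; last by rewrite -addnn leq_addr.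
  by rewrite lerDl sumr_ge0.
rewrite big_nat_double big_split /= lerD //.
  by apply: le_trans (gM n); apply: ler_sum.
apply: (@le_trans _ _ (\sum_(0 <= c < n) K * 2^-1 ^+ c)); first exact: ler_sum.
by rewrite -mulr_sumr ler_wpM2l // half_geometric_le.
Qed.

Lemma row_cvg i : (exists M, forall n,
    \sum_(0 <= c < n) (if I c == i then pnorm2 (u c) else 0) <= M) ->
  cvgn (series (row_term i)).
Proof.
move=> [M hM]; apply: (@cvg_series_ortho _ _ _ _ (M + 1 * 2)).
  move=> s t st; rewrite /row_term; case: ifP => _; last by rewrite inner0l.
  by case: ifP => _; rewrite ?inner0r ?left_ortho.
apply: sum_double_le hM => // [t|c|c]; first exact: sqr_ge0.
  have [[h1 _] _ [h2 _] _ _] := xP c.*2.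
  rewrite /row_term h1 /target_row /left_bound odd_double doubleK in h2 *.
  by case: ifP => _; rewrite ?rnorm_sqr_vec ?rnorm0 ?expr0n.
have [_ _ [h2 _] _ _] := xP c.*2.+1.
rewrite /left_bound /= odd_double /= uphalf_double in h2.
rewrite mul1r /row_term; case: ifP => _; rewrite ?rnorm_sqr_vec // rnorm0 expr0n /=.
by rewrite exprn_ge0 // invr_ge0.
Qed.

Lemma col_cvg j : (exists M, forall n,
    \sum_(0 <= c < n) (if J c == j then pnorm2 (v c) else 0) <= M) ->
  cvgn (series (col_term j)).
Proof.
move=> [M hM]; apply: (@cvg_series_ortho _ _ _ _ (4 * M + 4 * 2)).
  move=> s t st; rewrite /col_term; case: ifP => _; last by rewrite inner0l.
  by case: ifP => _; rewrite ?inner0r ?right_ortho.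
apply: (@sum_double_le _ (fun c => 4 * if J c == j then pnorm2 (v c) else 0)) => // [t|c|c|n].
- exact: sqr_ge0.
- have [[_ h1] _ [_ h2] _ _] := xP c.*2.
  rewrite /col_term h1 /target_col /right_bound odd_double doubleK in h2 *.
  by case: ifP => _; rewrite ?rnorm_sqr_vec ?rnorm0 ?expr0n //= mulr0.
- have [_ _ [_ h2] _ _] := xP c.*2.+1.
  rewrite /right_bound /= odd_double /= uphalf_double in h2.
  rewrite /col_term; case: ifP => _; rewrite ?rnorm_sqr_vec // rnorm0 expr0n /=.
  by rewrite mulr_ge0 // exprn_ge0 // invr_ge0.
- by rewrite -mulr_sumr ler_wpM2l.
Qed.

Definition entry i j k s t : C :=
  if (row (x s) == i) && (col (x t) == j) then cross w x s (x t) k else 0.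

Lemma rnorm_entry i j k s t : (s < t)%N -> rnorm (entry i j k s t) <= delta R t.
Proof.
move=> st; rewrite /entry; case: ifP => _; last first.
  by rewrite rnorm0 ltW // delta_gt0.
have [_ _ _ _ /(_ _ st)[a [b [ha hb ->]]]] := xP t.
apply: le_trans (rnorm_corr_le a b k) _; lra.
Qed.

Lemma partial_inner i j k n :
  '<iter k T (series (row_term i) n), series (col_term j) n> =
  \sum_(0 <= t < n) (entry i j k t t + \sum_(0 <= s < t) entry i j k s t).
Proof.
rewrite -iter_bop_compE bop_sum inner_suml.
transitivity (\sum_(0 <= s < n) \sum_(0 <= t < n) entry i j k s t).
  apply: eq_bigr => s _; rewrite inner_sumr; apply: eq_bigr => t _.
  rewrite iter_bop_compE /entry /row_term /col_term.
  case: (row (x s) == i) => /=; last by rewrite -iter_bop_compE bop0 inner0l.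
  by case: (col (x t) == j); rewrite ?inner0r // inner_shift_vec.
rewrite exchange_big_nat /=; apply: eq_big_nat => t /andP[_ tn].
rewrite (big_cat_nat (n := t.+1)) //= [X in _ + X]big_nat [X in _ + X]big1 ?addr0.
  by rewrite big_nat_recr //= addrC.
by move=> s /andP[ts _]; rewrite /entry cross_after // if_same.
Qed.

(** After an even number of steps, what remains besides the given correlations is
    the sum of the cross terms that are not yet corrected. *)
Lemma partial_inner_double i j k m :
  '<iter k T (series (row_term i) m.*2), series (col_term j) m.*2> =
  \sum_(0 <= c < m)
    (if (I c == i) && (J c == j) then corr (u c) (v c) k else 0) +
  \sum_(0 <= t < m.*2) \sum_(0 <= s < t)
    (if (code t s < m)%N then 0 else entry i j k s t).
Proof.
rewrite partial_inner big_split /= big_nat_double big_split /= -addrA; congr (_ + _).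
  apply: eq_bigr => c _; rewrite /entry /cross.
  have [[h1 h2] h3 _ _ _] := xP c.*2.
  by rewrite h1 h2 h3 /target_row /target_col /target odd_double doubleK.
transitivity (- \sum_(0 <= c < m) (if is_code c then entry i j k (logn 3 c) (logn 2 c) else 0)
  + \sum_(0 <= t < m.*2) \sum_(0 <= s < t) entry i j k s t).
  congr (_ + _); rewrite -sumrN; apply: eq_bigr => c _; rewrite /entry [in LHS]/cross.
  have [[h1 h2] h3 _ _ _] := xP c.*2.+1.
  rewrite h1 h2 h3 /target_row /target_col /target /= odd_double /= uphalf_double.
  case: (is_code c); last by rewrite if_same oppr0.
  by case: ifP => _; rewrite ?oppr0.
rewrite (@sum_is_code _ _ _ m.*2) -?addnn ?leq_addr // -sumrN -big_split.
apply: eq_bigr => t _ /=; rewrite -sumrN -big_split; apply: eq_bigr => s _ /=.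
by case: ifP => _; rewrite ?addNr // oppr0 add0r.
Qed.

(** The cross terms ending at piece [t] have all been corrected at step [2 m] once
    [6 ^ t < m], so only the large values of [t] remain. *)
Lemma tail_small i j k K m : (6 ^ K < m)%N ->
  rnorm (\sum_(0 <= t < m.*2) \sum_(0 <= s < t)
    (if (code t s < m)%N then 0 else entry i j k s t)) <= 2^-1 ^+ K * 2.
Proof.
move=> Km; apply: le_trans (rnorm_sum _ _ _) _.
have q0 n : 0 <= (2^-1 : R) ^+ n by rewrite exprn_ge0 // invr_ge0.
apply: (@le_trans _ _ (\sum_(0 <= t < m.*2) (if (t < K)%N then 0 else 2^-1 ^+ t))).
  apply: ler_sum => t _; case: ltnP => tK.
    rewrite big_nat big1 ?rnorm0 // => s /andP[_ st].
    rewrite ifT // (leq_ltn_trans (code_le st)) // (leq_ltn_trans _ Km) //.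
    by rewrite leq_exp2l // ltnW.
  apply: le_trans (rnorm_sum _ _ _) _; apply: le_trans (delta_summable R t).
  rewrite mulr_natl -[X in _ *+ X]subn0 -sumr_const_nat.
  apply: ler_sum_nat => s /andP[_ st].
  by case: ifP => _; rewrite ?rnorm0 ?(ltW (delta_gt0 _ _)) // rnorm_entry.
have powE t : (if (t < K)%N then 0 else 2^-1 ^+ t) =
    (if (t < K)%N then 0 else 2^-1 ^+ K * 2^-1 ^+ (t - K) : R).
  by case: ltnP => // Kt; rewrite -exprD subnKC.
rewrite (eq_bigr _ (fun t _ => powE t)).
rewrite -(big_nat_shift (fun p => 2^-1 ^+ K * 2^-1 ^+ p)).
apply: (@le_trans _ _ (\sum_(0 <= p < m.*2) 2^-1 ^+ K * 2^-1 ^+ p)).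
  by apply: ler_sum => p _; case: ifP => // _; rewrite mulr_ge0.
by rewrite -mulr_sumr ler_wpM2l // half_geometric_le.
Qed.

End Sums.

Lemma solve_moments (phi : nat -> nat -> nat -> C) :
  (forall i j, exists M, represented (phi i j) M) ->
  exists x y : nat -> H, forall i j k, '<iter k T (x i), y j> = phi i j k.
Proof.
move=> /enumerate_pairs[I [J [u [v [uM vM uv]]]]].
have [p pP] := scheme w01 runs decay I J u v.
exists (fun i => limn (series (row_term p i))), (fun j => limn (series (col_term p j))).
move=> i j k; set D := '<_, _>.
have SD : (fun n => '<iter k T (series (row_term p i) n), series (col_term p j) n> : C)
    @ \oo --> (D : C).
  rewrite /D -iter_bop_compE; under eq_fun do rewrite -iter_bop_compE.
  apply: cvg_inner; last exact: (col_cvg pP (vM j)).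
  apply: bop_cvg; exact: (row_cvg pP (uM i)).
apply/eqP; rewrite -subr_eq0 -rnorm_eq0 eq_le rnorm_ge0 andbT.
apply/ler_addgt0Pr => eps e0; rewrite add0r.
have e4 : 0 < eps / 4 by rewrite divr_gt0.
have /cvg_rnormP/(_ _ e4)[N hN] := SD.
have [K hK] := half_pow_small e4.
have [m mN hm] := uv i j k _ (maxn N (6 ^ K).+1) e4.
move: mN; rewrite geq_max => /andP[mN mK].
have mm : (m <= m.*2)%N by rewrite -addnn leq_addr.
have h1 := hN m.*2 (leq_trans mN mm).
have h2 := tail_small pP i j k mK.
rewrite (partial_inner_double pP) in h1; set O := \sum_(0 <= c < m) _ in h1 hm.
set E := \sum_(0 <= t < m.*2) _ in h1 h2.
have := rnorm_dist D (O + E) (phi i j k); rewrite (rnorm_sub D (O + E)).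
have := rnormD (O - phi i j k) E; rewrite (addrAC O _ E); lra.
Qed.

(** The deterministic form of the theorem. *)
Lemma weighted_shift_A_aleph0 : A_aleph0 e T.
Proof.
move=> L tL.
have [i j|x [y xy]] := @solve_moments
    (fun i j k => bop_trace e (bop_comp (iter k (bop_comp T) (bop_id H)) (L i j))).
  exact: trace_moments_represented.
exists x, y => i j; apply: predual_class_eq => //; first exact: trace_class_rank_one.
by move=> k; rewrite bop_trace_rank_one // iter_bop_compE xy.
Qed.

End Solve.

(** * Almost sure recurrence of runs *)
Lemma prod_EFin (R : realType) I (s : seq I) (f : I -> R) :
  (\prod_(i <- s) (f i)%:E)%E = (\prod_(i <- s) f i)%:E.
Proof. by elim: s => [|i s IH]; rewrite ?big_nil // !big_cons IH EFinM. Qed.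

Section Probability.
Context d (Omega : measurableType d) (R : realType) (P : probability Omega R).
Variable X : nat -> {RV P >-> R}.
Hypothesis X_indep : mutually_independent X.
Hypothesis X_ident : identically_distributed X.

Definition real_prob (A : set Omega) : R := fine (P A).

Lemma real_probE A : measurable A -> P A = (real_prob A)%:E.
Proof. by move=> mA; rewrite /real_prob fineK // fin_num_measure. Qed.

Definition cylinder (s : seq nat) (D : nat -> set R) : set Omega :=
  \bigcap_(n in [set` s]) (X n @^-1` D n).

Lemma measurable_coordinate n (B : set R) : measurable B -> measurable (X n @^-1` B).
Proof. by move=> mB; exact: measurable_funPTI. Qed.

Lemma measurable_cylinder s D : (forall n, measurable (D n)) ->
  measurable (cylinder s D).
Proof.
by move=> mD; apply: bigcap_measurableType => n _; exact: measurable_coordinate.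
Qed.

Lemma real_prob_ident n (B : set R) : measurable B ->
  real_prob (X n @^-1` B) = real_prob (X 0%N @^-1` B).
Proof.
move=> mB; rewrite /real_prob.
by have := X_ident n 0 mB; rewrite /distribution /pushforward => ->.
Qed.

Lemma real_prob_cylinder s D : uniq s -> (forall n, measurable (D n)) ->
  real_prob (cylinder s D) = \prod_(n <- s) real_prob (X n @^-1` D n).
Proof.
move=> us mD; rewrite {1}/real_prob /cylinder X_indep //.
by rewrite (eq_bigr _ (fun n _ => real_probE (measurable_coordinate n (mD n)))) prod_EFin.
Qed.

Lemma cylinder_cat s s' D :
  cylinder (s ++ s') D = cylinder s D `&` cylinder s' D.
Proof.
apply/seteqP; split=> w.
  by move=> h; split=> n /= ns; apply: h; rewrite /= mem_cat ns ?orbT.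
by move=> [h h'] n /=; rewrite mem_cat => /orP[/h|/h'].
Qed.

Lemma eq_cylinder s D D' : {in s, forall n, D n = D' n} -> cylinder s D = cylinder s D'.
Proof.
by move=> DD'; apply/seteqP; split=> w h n ns; have := h n ns; rewrite /= DD'.
Qed.

Section Block.
Variables (M N : nat) (B : set R).
Hypothesis mB : measurable B.

Definition block k := cylinder (iota (M + k * N) N) (fun=> B).

(** The event that none of the first [K] consecutive blocks of length [N] after
    position [M] is a run in [B]. *)
Fixpoint miss K : set Omega := if K is k.+1 then miss k `\` block k else setT.

Lemma measurable_block k : measurable (block k).
Proof. exact: measurable_cylinder. Qed.

Lemma measurable_miss K : measurable (miss K).
Proof. by elim: K => //= K IH; apply: measurableD => //; exact: measurable_block. Qed.

(** Independence is only assumed for cylinders, and [miss K] is not one. The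
    additional cylinder on later coordinates makes the induction work: removing a
    block from [miss K] subtracts the probability of [miss K] intersected with a
    larger cylinder on later coordinates. *)
Lemma real_prob_miss K s D : uniq s -> (forall n, n \in s -> (M + K * N <= n)%N) ->
  (forall n, measurable (D n)) ->
  real_prob (miss K `&` cylinder s D) =
  (1 - real_prob (X 0%N @^-1` B) ^+ N) ^+ K * real_prob (cylinder s D).
Proof.
elim: K s D => [|K IH] s D us Ms mD /=; first by rewrite setTI expr0 mul1r.
pose s' := iota (M + K * N) N ++ s.
pose D' n := if (n < M + K.+1 * N)%N then B else D n.
have mD' n : measurable (D' n) by rewrite /D'; case: ifP.
have us' : uniq s'.
  rewrite cat_uniq iota_uniq us andbT; apply/hasPn => n /Ms.
  by rewrite mem_iota mulSn; lia.
have Ms' n : n \in s' -> (M + K * N <= n)%N.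
  by rewrite mem_cat mem_iota => /orP[/andP[] //|/Ms]; rewrite mulSn; lia.
have cyls' : cylinder s' D' = block K `&` cylinder s D.
  rewrite cylinder_cat; congr (_ `&` _); apply: eq_cylinder => n.
    by rewrite mem_iota /D' => /andP[_ h]; rewrite ifT //; rewrite mulSn; lia.
  by move=> /Ms; rewrite /D' leqNgt => /negbTE ->.
have Pcyls' : real_prob (cylinder s' D') =
    real_prob (X 0%N @^-1` B) ^+ N * real_prob (cylinder s D).
  rewrite !real_prob_cylinder // big_cat /=; congr (_ * _).
    rewrite (eq_big_seq (fun=> real_prob (X 0%N @^-1` B))).
      by rewrite big_const_seq count_predT size_iota iter_mulr_1.
    move=> n; rewrite mem_iota /D' => /andP[_ h].
    by rewrite ifT ?real_prob_ident //; rewrite mulSn; lia.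
  apply: eq_big_seq => n /Ms; rewrite /D' leqNgt => /negbTE -> //.
have mMC : measurable (miss K `&` cylinder s D).
  by apply: measurableI; [exact: measurable_miss | exact: measurable_cylinder].
have -> : (miss K `\` block K) `&` cylinder s D =
    (miss K `&` cylinder s D) `\` block K.
  by rewrite !setDE setIAC.
have PD : P ((miss K `&` cylinder s D) `\` block K) =
    (P (miss K `&` cylinder s D) - P (miss K `&` cylinder s D `&` block K))%E.
  apply: measureD => //; first exact: measurable_block.
  by rewrite -ge0_fin_numE // fin_num_measure.
rewrite {1}/real_prob PD.
have -> : miss K `&` cylinder s D `&` block K = miss K `&` cylinder s' D'.
  by rewrite cyls' -setIA (setIC (block K)).
have mMC' : measurable (miss K `&` cylinder s' D').
  by apply: measurableI; [exact: measurable_miss | exact: measurable_cylinder].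
rewrite (real_probE mMC) (real_probE mMC').
have Ms0 n : n \in s -> (M + K * N <= n)%N by move=> /Ms; rewrite mulSn; lia.
by rewrite -EFinB !IH //= Pcyls' exprS; ring.
Qed.

End Block.

Lemma ae_recurrent_run (B : set R) N : measurable B ->
  0 < real_prob (X 0%N @^-1` B) ->
  {ae P, forall w, forall M, exists2 n, (M <= n)%N &
    forall s, (s < N)%N -> B (X (n + s)%N w)}.
Proof.
move=> mB p0; apply/ae_foralln => M.
set p := real_prob _ in p0.
have p1 : p <= 1.
  rewrite /p -lee_fin -(real_probE (measurable_coordinate 0 mB)).
  by apply: probability_le1; exact: measurable_coordinate.
have q01 : 0 <= 1 - p ^+ N < 1.
  have := exprn_gt0 N p0; have : p ^+ N <= 1 by rewrite exprn_ile1 // ltW.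
  by move=> h1 h2; apply/andP; split; lra.
pose bad := \bigcap_K miss M N B K.
have mbad : measurable bad by apply: bigcapT_measurable => K; exact: measurable_miss.
have bad_le K : real_prob bad <= (1 - p ^+ N) ^+ K.
  have := @real_prob_miss M N B mB K [::] (fun=> setT) isT.
  move=> /(_ (fun n (h : n \in [::]) => False_ind _ (notF h)) (fun=> measurableT)).
  have cyl0 : cylinder [::] (fun=> setT) = setT.
    by apply/seteqP; split=> // w _ n; rewrite /= in_nil.
  rewrite cyl0 setIT /real_prob probability_setT /= mulr1 => <-.
  rewrite -lee_fin !fineK ?fin_num_measure //; try exact: measurable_miss.
  by apply: le_measure; rewrite ?inE //; [exact: measurable_miss | exact: bigcap_inf].
have bad0 : P bad = 0%E.
  rewrite real_probE //; congr (_%:E); apply/eqP; rewrite eq_le; apply/andP; split.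
    have /andP[q0 q1] := q01.
    have cv : (fun K => (1 - p ^+ N) ^+ K) @ \oo --> (0 : R).
      by apply: cvg_expr; rewrite ger0_norm.
    apply/ler_addgt0Pr => eps e0; rewrite add0r.
    move/cvgrPdist_le: cv => /(_ _ e0)[K _ /(_ K (leqnn K))].
    rewrite sub0r normrN => /(le_trans (ler_norm _)).
    by apply: le_trans; exact: bad_le.
  by rewrite -lee_fin -real_probE.
exists bad; split=> // w /= nw K _.
elim: K => //= K IH; split=> // hw; apply: nw; exists (M + K * N)%N; first exact: leq_addr.
by move=> s sN; apply: hw; rewrite /= mem_iota; lia.
Qed.

Lemma essran_gt0 (U : set R) x : essran (X 0%N) x -> open U -> U x ->
  0 < real_prob (X 0%N @^-1` U).
Proof.
move=> ex oU Ux; have := ex U oU Ux; rewrite /distribution /pushforward.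
by rewrite (real_probE (measurable_coordinate 0 (open_measurable oU))) lte_fin.
Qed.

(** The complement of the support is covered by countably many null intervals
    with rational end points. *)
Lemma ae_le_max_essran (m : R) : ubound (essran (X 0%N)) m ->
  {ae P, forall w, forall n, X n w <= m}.
Proof.
move=> ub; apply/ae_foralln => n.
pose cover (q : nat) : set R := if unpickle q is Some (a, b) then
  if P (X 0%N @^-1` `]ratr a, ratr b[) == 0%E then `]ratr a, ratr b[%classic
  else set0 else set0.
have nullI q : P.-negligible (X n @^-1` cover q).
  rewrite /cover; case: unpickle => [[a b]|]; last first.
    by rewrite preimage_set0; exact: negligible_set0.
  case: eqP => h0; last by rewrite preimage_set0; exact: negligible_set0.
  apply/negligibleP; first by apply: measurable_coordinate; exact: measurable_itv.
  have := X_ident n 0 (measurable_itv `](ratr a : R), ratr b[).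
  by rewrite /distribution /pushforward h0.
apply: negligibleS (negligible_bigcup nullI) => w /= /negP.
rewrite -ltNge => mX; set y := X n w in mX.
have ny : ~ essran (X 0%N) y by move=> /ub; rewrite leNgt mX.
have [U oU [Uy PU]] : exists2 U : set R, open U & U y /\ P (X 0%N @^-1` U) = 0%E.
  apply: contrapT => nU; apply: ny => U oU Uy; rewrite lt_neqAle measure_ge0 andbT.
  by apply/negP => /eqP PU; apply: nU; exists U.
have /nbhs_ballP[r /= r0 rU] : nbhs y U by exact: open_nbhs_nbhs.
have [a] := rat_in_itvoo (ltac:(lra) : y - r < y).
have [b] := rat_in_itvoo (ltac:(lra) : y < y + r).
rewrite !in_itv /= => /andP[yb br] /andP[ra ay].
have sub : `](ratr a : R), ratr b[%classic `<=` U.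
  move=> z /=; rewrite in_itv /= => /andP[az zb]; apply: rU.
  by rewrite /ball /= ltr_distlC; apply/andP; split; lra.
have coverE : cover (pickle (a, b)) = `](ratr a : R), ratr b[%classic.
  rewrite /cover pickleK ifT // eq_le measure_ge0 andbT -PU le_measure ?inE //.
  - by apply: measurable_coordinate; exact: measurable_itv.
  - by apply: measurable_coordinate; exact: open_measurable.
  - exact: preimage_subset.
exists (pickle (a, b)); first exact: Logic.I.
change (cover (pickle (a, b)) y); rewrite coverE.
by rewrite /= in_itv /= ay yb.
Qed.

End Probability.

Lemma wprod_ge_pow (R : realType) (w : nat -> R) (x : R) n N : 0 <= x ->
  (forall s, (s < N)%N -> x <= w (n + s)%N) -> x ^+ N <= wprod w n N.
Proof.
move=> x0; elim: N => [|N IH] h; first by rewrite expr0 /wprod addn0 big_geq.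
rewrite wprodS exprSr ler_pM ?exprn_ge0 //; last exact: h.
by apply: IH => s sN; apply: h; exact: ltnW.
Qed.

Lemma bernoulli (R : realType) (x : R) N : 0 <= x <= 1 -> 1 - N%:R * x <= (1 - x) ^+ N.
Proof.
move=> /andP[x0 x1]; elim: N => [|N IH]; first by rewrite mul0r subr0 expr0.
have Nx : 0 <= N%:R * x by rewrite mulr_ge0.
by rewrite exprS -natr1; nra.
Qed.

Lemma wprod_decay (R : realType) (w : nat -> R) (r : R) :
  (forall n, 0 <= w n <= 1) -> 0 <= r < 1 ->
  (forall M, exists2 n, (M <= n)%N & w n <= r) ->
  forall M (eps : R), 0 < eps -> exists k, wprod w M k <= eps.
Proof.
move=> w01 /andP[r0 r1] inf M eps e0.
have pow K : exists k, wprod w M k <= r ^+ K.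
  elim: K => [|K [k hk]]; first by exists 0%N; rewrite expr0 /wprod addn0 big_geq.
  have [n Mn wn] := inf (M + k)%N.
  exists (n - M).+1; rewrite wprodS exprSr.
  have -> : (M + (n - M) = n)%N by apply: subnKC; apply: leq_trans (leq_addr _ _) Mn.
  have /andP[w0 _] := w01 n; have /andP[W0 _] := wprod_bound w01 M (n - M).
  rewrite ler_pM //; apply: le_trans hk; apply: wprod_le => //.
  by rewrite leq_subRL // (leq_trans (leq_addr _ _) Mn).
have : (fun K => r ^+ K) @ \oo --> (0 : R) by apply: cvg_expr; rewrite ger0_norm.
move=> /cvgrPdist_le/(_ _ e0)[K _ /(_ K (leqnn K))]; rewrite sub0r normrN => h.
by have [k hk] := pow K; exists k; apply: le_trans hk (le_trans (ler_norm _) h).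
Qed.

Theorem theorem7p6 (R : realType) (H : hilbertType R) (e : nat -> H)
    (e_basis : orthonormal_basis e)
    (d : measure_display) (Omega : measurableType d) (P : probability Omega R)
    (X : nat -> {RV P >-> R})
    (X_ge0 : forall n, {ae P, forall w, 0 <= X n w})
    (X_bounded : forall n, exists M : R, {ae P, forall w, X n w <= M})
    (X_indep : mutually_independent X)
    (X_ident : identically_distributed X)
    (T : Omega -> bop H)
    (T_shift : {ae P, forall w, forall n, T w (e n) = (X n w)%:C *: e n.+1})
    (rmin rmax : R)
    (rmin_min : is_min (essran (X 0%N)) rmin)
    (rmax_max : is_max (essran (X 0%N)) rmax)
    (rmin_lt_rmax : rmin < rmax) (rmax1 : rmax = 1) :
  {ae P, forall w, A_aleph0 e (T w)}.
Proof.
subst rmax; case: rmax_max => ess1 ub1; case: rmin_min => essr _.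
(* By Bernoulli's inequality a run of length [N] of weights above [x N] has
   product at least 1/2. *)
pose x N : R := 1 - (2 * N.+1%:R)^-1.
have xP N : 0 <= ((2 * N.+1%:R)^-1 : R) <= 1.
  have h : 1 <= 2 * N.+1%:R :> R by rewrite -natrM ler1n.
  have h0 : 0 < 2 * N.+1%:R :> R by exact: lt_le_trans h.
  by apply/andP; split; [rewrite invr_ge0 ltW | rewrite invf_le1].
have x_lt1 N : x N < 1.
  by rewrite /x ltrBlDr ltrDl invr_gt0 mulr_gt0.
have runs N : {ae P, forall w, forall M, exists2 n, (M <= n)%N &
    forall s, (s < N)%N -> `]x N, +oo[%classic (X (n + s)%N w)}.
  have oB : open `]x N, +oo[%classic by exact: interval_open.
  apply: (ae_recurrent_run X_indep X_ident N (open_measurable oB)).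
  by apply: (essran_gt0 ess1 oB); rewrite /= in_itv /= x_lt1.
pose r : R := (rmin + 1) / 2.
have lows : {ae P, forall w, forall M, exists2 n, (M <= n)%N &
    forall s, (s < 1)%N -> `]-oo, r[%classic (X (n + s)%N w)}.
  have oB : open `]-oo, r[%classic by exact: interval_open.
  apply: (ae_recurrent_run X_indep X_ident 1 (open_measurable oB)).
  by apply: (essran_gt0 essr oB); rewrite /= in_itv /= /r; lra.
have runs' : {ae P, forall w, forall N, forall M, exists2 n, (M <= n)%N &
    forall s, (s < N)%N -> `]x N, +oo[%classic (X (n + s)%N w)} by exact/ae_foralln.
have X_ge0' : {ae P, forall w, forall n, 0 <= X n w} by exact/ae_foralln.
have X_le1 := ae_le_max_essran X_ident ub1.
near=> w.
have Tw : forall n, T w (e n) = (X n w)%:C *: e n.+1 by near: w.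
have X0w : forall n, 0 <= X n w by near: w.
have X1w : forall n, X n w <= 1 by near: w.
have runw : forall N M, exists2 n, (M <= n)%N &
    forall s, (s < N)%N -> `]x N, +oo[%classic (X (n + s)%N w) by near: w.
have loww : forall M, exists2 n, (M <= n)%N &
    forall s, (s < 1)%N -> `]-oo, r[%classic (X (n + s)%N w) by near: w.
have w01 n : 0 <= X n w <= 1 by rewrite X0w X1w.
apply: (@weighted_shift_A_aleph0 _ _ _ e_basis (fun n => X n w)) => //.
- move=> N M; have [n Mn hn] := runw N M.
  exists n => //; apply: (@le_trans _ _ (x N ^+ N)).
    apply: le_trans _ (bernoulli N (xP N)).
    rewrite invfM mulrCA -(natr1 N).
    have N0 : 0 <= N%:R :> R by [].
    have : N%:R / (N%:R + 1) <= 1 :> R by rewrite ler_pdivrMr; lra.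
    lra.
  apply: wprod_ge_pow => [|s sN]; first by rewrite /x subr_ge0; have /andP[] := xP N.
  by have := hn s sN; rewrite /= in_itv /= andbT => /ltW.
- apply: (@wprod_decay _ _ (Num.max 0 r)) => //.
    by rewrite le_max lexx /= gt_max ltr01 /= /r; lra.
  move=> M; have [n Mn hn] := loww M.
  exists n => //; have := hn 0%N isT; rewrite /= addn0 in_itv /= => h.
  by rewrite le_max (ltW h) orbT.
Unshelve. all: by end_near. Qed.
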